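(* Let $f\in L^2(\mathbb R\times\mathbb R^+)$ (with respect to the measure $\frac{dt\,d\zeta}{\zeta^2}$) and let $\psi\in L^2(\mathbb R)$ be an admissible wavelet. Then $f$ belongs to the range of the novel special affine wavelet transform $\mathcal A^{\psi}_{\Lambda_S}$ (i.e. $f=\mathcal A^{\psi}_{\Lambda_S}[g]$ for some $g\in L^2(\mathbb R)$) if and only if $$f(t',\zeta')=\frac1{C_\psi}\int_{\mathbb R\times\mathbb R^+}f(t,\zeta)\,\big\langle\psi^{\Lambda_S}_{t,\zeta},\psi^{\Lambda_S}_{t',\zeta'}\big\rangle_{L^2(\mathbb R)}\,\frac{dt\,d\zeta}{\zeta^2}.$$
   Context: Fix real parameters $A,B,C,D,p,q$ with $AD-BC=1$ and $B\neq0$ (collected in $\Lambda_S$). $z^*$ denotes the complex conjugate of $z$, $\langle f,g\rangle_{L^2(\mathbb R)}=\int_{\mathbb R}fg^*\,dx$, and $\mathbb R^+=(0,\infty)$. Put $K_B=\frac1{\sqrt{2\pi B}}$ and $$\mathcal K_{\Lambda_S}(x,\omega)=K_B^*\exp\left\{\frac{i}{2B}\big(Ax^2+2x(p-\omega)-2\omega(Dp-Bq)+D\omega^2\big)\right\}.$$ The special affine Fourier transform (SAFT) of $f$ is $\widehat f_{\Lambda_S}(\omega)=\int_{\mathbb R}f(x)\,\mathcal K_{\Lambda_S}(x,\omega)\,dx$; it satisfies the Parseval formula $\langle f,g\rangle_{L^2(\mathbb R)}=\langle\widehat f_{\Lambda_S},\widehat g_{\Lambda_S}\rangle_{L^2(\mathbb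 R)}$ for $f,g\in L^2(\mathbb R)$. For $\psi\in L^2(\mathbb R)$, $t\in\mathbb R$, $\zeta\in\mathbb R^+$, put $$\psi^{\Lambda_S}_{t,\zeta}(x)=\frac{K_B}{\sqrt\zeta}\,\psi\left(\frac{x-t}{\zeta}\right)\exp\left\{\frac{iAx(t-x)}{B}\right\}.$$ The novel special affine wavelet transform of $g\in L^2(\mathbb R)$ is $\mathcal A^{\psi}_{\Lambda_S}[g](t,\zeta)=\int_{\mathbb R}g(x)\,\big(\psi^{\Lambda_S}_{t,\zeta}(x)\big)^*dx$. Let $\Psi(x,\zeta)=\exp\left\{\frac{i}{2B}\big(Ax^2(\zeta^2-1)+2xp(\zeta-1)\big)\right\}\psi^*(-x)$ and let $\widehat\Psi_{\Lambda_S}(\zeta\omega,\zeta)$ denote the SAFT of $x\mapsto\Psi(x,\zeta)$ evaluated at $\zeta\omega$. The function $\psi\in L^2(\mathbb R)$ is said to be admissible if $$C_\psi=\int_{\mathbb R^+}\frac{\big|\widehat\Psi_{\Lambda_S}(\zeta\omega,\zeta)\big|^2}{\zeta}\,d\zeta<\infty\quad\text{for a.e. }\omega\in\mathbb R.$$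
   Formalization: The integral defining C_ψ may depend on ω (e.g. A=0 with a one-sided spectrum of ψ), which leaves 1/C_ψ undefined; the formal theorem additionally assumes that this integral equals one finite constant C_ψ for a.e. ω. *)

(* Defs.v *)
From HB Require Import structures.
From mathcomp Require Import all_boot all_order all_algebra.
From mathcomp Require Import complex.
From mathcomp Require Import all_classical all_reals all_analysis.
Import Order.TTheory GRing.Theory Num.Theory.
Import numFieldNormedType.Exports.

Set Implicit Arguments.
Unset Strict Implicit.
Unset Printing Implicit Defensive.

Local Open Scope classical_set_scope.
Local Open Scope ring_scope.
Local Open Scope complex_scope.

(* The projections R[i] -> R, not the R[i]-valued parts of a closed field. *)
Local Notation Re := complex.Re.
Local Notation Im := complex.Im.

(* The library has no integral of complex-valued functions: integration,
   measurability and square-integrability over R[i] are taken componentwise. *)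
Section ComplexIntegral.
Context d (T : measurableType d) (R : realType).

Definition cmeasurable_fun (D : set T) (f : T -> R[i]) : Prop :=
  measurable_fun D (fun x => Re (f x)) /\ measurable_fun D (fun x => Im (f x)).

Definition Cintegral (mu : {measure set T -> \bar R}) (D : set T)
    (f : T -> R[i]) : R[i] :=
  (\int[mu]_(x in D) Re (f x)) +i* (\int[mu]_(x in D) Im (f x)).

End ComplexIntegral.

Section Saft.
Context (R : realType).

Notation leb := (@lebesgue_measure R).

Definition sqnormc (z : R[i]) : R := Re z ^+ 2 + Im z ^+ 2.

Definition expi (x : R) : R[i] := cos x +i* sin x.

Definition L2 (f : R -> R[i]) : Prop :=
  cmeasurable_fun [set: R] f /\ (\int[leb]_x (sqnormc (f x))%:E < +oo)%E.

Definition inner (f g : R -> R[i]) : R[i] :=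
  Cintegral leb [set: R] (fun x => f x * conjc (g x)).

(* Points (t, zeta) of R x R^+ are pairs z with z.1 = t and z.2 = zeta; the
   measure dt dzeta / zeta ^ 2 is Lebesgue measure with density z.2 ^- 2, and
   has the same null sets on the half-plane. *)
Definition half_plane : set (R * R) := [set: R] `*` `]0, +oo[.

Definition plane_measure := (leb \x leb)%E.

Definition L2_half_plane (f : R * R -> R[i]) : Prop :=
  cmeasurable_fun half_plane f /\
  (\int[plane_measure]_(z in half_plane) (sqnormc (f z) / z.2 ^+ 2)%:E < +oo)%E.

Definition half_plane_integral (F : R * R -> R[i]) : R[i] :=
  Cintegral plane_measure half_plane (fun z => F z * (z.2 ^- 2)%:C).

Record saft_param := SaftParam
  { sA : R; sB : R; sC : R; sD : R; sp : R; sq : R }.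

Variable L : saft_param.
Local Notation A := (sA L).
Local Notation B := (sB L).
Local Notation D := (sD L).
Local Notation p := (sp L).
Local Notation q := (sq L).

(* For B < 0 the square root is the principal one, with positive imaginary
   part. *)
Definition K_B : R[i] := (sqrtc (2 * pi * B)%:C)^-1.

Definition saft_kernel (x w : R) : R[i] :=
  conjc K_B *
  expi ((A * x ^+ 2 + 2 * x * (p - w) - 2 * w * (D * p - B * q) + D * w ^+ 2)
        / (2 * B)).

Definition truncated_saft (f : R -> R[i]) (n : nat) (w : R) : R[i] :=
  Cintegral leb `[- n%:R, n%:R] (fun x => f x * saft_kernel x w).

(* F is (a representative of) the SAFT of f in L^2(R). As f need not be
   integrable, the defining integral converges in the mean, i.e. as the L^2(R)
   limit of the integrals over [-n, n]. *)
Definition is_saft (f F : R -> R[i]) : Prop :=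
  cmeasurable_fun [set: R] F /\
  (fun n => \int[leb]_w (sqnormc (F w - truncated_saft f n w))%:E)%E
    @ \oo --> (0 : \bar R)%E.

Definition wavelet (psi : R -> R[i]) (t zeta x : R) : R[i] :=
  K_B / (Num.sqrt zeta)%:C * psi ((x - t) / zeta) *
  expi (A * x * (t - x) / B).

Definition wavelet_transform (psi g : R -> R[i]) (z : R * R) : R[i] :=
  inner g (wavelet psi z.1 z.2).

Definition Psi (psi : R -> R[i]) (zeta x : R) : R[i] :=
  expi ((A * x ^+ 2 * (zeta ^+ 2 - 1) + 2 * x * p * (zeta - 1)) / (2 * B)) *
  conjc (psi (- x)).

(* G (w, zeta) is a representative of the SAFT of Psi(., zeta) at w. For each
   zeta it is determined for a.e. w only; joint measurability makes
   [admissibility_integral] independent of the choice of G, for a.e. w. *)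
Definition is_saft_Psi (psi : R -> R[i]) (G : R * R -> R[i]) : Prop :=
  cmeasurable_fun half_plane G /\
  forall zeta, 0 < zeta -> is_saft (Psi psi zeta) (fun w => G (w, zeta)).

Definition admissibility_integral (G : R * R -> R[i]) (w : R) : \bar R :=
  (\int[leb]_(zeta in `]0%R, +oo[)
     (sqnormc (G ((zeta * w)%R, zeta)) / zeta)%:E)%E.

Definition admissible (psi : R -> R[i]) : Prop :=
  exists2 G, is_saft_Psi psi G &
    {ae leb, forall w, (admissibility_integral G w < +oo)%E}.

(* c is the constant C_psi: the integral takes the value c for a.e. w. *)
Definition is_admissibility_constant (psi : R -> R[i]) (c : R) : Prop :=
  exists2 G, is_saft_Psi psi G &
    {ae leb, forall w, admissibility_integral G w = c%:E}.

End Saft.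

(* Main.v *)
(* With [h x = g x * expi (A x^2 / 2B)] and
   [phi y = conjc (psi (- y / zeta)) * expi (A y^2 / 2B)], the modulus of
   [wavelet_transform L psi g (t, zeta)] squared is
   [|(h * phi) t|^2 / (2 pi |B| zeta)].  When [h] is continuous with compact
   support, Plancherel's formula and Tonelli's theorem turn the half-plane norm
   of the transform into [c] times the norm of [g], since the Fourier transform
   of [phi] is the SAFT occurring in [c]; density and Fatou's lemma extend this
   to every square-integrable [g].  By polarization the transform is [sqrt c]
   times an isometry, so the reproducing integral of [f] at [z'] is the inner
   product of [f] with the transform of the wavelet at [z'].  If [f] is in the
   range this is [c * f z']; conversely, Riesz representation of
   [k |-> <f, wavelet_transform L psi k>] provides the preimage of [f]. *)

(* The constant [c] is defined through SAFTs that exist only as limits in the mean, whereas the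
   Fourier transform used here is a plain integral. A continuous [h] with compact support bridges
   the two: its Fourier transform is bounded, and convolution with it is bounded on L2, so
   Plancherel's formula for [h * phi] with [phi] cut off to a bounded interval passes to the limit
   on both sides. Plancherel's formula itself is a statement about one value at the origin: the
   squared modulus of a Fourier transform is the transform of an autocorrelation, and because it is
   nonnegative its Abel means increase to its integral. Integrals are componentwise, so the Hilbert
   space arguments run on squared norms and real parts; imaginary parts are recovered by replacing a
   vector by [i] times it. The constant [c] may be 0. Then [c^-1] is 0 as well, and both sides of
   the equivalence say that [f] vanishes almost everywhere. *)
Require Import Defs.
From HB Require Import structures.
From mathcomp Require Import all_boot all_order all_algebra.
From mathcomp Require Import complex.
From mathcomp Require Import ring lra.
From mathcomp Require Import all_classical all_reals all_analysis.
From mathcomp Require Import measurable_realfun.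
Import Order.TTheory GRing.Theory Num.Theory.
Import numFieldNormedType.Exports.

Local Open Scope classical_set_scope.
Local Open Scope ring_scope.
Local Open Scope complex_scope.

(** * Square-integrable complex functions *)

Set Implicit Arguments.
Unset Strict Implicit.
Unset Printing Implicit Defensive.

Local Notation Re := complex.Re.
Local Notation Im := complex.Im.

Section ComplexAlgebra.
Context (R : realType).
Implicit Types z w : R[i].

Lemma cReD z w : Re (z + w) = Re z + Re w. Proof. by case: z w => [? ?] []. Qed.
Lemma cImD z w : Im (z + w) = Im z + Im w. Proof. by case: z w => [? ?] []. Qed.
Lemma cReN z : Re (- z) = - Re z. Proof. by case: z. Qed.
Lemma cImN z : Im (- z) = - Im z. Proof. by case: z. Qed.
Lemma cReM z w : Re (z * w) = Re z * Re w - Im z * Im w.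
Proof. by case: z w => [? ?] []. Qed.
Lemma cImM z w : Im (z * w) = Re z * Im w + Im z * Re w.
Proof. by case: z w => [? ?] []. Qed.
Lemma cReJ z : Re (conjc z) = Re z. Proof. by case: z. Qed.
Lemma cImJ z : Im (conjc z) = - Im z. Proof. by case: z. Qed.
Lemma conjcM z w : conjc (z * w) = conjc z * conjc w.
Proof. exact: rmorphM. Qed.
Lemma conjcD z w : conjc (z + w) = conjc z + conjc w.
Proof. exact: rmorphD. Qed.
Definition ReImE := (cReD, cImD, cReN, cImN, cReM, cImM, cReJ, cImJ).

Lemma cReZ (x : R) z : Re (x%:C * z) = x * Re z.
Proof. by case: z => a b; rewrite cReM /= mul0r subr0. Qed.
Lemma cImZ (x : R) z : Im (x%:C * z) = x * Im z.
Proof. by case: z => a b; rewrite cImM /= mul0r addr0. Qed.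
(** Polarization and Riesz representation control real parts only; pairing with [i] times a vector
    reaches the imaginary part. *)
Lemma cRe_conjiM z : Re (conjc (0 +i* 1) * z) = Im z.
Proof. by case: z => a b; rewrite cReM /=; ring. Qed.

Lemma complex_ext z w : Re z = Re w -> Im z = Im w -> z = w.
Proof. by case: z w => [? ?] [? ?] /= -> ->. Qed.

Lemma sqnormc_ge0 z : 0 <= sqnormc z.
Proof. by rewrite addr_ge0// sqr_ge0. Qed.
Lemma sqnormcM z w : sqnormc (z * w) = sqnormc z * sqnormc w.
Proof. by rewrite /sqnormc !ReImE; ring. Qed.
Lemma sqnormcJ z : sqnormc (conjc z) = sqnormc z.
Proof. by rewrite /sqnormc !ReImE; ring. Qed.
Lemma sqnormcN z : sqnormc (- z) = sqnormc z.
Proof. by rewrite /sqnormc !ReImE; ring. Qed.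
Lemma sqnormc_real (x : R) : sqnormc x%:C = x ^+ 2.
Proof. by rewrite /sqnormc /=; ring. Qed.
Lemma sqnormc0 : sqnormc (0 : R[i]) = 0.
Proof. by rewrite /sqnormc /=; ring. Qed.
Lemma sqnormc_expi (x : R) : sqnormc (expi x) = 1.
Proof. by rewrite /sqnormc /= cos2Dsin2. Qed.
Lemma sqnormcD_le z w : sqnormc (z + w) <= 2 * sqnormc z + 2 * sqnormc w.
Proof.
case: z w => [a b] [c e]; rewrite /sqnormc /=.
have := sqr_ge0 (a - c); have := sqr_ge0 (b - e); nra.
Qed.
Lemma mulcJ z : z * conjc z = (sqnormc z)%:C.
Proof. by apply: complex_ext; rewrite !ReImE /sqnormc /=; ring. Qed.
Lemma sqnormc_eq0 z : sqnormc z = 0 -> z = 0.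
Proof.
move=> /eqP; rewrite paddr_eq0 ?sqr_ge0// !sqrf_eq0 => /andP[/eqP a /eqP b].
exact: complex_ext.
Qed.

Lemma expiD (x y : R) : expi (x + y) = expi x * expi y.
Proof. by apply: complex_ext; rewrite !ReImE /= ?cosD ?sinD; ring. Qed.
Lemma expiN (x : R) : expi (- x) = conjc (expi x).
Proof. by apply: complex_ext; rewrite ?ReImE /= ?cosN ?sinN. Qed.

Lemma normrM_Re z w : `|Re (z * w)| <= sqnormc z + sqnormc w.
Proof.
case: z w => [a b] [c e]; rewrite ler_norml /sqnormc /=.
have := sqr_ge0 (a - c); have := sqr_ge0 (b - e).
have := sqr_ge0 (a + c); have := sqr_ge0 (b + e).
by move=> *; apply/andP; split; nra.
Qed.
Lemma normrM_Im z w : `|Im (z * w)| <= sqnormc z + sqnormc w.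
Proof.
case: z w => [a b] [c e]; rewrite ler_norml /sqnormc /=.
have := sqr_ge0 (a - e); have := sqr_ge0 (b - c).
have := sqr_ge0 (a + e); have := sqr_ge0 (b + c).
by move=> *; apply/andP; split; nra.
Qed.

End ComplexAlgebra.

Section ComplexMeasurability.
Context d (T : measurableType d) (R : realType) (D : set T).
Implicit Types f g : T -> R[i].

Lemma cmeasurable_funD f g : cmeasurable_fun D f -> cmeasurable_fun D g ->
  cmeasurable_fun D (fun x => f x + g x).
Proof.
move=> [? ?] [? ?]; split; under eq_fun do rewrite ReImE;
  exact: measurable_funD.
Qed.

Lemma cmeasurable_funM f g : cmeasurable_fun D f -> cmeasurable_fun D g ->
  cmeasurable_fun D (fun x => f x * g x).
Proof.
move=> [? ?] [? ?]; split; under eq_fun do rewrite ReImE.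
  by apply: measurable_funB; exact: measurable_funM.
by apply: measurable_funD; exact: measurable_funM.
Qed.

Lemma cmeasurable_conjc f : cmeasurable_fun D f ->
  cmeasurable_fun D (fun x => conjc (f x)).
Proof.
move=> [? ?]; split; first by under eq_fun do rewrite cReJ.
by under eq_fun do rewrite cImJ; exact: measurable_funN.
Qed.

Lemma cmeasurable_cst (z : R[i]) : cmeasurable_fun D (fun=> z).
Proof. by split; exact: measurable_cst. Qed.

Lemma cmeasurable_real (f : T -> R) : measurable_fun D f ->
  cmeasurable_fun D (fun x => (f x)%:C).
Proof. by move=> mf; split => //=; exact: measurable_cst. Qed.

Lemma cmeasurable_expi (f : T -> R) : measurable_fun D f ->
  cmeasurable_fun D (fun x => expi (f x)).
Proof.
move=> mf; split => /=.
  by apply: measurableT_comp => //; apply: continuous_measurable_fun; exact: continuous_cos.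
by apply: measurableT_comp => //; apply: continuous_measurable_fun; exact: continuous_sin.
Qed.

Lemma measurable_sqnormc f : cmeasurable_fun D f ->
  measurable_fun D (fun x => sqnormc (f x)).
Proof. by move=> [? ?]; apply: measurable_funD; exact: measurable_funX. Qed.

End ComplexMeasurability.

Section L2space.
Context d (T : measurableType d) (R : realType) (mu : {measure set T -> \bar R}).
Context (D : set T) (mD : measurable D).
Implicit Types f g h : T -> R[i].

Definition Cintegrable f := mu.-integrable D (EFin \o (fun x => Re (f x))) /\
  mu.-integrable D (EFin \o (fun x => Im (f x))).

Definition L2on f := cmeasurable_fun D f /\
  (\int[mu]_(x in D) (sqnormc (f x))%:E < +oo)%E.

Definition dotp f g := Cintegral mu D (fun x => f x * conjc (g x)).

Definition nrm2 f : R := \int[mu]_(x in D) sqnormc (f x).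

Lemma Cintegrable_meas f : Cintegrable f -> cmeasurable_fun D f.
Proof.
by move=> [/measurable_int/measurable_EFinP ? /measurable_int/measurable_EFinP ?].
Qed.

Lemma CintegralD f g : Cintegrable f -> Cintegrable g ->
  Cintegral mu D (fun x => f x + g x) = Cintegral mu D f + Cintegral mu D g.
Proof.
move=> [? ?] [? ?]; apply: complex_ext; rewrite ReImE /=.
  by under eq_Rintegral do rewrite cReD; rewrite RintegralD.
by under eq_Rintegral do rewrite cImD; rewrite RintegralD.
Qed.

Lemma integrableZE (k : R) (f : T -> R) : mu.-integrable D (EFin \o f) ->
  mu.-integrable D (EFin \o (fun x => k * f x)).
Proof. by move=> fi; exact: (integrableZl mD k fi). Qed.

Lemma integrableDE (f g : T -> R) : mu.-integrable D (EFin \o f) ->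
  mu.-integrable D (EFin \o g) -> mu.-integrable D (EFin \o (fun x => f x + g x)).
Proof. by move=> fi gi; exact: (integrableD mD fi gi). Qed.

Lemma integrableBE (f g : T -> R) : mu.-integrable D (EFin \o f) ->
  mu.-integrable D (EFin \o g) -> mu.-integrable D (EFin \o (fun x => f x - g x)).
Proof. by move=> fi gi; exact: (integrableB mD fi gi). Qed.

Lemma CintegrableZ (z : R[i]) f : Cintegrable f -> Cintegrable (fun x => z * f x).
Proof.
move=> [? ?]; split; under eq_fun do rewrite ReImE.
  by apply: integrableBE; exact: integrableZE.
by apply: integrableDE; exact: integrableZE.
Qed.

Lemma CintegralZ (z : R[i]) f : Cintegrable f ->
  Cintegral mu D (fun x => z * f x) = z * Cintegral mu D f.
Proof.
move=> [? ?]; apply: complex_ext; rewrite ReImE /=.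
  under eq_Rintegral do rewrite cReM.
  by rewrite RintegralB ?RintegralZl//; exact: integrableZE.
under eq_Rintegral do rewrite cImM.
by rewrite RintegralD ?RintegralZl//; exact: integrableZE.
Qed.

Lemma CintegralJ f : Cintegrable f ->
  Cintegral mu D (fun x => conjc (f x)) = conjc (Cintegral mu D f).
Proof.
move=> [? ?]; apply: complex_ext; rewrite ReImE /=.
  by under eq_Rintegral do rewrite cReJ.
under eq_Rintegral do rewrite cImJ -mulN1r.
by rewrite RintegralZl// mulN1r.
Qed.

Lemma eq_Cintegral f g : (forall x, D x -> f x = g x) ->
  Cintegral mu D f = Cintegral mu D g.
Proof.
by move=> fg; congr (_ +i* _); apply: eq_Rintegral => x xD; rewrite fg//;
  exact: set_mem.
Qed.

Lemma L2on_integrable f : L2on f ->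
  mu.-integrable D (EFin \o (fun x => sqnormc (f x))).
Proof.
move=> [mf fi]; apply/integrableP; split.
  exact/measurable_EFinP/measurable_sqnormc.
apply: le_lt_trans fi; apply: ge0_le_integral => //.
- apply/measurableT_comp => //; exact/measurable_EFinP/measurable_sqnormc.
- by apply/measurable_EFinP/measurable_sqnormc.
- by move=> x _ /=; rewrite ger0_norm ?sqnormc_ge0.
Qed.

Lemma nrm2E f : L2on f -> (nrm2 f)%:E = (\int[mu]_(x in D) (sqnormc (f x))%:E)%E.
Proof.
move=> /L2on_integrable fi; rewrite /nrm2 /Rintegral fineK//.
exact: integrable_fin_num.
Qed.

Lemma nrm2_ge0 f : 0 <= nrm2 f.
Proof. by apply: Rintegral_ge0 => x _; exact: sqnormc_ge0. Qed.

Lemma L2on_le (b : R) f : cmeasurable_fun D f ->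
  (\int[mu]_(x in D) (sqnormc (f x))%:E <= b%:E)%E -> L2on f /\ nrm2 f <= b.
Proof.
move=> mf fb; have L : L2on f by split => //; exact: le_lt_trans (ltry b).
by split => //; rewrite -lee_fin nrm2E.
Qed.

Lemma L2on_dom f (b : T -> R) : cmeasurable_fun D f ->
  mu.-integrable D (EFin \o b) -> (forall x, D x -> sqnormc (f x) <= b x) -> L2on f.
Proof.
move=> mf /integrableP[mb ib] fb; split => //; apply: le_lt_trans ib.
apply: ge0_le_integral => //.
- by move=> x _; rewrite lee_fin sqnormc_ge0.
- by apply/measurable_EFinP/measurable_sqnormc.
- exact/measurableT_comp.
- by move=> x Dx; rewrite lee_fin (le_trans (fb x Dx))// ler_norm.
Qed.

Lemma L2onD f g : L2on f -> L2on g -> L2on (fun x => f x + g x).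
Proof.
move=> Lf Lg; apply: (@L2on_dom _ (fun x => 2 * sqnormc (f x) + 2 * sqnormc (g x))).
- by apply: cmeasurable_funD; [case: Lf|case: Lg].
- by apply: integrableDE; apply: integrableZE; exact: L2on_integrable.
- by move=> x _; exact: sqnormcD_le.
Qed.

Lemma L2onZ (z : R[i]) f : L2on f -> L2on (fun x => z * f x).
Proof.
move=> Lf; apply: (@L2on_dom _ (fun x => sqnormc z * sqnormc (f x))).
- by apply: cmeasurable_funM; [exact: cmeasurable_cst|case: Lf].
- by apply: integrableZE; exact: L2on_integrable.
- by move=> x _; rewrite sqnormcM.
Qed.

Lemma L2onN f : L2on f -> L2on (fun x => - f x).
Proof. by move=> /(L2onZ (-1)); under eq_fun do rewrite mulN1r. Qed.

Lemma L2onB f g : L2on f -> L2on g -> L2on (fun x => f x - g x).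
Proof. by move=> Lf /L2onN; exact: L2onD. Qed.

Lemma L2onJ f : L2on f -> L2on (fun x => conjc (f x)).
Proof.
move=> Lf; apply: (@L2on_dom _ (fun x => sqnormc (f x))).
- by apply: cmeasurable_conjc; case: Lf.
- exact: L2on_integrable.
- by move=> x _; rewrite sqnormcJ.
Qed.

Lemma CintegrableM f g : L2on f -> L2on g -> Cintegrable (fun x => f x * g x).
Proof.
move=> Lf Lg; have [mr mi] : cmeasurable_fun D (fun x => f x * g x).
  by apply: cmeasurable_funM; [case: Lf|case: Lg].
have ib : mu.-integrable D (EFin \o (fun x => sqnormc (f x) + sqnormc (g x))).
  by apply: integrableDE; exact: L2on_integrable.
have b0 x : 0 <= sqnormc (f x) + sqnormc (g x) by rewrite addr_ge0 ?sqnormc_ge0.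
split; apply: le_integrable ib => //; try exact/measurable_EFinP;
  move=> x Dx /=; rewrite lee_fin (ger0_norm (b0 x)).
  exact: normrM_Re.
exact: normrM_Im.
Qed.

Lemma dotp_Cintegrable f g : L2on f -> L2on g ->
  Cintegrable (fun x => f x * conjc (g x)).
Proof. by move=> Lf Lg; apply: CintegrableM => //; exact: L2onJ. Qed.

Lemma dotpDl f g h : L2on f -> L2on g -> L2on h ->
  dotp (fun x => f x + g x) h = dotp f h + dotp g h.
Proof.
move=> Lf Lg Lh; rewrite /dotp.
rewrite -CintegralD; try exact: dotp_Cintegrable.
by congr Cintegral; apply/funext => x; rewrite mulrDl.
Qed.

Lemma dotpZl z f g : L2on f -> L2on g ->
  dotp (fun x => z * f x) g = z * dotp f g.
Proof.
move=> Lf Lg; rewrite /dotp -CintegralZ; last exact: dotp_Cintegrable.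
by congr Cintegral; apply/funext => x; rewrite mulrA.
Qed.

Lemma dotpC f g : L2on f -> L2on g -> dotp f g = conjc (dotp g f).
Proof.
move=> Lf Lg; rewrite /dotp -CintegralJ; last exact: dotp_Cintegrable.
by congr Cintegral; apply/funext => x; rewrite conjcM conjcK mulrC.
Qed.

Lemma dotpDr f g h : L2on f -> L2on g -> L2on h ->
  dotp f (fun x => g x + h x) = dotp f g + dotp f h.
Proof.
move=> Lf Lg Lh; rewrite dotpC//; last exact: L2onD.
by rewrite dotpDl// conjcD -!dotpC.
Qed.

Lemma dotpZr z f g : L2on f -> L2on g ->
  dotp f (fun x => z * g x) = conjc z * dotp f g.
Proof.
move=> Lf Lg; rewrite dotpC//; last exact: L2onZ.
by rewrite dotpZl// conjcM -dotpC.
Qed.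

Lemma dotpff f : dotp f f = (nrm2 f)%:C.
Proof.
rewrite /dotp (_ : (fun x => _) = (fun x => (sqnormc (f x))%:C)).
  rewrite /Cintegral /=; congr (_ +i* _).
  by rewrite /Rintegral; under eq_integral do rewrite /=; rewrite integral0.
by apply/funext => x; rewrite mulcJ.
Qed.

Lemma nrm2D f g : L2on f -> L2on g ->
  nrm2 (fun x => f x + g x) = nrm2 f + nrm2 g + 2 * Re (dotp f g).
Proof.
move=> Lf Lg; have Lfg := L2onD Lf Lg.
have := dotpff (fun x => f x + g x).
rewrite dotpDl// !dotpDr// !dotpff (dotpC Lg Lf) => /(congr1 (@Re R)).
by rewrite !ReImE /= => <-; ring.
Qed.

Lemma nrm2Z z f : L2on f -> nrm2 (fun x => z * f x) = sqnormc z * nrm2 f.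
Proof.
move=> Lf; rewrite /nrm2; under eq_Rintegral do rewrite sqnormcM.
by rewrite RintegralZl//; exact: L2on_integrable.
Qed.

Lemma nrm2N f : nrm2 (fun x => - f x) = nrm2 f.
Proof. by rewrite /nrm2; under eq_Rintegral do rewrite sqnormcN. Qed.

Lemma nrm2B f g : L2on f -> L2on g ->
  nrm2 (fun x => f x - g x) = nrm2 f + nrm2 g - 2 * Re (dotp f g).
Proof.
move=> Lf Lg; rewrite nrm2D//; last exact: L2onN.
rewrite nrm2N.
have -> : dotp f (fun x => - g x) = - dotp f g.
  under eq_fun do rewrite -mulN1r.
  by rewrite dotpZr// rmorphN rmorph1 mulN1r.
by rewrite cReN mulrN.
Qed.

Lemma CauchySchwarz f g : L2on f -> L2on g ->
  sqnormc (dotp f g) <= nrm2 f * nrm2 g.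
Proof.
(* This is the squared norm of [f - t <f, g> g]. The factor [<f, g>] makes the cross term real, so
   that real [t] are enough. *)
move=> Lf Lg; have key (t : R) :
    0 <= nrm2 f + t ^+ 2 * (sqnormc (dotp f g) * nrm2 g) - 2 * t * sqnormc (dotp f g).
  have := nrm2_ge0 (fun x => f x - (t%:C * dotp f g) * g x).
  rewrite nrm2B//; last exact: L2onZ.
  rewrite dotpZr// nrm2Z// sqnormcM sqnormc_real.
  have -> : conjc (t%:C * dotp f g) * dotp f g = (t * sqnormc (dotp f g))%:C.
    by rewrite conjcM conjc_real -mulrA [conjc _ * _]mulrC mulcJ rmorphM.
  rewrite /= => h; apply: le_trans h _.
  by rewrite le_eqVlt; apply/orP; left; apply/eqP; ring.
have [s0|] := eqVneq (sqnormc (dotp f g)) 0.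
  by rewrite s0 mulr_ge0 ?nrm2_ge0.
move=> s0; have sp : 0 < sqnormc (dotp f g) by rewrite lt_def s0 sqnormc_ge0.
have [g0|g0] := eqVneq (nrm2 g) 0.
  (* With [nrm2 g = 0] the expression is affine in [t]; this [t] gives it the value -1. *)
  have := key ((nrm2 f + 1) / (2 * sqnormc (dotp f g))).
  rewrite g0 !mulr0 addr0 => h; exfalso; move: h.
  rewrite (_ : _ - _ = -1); first by rewrite oppr_ge0 ler10.
  by field.
have gp : 0 < nrm2 g by rewrite lt_def g0 nrm2_ge0.
have := key (nrm2 g)^-1.
rewrite (_ : _ - _ = nrm2 f - sqnormc (dotp f g) / nrm2 g); last by field.
by rewrite subr_ge0 ler_pdivrMr.
Qed.

Lemma CauchySchwarz_Re f g : L2on f -> L2on g ->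
  Re (dotp f g) ^+ 2 <= nrm2 f * nrm2 g.
Proof.
move=> Lf Lg; apply: le_trans (CauchySchwarz Lf Lg).
by rewrite /sqnormc lerDl sqr_ge0.
Qed.

Lemma L2on0 : L2on (fun=> 0).
Proof.
split; first exact: cmeasurable_cst.
by under eq_integral do rewrite sqnormc0; rewrite integral0.
Qed.

Lemma nrm2_eq0 f : L2on f -> nrm2 f = 0 -> f = (fun=> 0) %[ae mu in D].
Proof.
move=> Lf f0; have := nrm2E Lf; rewrite f0 => /esym h.
have [mf _] := Lf.
have := (@ae_eq_integral_abs _ _ _ mu _ mD (fun x => (sqnormc (f x))%:E)).
move=> /(_ (proj2 (measurable_EFinP _ _) (measurable_sqnormc mf)))[+ _].
rewrite (_ : (\int[mu]_(x in D) _ = 0)%E); last first.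
  rewrite -[RHS]h; apply: eq_integral => x _ /=; by rewrite ger0_norm ?sqnormc_ge0.
move=> /(_ erefl); apply: filterS => x /= + Dx => /(_ Dx) [e].
exact: sqnormc_eq0.
Qed.

(** Write [f_ n] as [f + (f_ n - f)] and expand: the cross term tends to 0 by Cauchy-Schwarz. *)
Lemma nrm2_cvg f (f_ : nat -> T -> R[i]) : L2on f -> (forall n, L2on (f_ n)) ->
  (fun n => nrm2 (fun x => f_ n x - f x)) @ \oo --> (0 : R) ->
  (fun n => nrm2 (f_ n)) @ \oo --> nrm2 f.
Proof.
move=> Lf Lf_ h.
have LB n : L2on (fun x => f_ n x - f x) by exact: L2onB.
have E n : nrm2 (f_ n) = nrm2 f + nrm2 (fun x => f_ n x - f x) +
    2 * Re (dotp f (fun x => f_ n x - f x)).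
  rewrite -nrm2D//; congr nrm2; apply/funext => x; ring.
rewrite (_ : (fun n => _) = (fun n => nrm2 f + nrm2 (fun x => f_ n x - f x) +
    2 * Re (dotp f (fun x => f_ n x - f x)))); last exact/funext.
rewrite [X in _ --> X](_ : nrm2 f = nrm2 f + 0 + 0); last by rewrite !addr0.
apply: cvgD; first by apply: cvgD => //; exact: cvg_cst.
rewrite -(mulr0 2); apply: cvgMl_tmp.
apply/norm_cvg0P.
have h2 : (fun n => Num.sqrt (nrm2 f * nrm2 (fun x => f_ n x - f x))) @ \oo --> (0 : R).
  rewrite -sqrtr0; apply: continuous_cvg; first exact: sqrt_continuous.
  by rewrite -(mulr0 (nrm2 f)); exact: cvgMl_tmp.
apply: (squeeze_cvgr _ _ h2 ); last exact: cvg_cst.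
apply: nearW => n; rewrite normr_ge0/=.
rewrite -sqrtr_sqr ler_wsqrtr//; exact: CauchySchwarz_Re.
Qed.

End L2space.

(** * Completeness and Riesz representation *)

Section SeqComplex.
Context (R : realType).
Implicit Types u : nat -> R[i].

(** Cauchy-Schwarz for two weighted terms: the cross term is at most twice the root of [S Q s q],
    hence at most [S q + s Q]. In this form it is the induction step for a telescoping sum, [S]
    collecting the inverse weights and [Q] the weighted squares. *)
Lemma sqnormcD_le_weighted (z w : R[i]) (S s Q q : R) :
  0 <= S -> 0 <= s -> 0 <= Q -> 0 <= q ->
  sqnormc z <= S * Q -> sqnormc w <= s * q ->
  sqnormc (z + w) <= (S + s) * (Q + q).
Proof.
move=> S0 s0 Q0 q0 hz hw.
have E : sqnormc (z + w) = sqnormc z + sqnormc w + 2 * Re (z * conjc w).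
  by rewrite /sqnormc !ReImE; ring.
have h1 : (2 * Re (z * conjc w)) ^+ 2 <= (S * q + s * Q) ^+ 2.
  apply: (@le_trans _ _ (4 * (sqnormc z * sqnormc w))).
    rewrite -(sqnormcJ w) -sqnormcM [X in _ <= _ * X]/sqnormc.
    have := sqr_ge0 (Im (z * conjc w)); nra.
  apply: (@le_trans _ _ (4 * ((S * Q) * (s * q)))).
    by rewrite ler_wpM2l// ler_pM// sqnormc_ge0.
  have := sqr_ge0 (S * q - s * Q); nra.
have h2 : 0 <= S * q + s * Q by rewrite addr_ge0 ?mulr_ge0.
have h3 : 2 * Re (z * conjc w) <= S * q + s * Q.
  rewrite (le_trans (ler_norm _))// -(ger0_norm h2) -ler_sqr ?nnegrE//.
  by rewrite !real_normK ?num_real.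
rewrite E; nra.
Qed.

Lemma sqnormc_telescope_le u (r : R) :
  (forall m, \sum_(0 <= j < m) 2 ^+ j * sqnormc (u j.+1 - u j) <= r) ->
  forall n m, sqnormc (u (n + m)%N - u n) <= (2 * r) * 2^-1 ^+ n.
Proof.
move=> ur n m.
have p0 k : 0 < (2^-1 : R) ^+ k by rewrite exprn_gt0.
pose Q k := \sum_(n <= j < k) 2 ^+ j * sqnormc (u j.+1 - u j).
have Q0 k : 0 <= Q k.
  by apply: sumr_ge0 => j _; rewrite mulr_ge0 ?sqnormc_ge0// exprn_ge0.
have mono k : (2^-1 : R) ^+ (n + k) <= 2^-1 ^+ n.
  rewrite exprD; apply: ler_piMr; first exact: ltW.
  by apply: exprn_ile1 => //; rewrite invf_le1// ler1n.
(* The first factor is the sum of [2^-j] over [n <= j < n + k] in closed form, so that the induction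
   adds exactly [2^-(n + k)] to it. *)
have key k : sqnormc (u (n + k)%N - u n) <=
    (2 * 2^-1 ^+ n - 2 * 2^-1 ^+ (n + k)) * Q (n + k)%N.
  elim: k => [|k IH]; first by rewrite addn0 !subrr mul0r sqnormc0.
  rewrite addnS /Q big_nat_recr ?leq_addr//= -/(Q _).
  have -> : u (n + k).+1 - u n = (u (n + k)%N - u n) + (u (n + k).+1 - u (n + k)%N).
    by ring.
  have -> : 2 * 2^-1 ^+ n - 2 * (2^-1 : R) ^+ (n + k).+1 =
      (2 * 2^-1 ^+ n - 2 * 2^-1 ^+ (n + k)) + 2^-1 ^+ (n + k).
    by rewrite exprS; field.
  apply: sqnormcD_le_weighted => //.
  - by have := mono k; lra.
  - by rewrite mulr_ge0 ?sqnormc_ge0// exprn_ge0.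
  - by rewrite mulrA -exprMn mulVf// expr1n mul1r.
apply: (le_trans (key m)).
have Qr : Q (n + m)%N <= r.
  apply: le_trans (ur (n + m)%N).
  rewrite [leRHS](@big_cat_nat _ _ _ n)//= ?leq_addr// lerDr.
  by apply: sumr_ge0 => j _; rewrite mulr_ge0 ?sqnormc_ge0// exprn_ge0.
have := p0 n; have := p0 (n + m)%N; have := mono m; have := Q0 (n + m)%N; nra.
Qed.

Lemma cvg_real_fast (v : nat -> R) (b : R) :
  (forall n m, (v (n + m)%N - v n) ^+ 2 <= b * 2^-1 ^+ n) -> cvgn v.
Proof.
move=> vb; apply: cauchy_cvg; apply: cauchy_exP => e e0.
have : (fun n => b * (2^-1 : R) ^+ n) @ \oo --> (0 : R).
  by apply: cvg_geometric; rewrite ger0_norm// invf_lt1// ltr1n.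
move=> /cvgrPdist_lt /(_ (e ^+ 2)); rewrite exprn_gt0// => /(_ isT)[n _ hn].
exists (v n); exists n => // m /= nm.
rewrite /ball /= distrC -ltr_sqr ?nnegrE ?(ltW e0)// real_normK ?num_real//.
rewrite -(subnKC nm); apply: (le_lt_trans (vb n _)).
have := hn n (leqnn _); rewrite sub0r normrN.
by apply: le_lt_trans; exact: ler_norm.
Qed.

Lemma cvg_complex_fast u (b : R) :
  (forall n m, sqnormc (u (n + m)%N - u n) <= b * 2^-1 ^+ n) ->
  [/\ cvgn (fun n => Re (u n)), cvgn (fun n => Im (u n)) &
   forall n, sqnormc (u n - ((limn (fun n => Re (u n))) +i*
     (limn (fun n => Im (u n))))) <= b * 2^-1 ^+ n].
Proof.
move=> ub.
have cr : cvgn (fun n => Re (u n)).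
  apply: (@cvg_real_fast _ b) => n m; apply: le_trans (ub n m).
  by rewrite /sqnormc !ReImE lerDl sqr_ge0.
have ci : cvgn (fun n => Im (u n)).
  apply: (@cvg_real_fast _ b) => n m; apply: le_trans (ub n m).
  by rewrite /sqnormc !ReImE lerDr sqr_ge0.
split => // n; rewrite /sqnormc !ReImE /=.
have h : (fun m => sqnormc (u (n + m)%N - u n)) @ \oo -->
    (Re (u n) - limn (fun n => Re (u n))) ^+ 2 +
    (Im (u n) - limn (fun n => Im (u n))) ^+ 2.
  have hr : (fun m => Re (u (n + m)%N)) @ \oo --> limn (fun n => Re (u n)).
    have := cr; rewrite -(cvg_shiftn n) => h.
    under eq_fun do rewrite addnC; exact: h.
  have hi : (fun m => Im (u (n + m)%N)) @ \oo --> limn (fun n => Im (u n)).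
    have := ci; rewrite -(cvg_shiftn n) => h.
    under eq_fun do rewrite addnC; exact: h.
  rewrite /sqnormc; under eq_fun do rewrite !ReImE.
  rewrite -(sqrrN (Re (u n) - _)) -(sqrrN (Im (u n) - _)) !opprB.
  have sq (v : nat -> R) (l : R) : v @ \oo --> l -> (fun m => v m ^+ 2) @ \oo --> l ^+ 2.
    by move=> vl; under eq_fun do rewrite expr2; rewrite expr2; exact: cvgM.
  by apply: cvgD; apply: sq; apply: cvgB => //; exact: cvg_cst.
by apply: (cvgr_to_le h); apply: nearW => m; exact: ub.
Qed.

End SeqComplex.

Section Completeness.
Context d (T : measurableType d) (R : realType) (mu : {measure set T -> \bar R}).
Context (D : set T) (mD : measurable D).

Local Notation L2on := (L2on mu D).
Local Notation nrm2 := (nrm2 mu D).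
Local Notation dotp := (dotp mu D).

(* Riesz-Fischer.  If [r x] denotes the sum of [2 ^ j |k (j + 1) x - k j x| ^ 2]
   then [|k m x - k n x| ^ 2 <= 2 r x / 2 ^ n] for [n <= m], by the weighted
   Cauchy-Schwarz inequality, and [r] is integrable. *)
Lemma L2_complete (k : nat -> T -> R[i]) (b : R) : (forall n, L2on (k n)) ->
  (forall n, nrm2 (fun x => k n.+1 x - k n x) <= b * 4^-1 ^+ n) ->
  exists2 g, L2on g & (fun n => nrm2 (fun x => k n x - g x)) @ \oo --> (0 : R).
Proof.
move=> Lk kb.
have b0 : 0 <= b by have := kb 0%N; rewrite expr0 mulr1; apply: le_trans; exact: nrm2_ge0.
pose a n x := k n.+1 x - k n x.
have La n : L2on (a n) by exact: L2onB.
pose t n x := (2 ^+ n * sqnormc (a n x))%:E.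
have mt n : measurable_fun D (t n).
  apply/measurable_EFinP/measurable_funM; first exact: measurable_cst.
  by apply: measurable_sqnormc; case: (La n).
have t0 n x : (0 <= t n x)%E.
  by rewrite lee_fin mulr_ge0 ?sqnormc_ge0// exprn_ge0.
pose S x := (\sum_(n <oo) t n x)%E.
have mS : measurable_fun D S.
  by apply: ge0_emeasurable_sum => // n x _ _; exact: t0.
have S0 x : (0 <= S x)%E by apply: nneseries_ge0 => n _ _; exact: t0.
(* The rate [4^-n] absorbs the weight [2^n] and still leaves a summable sequence. *)
have St n : (\int[mu]_(x in D) t n x <= (b * 2^-1 ^+ n)%:E)%E.
  under eq_integral do rewrite /t EFinM.
  rewrite ge0_integralZl_EFin//; [|by move=> x _; rewrite lee_fin sqnormc_ge0
    |by apply/measurable_EFinP/measurable_sqnormc; case: (La n)].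
  rewrite -nrm2E// -EFinM lee_fin.
  apply: (@le_trans _ _ (2 ^+ n * (b * 4^-1 ^+ n))).
    by rewrite ler_wpM2l ?exprn_ge0//; exact: kb.
  rewrite mulrCA -exprMn (_ : 2 * 4^-1 = 2^-1 :> R)//.
  by field.
have Sint : (\int[mu]_(x in D) S x <= (2 * b)%:E)%E.
  rewrite integral_nneseries//; apply: lime_le.
    by apply: is_cvg_nneseries => i _ _; apply: integral_ge0 => x _; exact: t0.
  apply: nearW => i.
  apply: (@le_trans _ _ (\sum_(0 <= j < i) (b * 2^-1 ^+ j)%:E)%E).
    by apply: lee_sum => j _; exact: St.
  rewrite sumEFin lee_fin -mulr_sumr mulrC ler_wpM2r//.
  have h21 : (2^-1 : R) != 1 by rewrite lt_eqF// invf_lt1// ltr1n.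
  have := geometric_seriesE (1 : R) h21 => /(congr1 (@^~ i)); rewrite /series /= => E.
  rewrite (eq_bigr (geometric 1 (2^-1 : R))); last by move=> j _; rewrite /= mul1r.
  rewrite E mul1r; have : 0 <= (2^-1 : R) ^+ i by rewrite exprn_ge0.
  by rewrite ler_pdivrMr; lra.
have SI : mu.-integrable D S.
  apply/integrableP; split => //.
  under eq_integral do rewrite gee0_abs//.
  exact: le_lt_trans Sint (ltry _).
have Sfin := integrable_ae mD SI.
(* An upper limit followed by [fine] is defined and measurable everywhere, including where [k n x]
   diverges; it is the limit wherever [S x] is finite. *)
pose g x := fine (limn_esup (fun n => (Re (k n x))%:E)) +i*
            fine (limn_esup (fun n => (Im (k n x))%:E)).
have mg : cmeasurable_fun D g.
  split => /=.
    apply: measurableT_comp => //; apply: measurable_fun_limn_esup => n.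
    by apply/measurable_EFinP; case: (Lk n) => -[].
  apply: measurableT_comp => //; apply: measurable_fun_limn_esup => n.
  by apply/measurable_EFinP; case: (Lk n) => -[].
have pt x : S x \is a fin_num -> forall n,
    sqnormc (k n x - g x) <= (2 * fine (S x)) * 2^-1 ^+ n.
  move=> Sx; have hb m : \sum_(0 <= j < m) 2 ^+ j * sqnormc (k j.+1 x - k j x) <= fine (S x).
    rewrite -lee_fin fineK// -sumEFin.
    by apply: (@nneseries_lim_ge _ (t ^~ x) predT 0%N) => j _ _; exact: t0.
  have [cr ci hn] := cvg_complex_fast (sqnormc_telescope_le hb).
  suff -> : g x = limn (fun n => Re (k n x)) +i* limn (fun n => Im (k n x)).
    exact: hn.
  rewrite /g; congr (_ +i* _).
    have h : (fun n => (Re (k n x))%:E) @ \oo --> (limn (fun n => Re (k n x)))%:E.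
      by apply/cvg_EFin => //; exact: nearW.
    by rewrite (cvg_limn_einf_sup h).2.
  have h : (fun n => (Im (k n x))%:E) @ \oo --> (limn (fun n => Im (k n x)))%:E.
    by apply/cvg_EFin => //; exact: nearW.
  by rewrite (cvg_limn_einf_sup h).2.
have kg n : L2on (fun x => k n x - g x) /\
    nrm2 (fun x => k n x - g x) <= (4 * b) * 2^-1 ^+ n.
  have mkg : cmeasurable_fun D (fun x => k n x - g x).
    under eq_fun do rewrite -[X in _ - X]mul1r -mulNr.
    apply: cmeasurable_funD; first by case: (Lk n).
    by apply: cmeasurable_funM => //; exact: cmeasurable_cst.
  apply: L2on_le => //.
  apply: (@le_trans _ _ (\int[mu]_(x in D) ((2 * 2^-1 ^+ n)%:E * S x))%E).
    apply: ae_ge0_le_integral => //.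
    - by move=> x _; rewrite lee_fin sqnormc_ge0.
    - by apply/measurable_EFinP/measurable_sqnormc.
    - by move=> x _; rewrite mule_ge0// lee_fin mulr_ge0// exprn_ge0.
    - by apply: measurable_funeM.
    apply: filterS Sfin => x /= h Dx; have Sx := h Dx.
    rewrite -(fineK Sx) -EFinM lee_fin (le_trans (pt x Sx n))//.
    by rewrite le_eqVlt; apply/orP; left; apply/eqP; ring.
  rewrite ge0_integralZl_EFin//.
  apply: (@le_trans _ _ ((2 * 2^-1 ^+ n)%:E * (2 * b)%:E)%E).
    by apply: lee_wpmul2l => //; rewrite lee_fin mulr_ge0// exprn_ge0.
  by rewrite -EFinM lee_fin le_eqVlt; apply/orP; left; apply/eqP; ring.
exists g.
  have -> : g = (fun x => k 0%N x - (k 0%N x - g x)) by apply/funext => x; ring.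
  by apply: L2onB => //; case: (kg 0%N).
have h2 : (fun n => (4 * b) * (2^-1 : R) ^+ n) @ \oo --> (0 : R).
  by apply: cvg_geometric; rewrite ger0_norm// invf_lt1// ltr1n.
apply: (squeeze_cvgr _ (@cvg_cst _ (0:R) _ _ _) h2).
by apply: nearW => n; rewrite nrm2_ge0/=; case: (kg n).
Qed.

Lemma dotp_cvg (k : nat -> T -> R[i]) (g h : T -> R[i]) :
  (forall n, L2on (k n)) -> L2on g -> L2on h ->
  (fun n => nrm2 (fun x => k n x - g x)) @ \oo --> (0 : R) ->
  (fun n => Re (dotp (k n) h)) @ \oo --> Re (dotp g h).
Proof.
move=> Lk Lg Lh kg.
have E n : Re (dotp (k n) h) = Re (dotp g h) + Re (dotp (fun x => k n x - g x) h).
  rewrite -cReD -dotpDl//; last exact: L2onB.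
  congr (Re (dotp _ _)); apply/funext => x; ring.
under eq_fun do rewrite E.
suff : (fun n => Re (dotp g h) + Re (dotp (fun x => k n x - g x) h)) @ \oo -->
    Re (dotp g h) + (0 : R) by rewrite addr0.
apply: cvgD; first exact: cvg_cst.
apply/norm_cvg0P.
have h2 : (fun n => Num.sqrt (nrm2 (fun x => k n x - g x) * nrm2 h)) @ \oo --> (0 : R).
  rewrite -sqrtr0; apply: continuous_cvg; first exact: sqrt_continuous.
  by rewrite -(mul0r (nrm2 h)); exact: cvgMr_tmp.
apply: (squeeze_cvgr _ _ h2); last exact: cvg_cst.
apply: nearW => n; rewrite normr_ge0/=.
rewrite -sqrtr_sqr ler_wsqrtr//; apply: CauchySchwarz_Re => //; exact: L2onB.
Qed.

Lemma linear_le0_quadratic (x y : R) :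
  (forall s : R, 0 <= 2 * s * x + s ^+ 2 * y) -> x = 0.
Proof.
move=> h; have y0 : 0 <= y by have := h 1; have := h (-1); nra.
(* The minimizer would be [- x / y], but [y] may be 0; with [y + 1] the value is still a negative
   multiple of [x ^+ 2]. *)
have := h (- x / (y + 1)).
rewrite (_ : _ + _ = - (x ^+ 2 * (y + 2)) / (y + 1) ^+ 2); last by field; lra.
rewrite pmulr_lge0 ?invr_gt0 ?exprn_gt0//; last by lra.
rewrite oppr_ge0 pmulr_lle0; last by lra.
by move=> x2; apply/eqP; rewrite -sqrf_eq0 eq_le x2 sqr_ge0.
Qed.

(* The representative is the limit of a sequence minimizing
   [nrm2 k - 2 ell k]. *)
Lemma Riesz_representation (ell : (T -> R[i]) -> R) (C : R) :
  (forall f g (s : R), L2on f -> L2on g ->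
     ell (fun x => f x + s%:C * g x) = ell f + s * ell g) ->
  (forall f, L2on f -> ell f ^+ 2 <= C * nrm2 f) ->
  exists2 g, L2on g & forall k, L2on k -> Re (dotp g k) = ell k.
Proof.
move=> lin bd.
pose J k := nrm2 k - 2 * ell k.
have L0 : L2on (fun=> 0) by exact: L2on0.
(* The arithmetic-geometric inequality applied to [ell k ^+ 2 <= |C| nrm2 k], so that the infimum of
   [J] is finite. *)
have JC k : L2on k -> - `|C| <= J k.
  move=> Lk; rewrite /J.
  have C1 : ell k ^+ 2 <= `|C| * nrm2 k.
    by rewrite (le_trans (bd _ Lk))// ler_wpM2r ?nrm2_ge0// ler_norm.
  have h2 : 0 <= nrm2 k + `|C| by rewrite addr_ge0 ?nrm2_ge0.
  have : 2 * ell k <= nrm2 k + `|C|.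
    rewrite (le_trans (ler_norm _))// -(ger0_norm h2) -ler_sqr ?nnegrE//.
    rewrite !real_normK ?num_real//.
    have := sqr_ge0 (nrm2 k - `|C|); nra.
  by lra.
pose E := [set J k | k in L2on].
have Einf : has_inf E.
  split; first by exists (J (fun=> 0)); exists (fun=> 0).
  by exists (- `|C|) => _ [k Lk <-]; exact: JC.
have minJ k : L2on k -> inf E <= J k.
  by move=> Lk; apply: ge_inf; [case: Einf|exists k].
have seq n : exists k, L2on k /\ J k <= inf E + 4^-1 ^+ n.
  have e0 : 0 < (4^-1 : R) ^+ n by rewrite exprn_gt0.
  have [_ [k Lk <-] /ltW Jk] := inf_adherent e0 Einf.
  by exists k.
pose k n := projT1 (cid (seq n)).
have Lk n : L2on (k n) by case: (projT2 (cid (seq n))).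
have Jk n : J (k n) <= inf E + 4^-1 ^+ n by case: (projT2 (cid (seq n))).
(* The parallelogram identity reads [nrm2 (f - g) = 2 (J f + J g) - 4 J m] with [m] the midpoint,
   because [ell] is linear; and [J m] is at least the infimum. *)
have Jdiff f g : L2on f -> L2on g -> nrm2 (fun x => f x - g x) <=
    2 * (J f + J g) - 4 * inf E.
  move=> Lf Lg.
  have Lm : L2on (fun x => (2^-1 : R)%:C * (f x + g x)) by apply/L2onZ/L2onD.
  have := minJ _ Lm; rewrite /J nrm2Z//; last exact: L2onD.
  have -> : ell (fun x => (2^-1 : R)%:C * (f x + g x)) = 2^-1 * (ell f + ell g).
    have -> : (fun x => (2^-1 : R)%:C * (f x + g x)) =
      (fun x => ((0 : R[i]) + (2^-1 : R)%:C * f x) + (2^-1 : R)%:C * g x).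
      by apply/funext => x; ring.
    have l0 : ell (fun=> 0) = 0.
      have := lin (fun=> 0) (fun=> 0) 1 L0 L0.
      under eq_fun do rewrite mulr0 addr0.
      by move=> h; lra.
    rewrite lin//; last by apply: L2onD => //; exact: L2onZ.
    by rewrite lin// l0; ring.
  rewrite sqnormc_real nrm2D// nrm2B//; lra.
(* By [Jdiff] consecutive terms differ by at most [2 (1 + 1/4) 4^-n], which 4 bounds with room to
   spare. *)
have [|g Lg kg] := @L2_complete k 4 Lk.
  move=> n; apply: (le_trans (Jdiff _ _ (Lk _) (Lk _))).
  have := Jk n; have := Jk n.+1.
  have : 0 <= (4^-1 : R) ^+ n by rewrite exprn_ge0.
  by rewrite exprS; lra.
exists g => // h Lh.
apply/eqP; rewrite -subr_eq0; apply/eqP.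
apply: (@linear_le0_quadratic _ (nrm2 h)) => s.
(* Perturb in the direction [h]: [J (k n + s h) >= inf E] against [J (k n) <= inf E + 4^-n]. The
   limit in [n] is a nonnegative quadratic in [s] without constant term. *)
have hn n : 0 <= 4^-1 ^+ n + 2 * s * (Re (dotp (k n) h) - ell h) + s ^+ 2 * nrm2 h.
  have := minJ (fun x => k n x + s%:C * h x).
  have Lsh : L2on (fun x => s%:C * h x) by exact: L2onZ.
  move=> /(_ (L2onD mD (Lk n) Lsh)); rewrite /J lin// nrm2D// nrm2Z//.
  rewrite sqnormc_real dotpZr// conjc_real cReM /= mul0r subr0.
  have := Jk n; rewrite /J; lra.
have c4 : (fun n => (4^-1 : R) ^+ n) @ \oo --> (0 : R).
  have := @cvg_geometric _ 1 (4^-1 : R); rewrite /geometric /=.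
  under eq_fun do rewrite mul1r.
  by apply; rewrite ger0_norm// invf_lt1// ltr1n.
have cv : (fun n => 4^-1 ^+ n + 2 * s * (Re (dotp (k n) h) - ell h) + s ^+ 2 * nrm2 h)
    @ \oo --> 0 + 2 * s * (Re (dotp g h) - ell h) + s ^+ 2 * nrm2 h.
  apply: cvgD; last exact: cvg_cst.
  apply: cvgD => //; apply: cvgMl_tmp; apply: cvgB; last exact: cvg_cst.
  exact: dotp_cvg.
rewrite add0r in cv; apply: (cvgr_to_ge cv).
exact: nearW.
Qed.

End Completeness.

(** * Changes of variables and Fubini *)

Section LebesgueTools.
Context (R : realType).
Local Notation leb := (@lebesgue_measure R).

Lemma measurable_affine (a b : R) : measurable_fun setT (fun x : R => a * x + b).
Proof.
by apply: measurable_funD; [exact: mulrl_measurable|exact: measurable_cst].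
Qed.

(** Lebesgue measure is determined by its values on the intervals []u, v]]. For [a < 0] the preimage
    of such an interval is closed on the left instead, which does not change its length. *)
Lemma lebesgue_measure_affine (a b : R) (X : set R) : a != 0 -> measurable X ->
  leb X = (`|a|%:E * leb ((fun x => (a * x + b)%R) @^-1` X))%E.
Proof.
move=> a0 mX; have a0' : 0 <= `|a| by [].
pose f (x : R) := a * x + b.
have mf : measurable_fun setT (f : measurableTypeR R -> measurableTypeR R).
  exact: measurable_affine.
pose m : {measure set (measurableTypeR R) -> \bar R} :=
  pushforward leb (f : measurableTypeR R -> measurableTypeR R).
pose mu' : {measure set (measurableTypeR R) -> \bar R} := mscale (NngNum a0') (m mf).
rewrite (@lebesgue_measure_unique R mu')//.
move=> _ [[u v] _ <-].
transitivity (`|a|%:E * leb (f @^-1` `]u, v]%classic))%E; last by [].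
have [a_gt0|a_lt0|/eqP] := ltgtP a 0; last by rewrite (negbTE a0).
- have -> : f @^-1` `]u, v] = `[(v - b) / a, (u - b) / a[%classic.
    apply/seteqP; split => x /=; rewrite /f !in_itv /= ler_ndivrMr// ltr_ndivlMr//;
      rewrite mulrC; lra.
  rewrite !lebesgue_measure_itv /= !lte_fin ltr_nM2r ?invr_lt0// ltrD2r.
  case: ifPn => _; last by rewrite mule0.
  rewrite -!EFinD -EFinM; congr EFin; rewrite ltr0_norm//.
  by field.
- have -> : f @^-1` `]u, v] = `](u - b) / a, (v - b) / a]%classic.
    apply/seteqP; split => x /=; rewrite /f !in_itv /= ler_pdivlMr// ltr_pdivrMr//;
      rewrite mulrC; lra.
  rewrite !lebesgue_measure_itv /= !lte_fin ltr_pM2r ?invr_gt0// ltrD2r.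
  case: ifPn => _; last by rewrite mule0.
  rewrite -!EFinD -EFinM; congr EFin; rewrite gtr0_norm//.
  by field.
Qed.

Lemma ge0_integral_affine (a b : R) (f : R -> \bar R) : a != 0 ->
  measurable_fun setT f -> (forall x, 0 <= f x)%E ->
  (\int[leb]_x f (a * x + b)%R = `|a|^-1%:E * \int[leb]_x f x)%E.
Proof.
move=> a0 mf f0; have a0' : 0 <= `|a| by [].
have mg : measurable_fun setT
  ((fun x => a * x + b) : measurableTypeR R -> measurableTypeR R).
  exact: measurable_affine.
pose m : {measure set (measurableTypeR R) -> \bar R} :=
  pushforward leb ((fun x => a * x + b) : measurableTypeR R -> measurableTypeR R).
rewrite [in RHS](@eq_measure_integral _ _ _ _ (mscale (NngNum a0') (m mg))); last first.
  by move=> X mX _; exact: lebesgue_measure_affine.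
rewrite ge0_integral_mscale// ge0_integral_pushforward//.
by rewrite muleA -EFinM mulVf ?normr_eq0// mul1e preimage_setT.
Qed.

Lemma Rintegral_affine (a b : R) (f : R -> R) : a != 0 ->
  measurable_fun setT f ->
  \int[leb]_x f (a * x + b) = `|a|^-1 * \int[leb]_x f x.
Proof.
move=> a0 mf; have mfE : measurable_fun setT (EFin \o f) by exact/measurable_EFinP.
rewrite /Rintegral [in RHS]integralE [in LHS]integralE.
have E1 : (\int[leb]_x ((fun x => (f (a * x + b)%R)%:E)^\+ x) =
    `|a|^-1%:E * \int[leb]_x (fun x => (f x)%:E)^\+ x)%E.
  have := @ge0_integral_affine a b (EFin \o f)^\+%E a0 (measurable_funepos mfE).
  move=> <-; last by move=> x; exact: funepos_ge0.
  by apply: eq_integral => x _; rewrite !funeposE.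
have E2 : (\int[leb]_x ((fun x => (f (a * x + b)%R)%:E)^\- x) =
    `|a|^-1%:E * \int[leb]_x (fun x => (f x)%:E)^\- x)%E.
  have := @ge0_integral_affine a b (EFin \o f)^\-%E a0 (measurable_funeneg mfE).
  move=> <-; last by move=> x; exact: funeneg_ge0.
  by apply: eq_integral => x _; rewrite !funenegE.
rewrite E1 E2.
have p0 : (0 <= \int[leb]_x (fun x => (f x)%:E)^\+ x)%E by exact: integral_ge0.
have n0 : (0 <= \int[leb]_x (fun x => (f x)%:E)^\- x)%E by exact: integral_ge0.
have k0 : 0 < `|a|^-1 by rewrite invr_gt0 normr_gt0.
(* An infinite part stays infinite after rescaling, and [fine] then returns 0 on both sides; so the
   formula also covers divergent integrals. *)
move: p0 n0; case: (\int[leb]_x (fun x => (f x)%:E)^\+ x)%E => [p| |]//=;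
  case: (\int[leb]_x (fun x => (f x)%:E)^\- x)%E => [n| |]//= _ _;
  rewrite ?gt0_muley ?lte_fin//= ?mulr0//.
by rewrite mulrBr.
Qed.

Lemma ae_affine (a b : R) (P : R -> Prop) : a != 0 ->
  {ae leb, forall x, P x} -> {ae leb, forall x, P (a * x + b)}.
Proof.
move=> a0 [N [mN N0 PN]]; exists ((fun x => a * x + b) @^-1` N); split.
- have := @measurable_affine a b measurableT _ mN.
  by rewrite setTI.
- have := lebesgue_measure_affine b a0 mN.
  rewrite N0 => /esym/eqP; rewrite mule_eq0 eqe normr_eq0 (negbTE a0) /=.
  by move/eqP.
- by move=> x /= Px; apply: PN.
Qed.

Lemma ge0_integral_half_lines (f : R -> \bar R) : measurable_fun setT f ->
  (forall x, 0 <= f x)%E ->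
  (\int[leb]_x f x =
   \int[leb]_(x in `[0%R, +oo[) f x + \int[leb]_(x in `[0%R, +oo[) f (- x)%R)%E.
Proof.
move=> mf f0.
have mg : measurable_fun setT (fun x : R => f (- x)%R) by exact: measurableT_comp.
rewrite [X in (_ + X)%E](@ge0_integration_by_substitution0 _ (fun x => f (- x)%R))//.
under [X in (_ + X)%E]eq_integral do rewrite opprK.
rewrite -(@integral_itv_bndo_bndc _ -oo%O 0 f); last exact: measurable_funTS.
rewrite addeC -ge0_integral_setU//=; last first.
- by apply/disj_setPS => x []/=; rewrite !in_itv/= andbT => /lt_geF ->.
- exact: measurable_funTS.
congr (integral _ _ _); apply/seteqP; split => x //= _; rewrite !in_itv/= andbT.
by have [|] := leP 0 x; [right|left].
Qed.

End LebesgueTools.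

Section FubiniTools.
Context d1 d2 (T1 : measurableType d1) (T2 : measurableType d2) (R : realType).
Context (m1 : {sigma_finite_measure set T1 -> \bar R}).
Context (m2 : {sigma_finite_measure set T2 -> \bar R}).

(** Tonelli for the positive and the negative part, followed by [fine]; sections with a divergent
    integral are thereby included. *)
Lemma measurable_Rintegral (F : T1 * T2 -> R) : measurable_fun setT F ->
  measurable_fun setT (fun x => \int[m2]_y F (x, y)).
Proof.
move=> mF; apply: measurableT_comp => //.
under eq_fun do rewrite integralE.
have mFE : measurable_fun setT (EFin \o F) by exact/measurable_EFinP.
apply: emeasurable_funB.
  rewrite (_ : (fun x => _) = fubini_F m2 (EFin \o F)^\+%E).
    exact: measurable_fun_fubini_tonelli_F (measurable_funepos mFE) _.
  by apply/funext => x; apply: eq_integral => y _; rewrite !funeposE.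
rewrite (_ : (fun x => _) = fubini_F m2 (EFin \o F)^\-%E).
  exact: measurable_fun_fubini_tonelli_F (measurable_funeneg mFE) _.
by apply/funext => x; apply: eq_integral => y _; rewrite !funenegE.
Qed.

(** The inner real integral equals the extended one on integrable sections, hence for almost every
    parameter; the rest is Fubini for extended values. *)
Lemma Rintegral_Fubini (F : T1 * T2 -> R) :
  (m1 \x m2)%E.-integrable setT (EFin \o F) ->
  \int[m1]_x \int[m2]_y F (x, y) = \int[m2]_y \int[m1]_x F (x, y).
Proof.
move=> iF; congr fine.
have h1 : (\int[m1]_x (\int[m2]_y F (x, y))%:E = \int[m1]_x \int[m2]_y (F (x, y))%:E)%E.
  apply: ae_eq_integral => //.
  - apply/measurable_EFinP/measurable_Rintegral.
    by have /measurable_int/measurable_EFinP := iF.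
  - exact: (measurable_fubini_F iF).
  - apply: filterS (ae_integrable1 iF) => x ix _ /=.
    by rewrite fineK//; exact: integrable_fin_num.
have h2 : (\int[m2]_y (\int[m1]_x F (x, y))%:E = \int[m2]_y \int[m1]_x (F (x, y))%:E)%E.
  apply: ae_eq_integral => //.
  - apply/measurable_EFinP.
    apply: measurableT_comp; first exact: fine_measurable.
    exact: (measurable_fubini_G iF).
  - exact: (measurable_fubini_G iF).
  - apply: filterS (ae_integrable2 iF) => x ix _ /=.
    by rewrite fineK//; exact: integrable_fin_num.
by rewrite h1 h2; exact: (Fubini iF).
Qed.

Lemma integrable_tensor (a : T1 -> R) (b : T2 -> R) :
  m1.-integrable setT (EFin \o a) -> m2.-integrable setT (EFin \o b) ->
  (m1 \x m2)%E.-integrable setT (EFin \o (fun z => a z.1 * b z.2)).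
Proof.
move=> ia ib.
have ma : measurable_fun setT a by have /measurable_int/measurable_EFinP := ia.
have mb : measurable_fun setT b by have /measurable_int/measurable_EFinP := ib.
apply/integrable12ltyP.
  apply/measurable_EFinP/measurable_funM; exact: measurableT_comp.
under eq_integral => x _.
  under eq_integral do rewrite /= normrM EFinM.
  rewrite ge0_integralZl_EFin//; last exact/measurable_EFinP/measurableT_comp.
  over.
have /integrableP[_ fa] := ia; have /integrableP[_ fb] := ib.
have fbE : (\int[m2]_y `|(b y)%:E| \is a fin_num)%E.
  by rewrite ge0_fin_numE; [exact: fb|apply: integral_ge0].
rewrite -(fineK fbE).
rewrite ge0_integralZr//; last 2 first.
- exact/measurable_EFinP/measurableT_comp.
- by rewrite lee_fin fine_ge0//; apply: integral_ge0 => y _; exact: abse_ge0.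
rewrite fineK//; apply: lte_mul_pinfty => //; first by apply: integral_ge0.
rewrite ge0_fin_numE; first exact: fa.
by apply: integral_ge0.
Qed.

End FubiniTools.

(** * The Abel kernel *)

Section AbelKernel.
Context (R : realType).
Local Notation leb := (@lebesgue_measure R).
Implicit Types e s x : R.

Lemma cvg_expR_neg e : 0 < e -> expR (- (e * x)) @[x --> +oo] --> (0 : R).
Proof.
move=> e0.
rewrite (_ : (fun x => _) = (fun z => expR (- z)) \o (fun z => e * z))//.
apply: (@cvg_comp _ _ _ _ _ _ (pinfty_nbhs R)); last exact: cvgr_expR.
exact: gt0_cvgMry.
Qed.

Lemma is_derive_expR_lin e x :
  is_derive x 1 (fun x => expR (- (e * x))) (- e * expR (- (e * x))).
Proof.
have h : is_derive x 1 (fun x => - (e * x)) (- e).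
  have -> : (fun x => - (e * x)) = (- e) \*: (@id R) by apply/funext => y; rewrite -mulNr.
  by apply: is_derive_eq; rewrite /GRing.scale /= mulr1.
have := @is_derive1_comp _ (@expR R) (fun x => - (e * x)) x _ _ (is_derive_expR _) h.
by rewrite mulrC.
Qed.

Lemma is_derive_cos_lin s x :
  is_derive x 1 (fun x => cos (x * s)) (- s * sin (x * s)).
Proof.
have h : is_derive x 1 (fun x => x * s) s.
  have -> : (fun x => x * s) = s \*: (@id R) by apply/funext => y; rewrite mulrC.
  by apply: is_derive_eq; rewrite /GRing.scale /= mulr1.
have := @is_derive1_comp _ (@cos R) (fun x => x * s) x _ _ (is_derive_cos _) h.
by rewrite mulNr -mulrN mulrC.
Qed.

Lemma is_derive_sin_lin s x :
  is_derive x 1 (fun x => sin (x * s)) (s * cos (x * s)).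
Proof.
have h : is_derive x 1 (fun x => x * s) s.
  have -> : (fun x => x * s) = s \*: (@id R) by apply/funext => y; rewrite mulrC.
  by apply: is_derive_eq; rewrite /GRing.scale /= mulr1.
have := @is_derive1_comp _ (@sin R) (fun x => x * s) x _ _ (is_derive_sin _) h.
by rewrite mulrC.
Qed.

Lemma ge0_integral_FTC0y (f F : R -> R) (l : R) :
  (forall x, 0 <= f x) -> continuous f -> (forall x, is_derive x 1 F (f x)) ->
  F x @[x --> +oo] --> l ->
  (\int[leb]_(x in `[0%R, +oo[) (f x)%:E = (l - F 0)%:E)%E.
Proof.
move=> f0 cf dF Fl; rewrite (@ge0_continuous_FTC2y _ f F 0 l)//.
- exact: continuous_subspaceT.
- apply: cvg_at_right_filter; apply: differentiable_continuous.
  by apply/derivable1_diffP; case: (dF 0).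
- by move=> x _; rewrite derive1E; case: (dF x).
Qed.

Lemma continuous_derivable (F f : R -> R) :
  (forall x, is_derive x 1 F (f x)) -> continuous F.
Proof.
move=> dF x; apply: differentiable_continuous.
by apply/derivable1_diffP; case: (dF x).
Qed.

Lemma integral_expR_neg e : 0 < e ->
  (\int[leb]_(x in `[0%R, +oo[) (expR (- (e * x)))%:E = (e^-1)%:E)%E.
Proof.
move=> e0.
pose F x := - e^-1 * expR (- (e * x)).
transitivity (0 - F 0)%:E; last first.
  by rewrite /F sub0r; congr EFin; rewrite mulr0 oppr0 expR0 mulr1 opprK.
apply: ge0_integral_FTC0y.
- by move=> x; exact: expR_ge0.
- apply: continuous_derivable => x; exact: is_derive_expR_lin.
- move=> x.
  have := is_derive_expR_lin e x.
  move=> h; have := @is_deriveZ _ _ _ _ (- e^-1) _ _ _ h.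
  by rewrite /GRing.scale /= mulrA mulrNN mulVf ?gt_eqF// mul1r.
- by rewrite -(mulr0 (- e^-1)); apply: cvgMl_tmp; exact: cvg_expR_neg.
Qed.

(** The summand 1 keeps the integrand nonnegative, as [ge0_integral_FTC0y] demands. Subtracting
    [integral_expR_neg] then leaves the Poisson kernel in [s]. *)
Lemma integral_expR_cos1 e s : 0 < e ->
  (\int[leb]_(x in `[0%R, +oo[) (expR (- (e * x)) * (1 + cos (x * s)))%:E =
   (e^-1 + e / (e ^+ 2 + s ^+ 2))%:E)%E.
Proof.
move=> e0; have q0 : e ^+ 2 + s ^+ 2 != 0.
  by rewrite gt_eqF// ltr_pwDl ?sqr_ge0// exprn_gt0.
(* The antiderivative that vanishes at [+oo], from integrating by parts twice. *)
pose F x := expR (- (e * x)) * ((s * sin (x * s) - e * cos (x * s)) / (e ^+ 2 + s ^+ 2) - e^-1).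
have dC x : is_derive x 1 (fun x => 1 + cos (x * s)) (- s * sin (x * s)).
  have := @is_deriveD R R^o R^o _ _ x 1 _ _ (is_derive_cst (1 : R^o) x 1) (is_derive_cos_lin s x).
  by rewrite add0r.
transitivity (0 - F 0)%:E; last first.
  by rewrite /F mulr0 oppr0 expR0 mul0r sin0 cos0; congr EFin; field; rewrite q0 gt_eqF.
apply: ge0_integral_FTC0y.
- move=> x; rewrite mulr_ge0 ?expR_ge0//; have := cos_geN1 (x * s); lra.
- move=> x; apply: (@cvgM _ _ _ _ (fun x => expR (- (e * x))) (fun x => 1 + cos (x * s))).
    exact: (continuous_derivable (is_derive_expR_lin e)).
  exact: (continuous_derivable dC).
- move=> x.
  have dG : is_derive x 1 (fun x => (s * sin (x * s) - e * cos (x * s)) / (e ^+ 2 + s ^+ 2) - e^-1)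
    ((s * (s * cos (x * s)) + e * (s * sin (x * s))) / (e ^+ 2 + s ^+ 2)).
    have h1 := @is_deriveZ _ _ _ _ s _ _ _ (is_derive_sin_lin s x).
    have h2 := @is_deriveZ _ _ _ _ (- e) _ _ _ (is_derive_cos_lin s x).
    have h3 := @is_deriveD _ _ _ _ _ _ _ _ _ h1 h2.
    have h4 := @is_deriveZ _ _ _ _ (e ^+ 2 + s ^+ 2)^-1 _ _ _ h3.
    have h5 := @is_deriveD _ _ _ _ _ _ _ _ _ h4 (is_derive_cst (- e^-1 : R^o) (x : R^o) 1).
    have E : (fun x => (s * sin (x * s) - e * cos (x * s)) / (e ^+ 2 + s ^+ 2) - e^-1) =
      ((e ^+ 2 + s ^+ 2)^-1 \*: (s \*: (fun x => sin (x * s)) + (- e) \*: (fun x => cos (x * s)))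
        + cst (- e^-1)).
      by apply/funext => y; rewrite /GRing.add /= /GRing.scale /= mulNr [in LHS]mulrC.
    rewrite E; apply: (is_derive_eq h5); rewrite /GRing.scale /=; ring.
  have := @is_deriveM _ _ _ _ _ _ _ _ (is_derive_expR_lin e x) dG.
  move=> h; apply: (is_derive_eq h); rewrite /GRing.scale /=.
  by field; rewrite q0 gt_eqF.
- have K x : `|F x| <= ((`|s| + e) / (e ^+ 2 + s ^+ 2) + e^-1) * expR (- (e * x)).
    rewrite /F normrM (ger0_norm (expR_ge0 _)) mulrC ler_wpM2r ?expR_ge0//.
    rewrite (le_trans (ler_normB _ _))// [`|e^-1|]gtr0_norm ?invr_gt0// lerD2r.
    have qp : 0 < e ^+ 2 + s ^+ 2 by rewrite lt_def q0 addr_ge0 ?sqr_ge0.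
    rewrite normrM [`|_^-1|]gtr0_norm ?invr_gt0// ler_pM2r ?invr_gt0//.
    rewrite (le_trans (ler_normB _ _))// !normrM (gtr0_norm e0) lerD//.
      by rewrite ler_piMr// ler_norml sin_geN1 sin_le1.
    by rewrite ler_piMr ?(ltW e0)// ler_norml cos_geN1 cos_le1.
  apply/norm_cvg0P.
  have lim : ((`|s| + e) / (e ^+ 2 + s ^+ 2) + e^-1) * expR (- (e * x)) @[x --> +oo] --> (0 : R).
    rewrite -(mulr0 ((`|s| + e) / (e ^+ 2 + s ^+ 2) + e^-1)).
    by apply: cvgMl_tmp; exact: cvg_expR_neg.
  apply: (squeeze_cvgr _ _ lim); last exact: cvg_cst.
  by apply: nearW => x; rewrite normr_ge0 /=; exact: K.
Qed.

Lemma integrable_expR_neg e : 0 < e ->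
  leb.-integrable `[0%R, +oo[ (EFin \o (fun x => expR (- (e * x)))).
Proof.
move=> e0; apply/integrableP; split.
  apply/measurable_EFinP; apply: measurable_funTS; apply: continuous_measurable_fun.
  exact: (continuous_derivable (is_derive_expR_lin e)).
under eq_integral do rewrite /= ger0_norm ?expR_ge0//.
by rewrite integral_expR_neg// ltry.
Qed.

Lemma integrable_expR_cos e s : 0 < e ->
  leb.-integrable `[0%R, +oo[ (EFin \o (fun x => expR (- (e * x)) * cos (x * s))).
Proof.
move=> e0; apply: le_integrable (integrable_expR_neg e0) => //.
  apply/measurable_EFinP; apply: measurable_funTS; apply: continuous_measurable_fun => x.
  apply: (@cvgM _ _ _ _ (fun x => expR (- (e * x))) (fun x => cos (x * s))).
    exact: (continuous_derivable (is_derive_expR_lin e)).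
  exact: (continuous_derivable (is_derive_cos_lin s)).
move=> x _ /=; rewrite lee_fin normrM ler_piMr//.
by rewrite ler_norml cos_geN1 cos_le1.
Qed.

Lemma Rintegral_expR_cos e s : 0 < e ->
  \int[leb]_(x in `[0%R, +oo[) (expR (- (e * x)) * cos (x * s)) =
   e / (e ^+ 2 + s ^+ 2).
Proof.
move=> e0; have := integral_expR_cos1 s e0.
under eq_integral do rewrite mulrDr mulr1 EFinD.
rewrite integralD//; [|exact: integrable_expR_neg|exact: integrable_expR_cos].
have fI : (\int[leb]_(x in `[0%R, +oo[) (expR (- (e * x)) * cos (x * s))%:E)%E \is a fin_num.
  by apply: integrable_fin_num => //; exact: integrable_expR_cos.
rewrite integral_expR_neg// -[X in (_ + X)%E](fineK fI) -EFinD => -[].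
by move=> /addrI.
Qed.

Lemma cvg_atan_pinfty : atan x @[x --> +oo] --> (pi / 2 : R).
Proof.
apply/cvgrPdist_lt => e e0.
have pi2 : 0 < (pi : R) / 2 by rewrite divr_gt0 ?pi_gt0.
pose d := Num.min (e / 2) (pi / 2).
have d0 : 0 < d by rewrite lt_min pi2 divr_gt0.
have de : d < e.
  by rewrite gt_min; apply/orP; left; lra.
have dpi : d <= pi / 2 by rewrite ge_min lexx orbT.
near=> x.
rewrite gtr0_norm ?subr_gt0 ?atan_ltpi2//.
have xt : tan (pi / 2 - d) < x by near: x; apply: nbhs_pinfty_gt; exact: num_real.
have := lt_atan xt; rewrite tanK; first by lra.
by rewrite in_itv /=; apply/andP; split; lra.
Unshelve. all: by end_near. Qed.

Lemma continuous_inv_1Dsqr : continuous (fun x : R => (1 + x ^+ 2)^-1).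
Proof.
move=> x; apply: cvgV; first by rewrite gt_eqF// ltr_pwDl// sqr_ge0.
by apply: cvgD; [exact: cvg_cst|exact: exprn_continuous].
Qed.

Lemma integral_half_inv_1Dsqr :
  (\int[leb]_(x in `[0%R, +oo[) ((1 + x ^+ 2)^-1)%:E = (pi / 2)%:E)%E.
Proof.
transitivity (pi / 2 - atan (0 : R))%:E; last by rewrite atan0 subr0.
apply: (@ge0_integral_FTC0y _ (@atan R)).
- by move=> x; rewrite invr_ge0 addr_ge0// sqr_ge0.
- exact: continuous_inv_1Dsqr.
- exact: cvg_atan_pinfty.
Qed.

Lemma integral_inv_1Dsqr : (\int[leb]_x ((1 + x ^+ 2)^-1)%:E = pi%:E)%E.
Proof.
rewrite ge0_integral_half_lines.
- under [X in (_ + X)%E]eq_integral do rewrite sqrrN.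
  by rewrite integral_half_inv_1Dsqr -EFinD; congr EFin; field.
- by apply/measurable_EFinP; apply: continuous_measurable_fun; exact: continuous_inv_1Dsqr.
- by move=> x; rewrite lee_fin invr_ge0 addr_ge0// sqr_ge0.
Qed.

Lemma integrable_inv_1Dsqr : leb.-integrable setT (EFin \o (fun x => (1 + x ^+ 2)^-1)).
Proof.
apply/integrableP; split.
  by apply/measurable_EFinP; apply: continuous_measurable_fun; exact: continuous_inv_1Dsqr.
under eq_integral do rewrite /= ger0_norm ?invr_ge0 ?addr_ge0 ?sqr_ge0//.
by rewrite integral_inv_1Dsqr ltry.
Qed.

End AbelKernel.

(** * Abel summation of a nonnegative cosine transform *)

Section AbelInversion.
Context (R : realType).
Local Notation leb := (@lebesgue_measure R).
Variables (rho : R -> R) (M : R).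
Hypothesis rhoM : forall x, `|rho x| <= M.
Hypothesis irho : leb.-integrable setT (EFin \o rho).
Hypothesis crho : {for 0, continuous rho}.

Let q xi := \int[leb]_s (rho s * cos (xi * s)).

Let mrho : measurable_fun setT rho.
Proof. by have /measurable_int/measurable_EFinP := irho. Qed.

Let mcos (c : R) : measurable_fun setT (fun s : R => cos (c * s)).
Proof.
apply: measurableT_comp; first by apply: continuous_measurable_fun; exact: continuous_cos.
exact: mulrl_measurable.
Qed.

Let irho_cos xi : leb.-integrable setT (EFin \o (fun s => rho s * cos (xi * s))).
Proof.
apply: le_integrable irho => //.
  by apply/measurable_EFinP; apply: measurable_funM; [exact: mrho|exact: mcos].
by move=> x _ /=; rewrite lee_fin normrM ler_piMr// ler_norml cos_geN1 cos_le1.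
Qed.

(** The damping factor makes the double integrand absolutely integrable, so Fubini applies; the
    inner integral over [xi] is the Poisson kernel. *)
Let expR_integral (e : R) : 0 < e ->
  (\int[leb]_(xi in `[0%R, +oo[) (expR (- (e * xi)) * q xi)%:E =
   (\int[leb]_s (rho s * (e / (e ^+ 2 + s ^+ 2))))%:E)%E.
Proof.
move=> e0.
(* Extension by 0 puts the half-line into the integrand, so that Fubini is used on the whole
   plane. *)
pose a := (fun x => expR (- (e * x))) \_ `[0, +oo[%classic.
have ia : leb.-integrable setT (EFin \o a).
  rewrite /a -restrict_EFin; apply: (integrable_mkcond _ _).1 => //.
  exact: integrable_expR_neg.
have ma : measurable_fun setT a by have /measurable_int/measurable_EFinP := ia.
pose F (z : R * R) := a z.1 * rho z.2 * cos (z.1 * z.2).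
have mF : measurable_fun setT F.
  apply: measurable_funM.
    apply: measurable_funM.
      exact: (measurableT_comp ma measurable_fst).
    exact: (measurableT_comp mrho measurable_snd).
  apply: measurableT_comp; first by apply: continuous_measurable_fun; exact: continuous_cos.
  by apply: measurable_funM; [exact: measurable_fst|exact: measurable_snd].
have iF : (leb \x leb)%E.-integrable setT (EFin \o F).
  apply: le_integrable (integrable_tensor ia irho) => //; first exact/measurable_EFinP.
  move=> z _ /=; rewrite lee_fin !normrM ler_piMr ?mulr_ge0//.
  by rewrite ler_norml cos_geN1 cos_le1.
have Ea xi : \int[leb]_s F (xi, s) = a xi * q xi.
  rewrite /F /=; under eq_Rintegral do rewrite -mulrA.
  by rewrite RintegralZl.
have Es s : \int[leb]_xi F (xi, s) = rho s * (e / (e ^+ 2 + s ^+ 2)).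
  rewrite -(Rintegral_expR_cos s e0) [in RHS]Rintegral_mkcond -RintegralZl//; last first.
    rewrite -restrict_EFin; apply: (integrable_mkcond _ _).1 => //; exact: integrable_expR_cos.
  apply: eq_Rintegral => xi _; rewrite /F /a /= !patchE.
  case: ifP => _ /=; first by ring.
  by rewrite !mul0r mulr0.
have := Rintegral_Fubini iF.
under eq_Rintegral do rewrite Ea.
under [RHS]eq_Rintegral do rewrite Es.
move=> <-; rewrite /Rintegral fineK; last first.
  have h := integrable_fin_num measurableT (integrable_fubini_F iF).
  rewrite (_ : (\int[leb]_xi _ = \int[leb]_xi (fubini_F leb (EFin \o F) xi))%E)//.
  apply: eq_integral => xi _; rewrite /fubini_F /= -Ea /Rintegral fineK//.
  apply: integrable_fin_num => //.
  have -> : (fun y => (EFin \o F) (xi, y)) = EFin \o (fun y => a xi * (rho y * cos (xi * y))).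
    by apply/funext => y /=; rewrite /F /= mulrA.
  exact: integrableZE.
rewrite [LHS]integral_mkcond; apply: eq_integral => xi _.
by rewrite /a /= !patchE; case: ifP => _ //=; rewrite mul0r.
Qed.

Let e_ (n : nat) : R := n.+1%:R^-1.
Let e_gt0 n : 0 < e_ n. Proof. by rewrite invr_gt0. Qed.

Let cvg_e : e_ @ \oo --> (0 : R). Proof. exact: cvg_harmonic. Qed.

(** The substitution [s = e_ n * v] turns the Poisson kernel into the fixed density
    [(1 + v ^+ 2)^-1] of total mass [pi]; then dominated convergence uses the bound [M] and the
    continuity of [rho] at 0. *)
Let approx_cvg :
  (fun n => \int[leb]_s (rho s * (e_ n / (e_ n ^+ 2 + s ^+ 2)))) @ \oo --> pi * rho 0.
Proof.
have M0 : 0 <= M by apply: le_trans (rhoM 0).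
pose g n v := rho (e_ n * v) * (1 + v ^+ 2)^-1.
have p1 (v : R) : 0 < 1 + v ^+ 2 by rewrite ltr_pwDl// sqr_ge0.
have mg n : measurable_fun setT (g n).
  apply: measurable_funM.
    by apply: measurableT_comp => //; exact: mulrl_measurable.
  by apply: continuous_measurable_fun; exact: continuous_inv_1Dsqr.
have iM : leb.-integrable setT (EFin \o (fun v => M * (1 + v ^+ 2)^-1)).
  by apply: integrableZE => //; exact: integrable_inv_1Dsqr.
have gM n v : `|g n v| <= M * (1 + v ^+ 2)^-1.
  rewrite normrM [X in _ * X]ger0_norm ?invr_ge0 ?(ltW (p1 _))//.
  by rewrite ler_wpM2r// invr_ge0 (ltW (p1 _)).
have ig n : leb.-integrable setT (EFin \o (g n)).
  apply: le_integrable iM => //; first by apply/measurable_EFinP; exact: mg.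
  by move=> v _ /=; rewrite lee_fin (le_trans (gM _ _))// ler_norm.
have E n : \int[leb]_s (rho s * (e_ n / (e_ n ^+ 2 + s ^+ 2))) = \int[leb]_v g n v.
  have mf : measurable_fun setT (fun s => rho s * (e_ n / (e_ n ^+ 2 + s ^+ 2))).
    apply: measurable_funM => //; apply: continuous_measurable_fun => x.
    apply: cvgMl_tmp; apply: cvgV.
      by rewrite gt_eqF// ltr_pwDl ?sqr_ge0 ?exprn_gt0.
    by apply: cvgD; [exact: cvg_cst|exact: exprn_continuous].
  have := Rintegral_affine 0 (lt0r_neq0 (e_gt0 n)) mf.
  rewrite (gtr0_norm (e_gt0 n)) => /(congr1 (fun z => e_ n * z)).
  rewrite mulrA mulfV ?lt0r_neq0// mul1r => <-.
  rewrite -RintegralZl//; last first.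
    have -> : (fun x : R => rho (e_ n * x + 0) * (e_ n / (e_ n ^+ 2 + (e_ n * x + 0) ^+ 2))) =
      (fun x => (e_ n)^-1 * g n x).
      apply/funext => v; rewrite /g addr0.
      have := p1 v; have := e_gt0 n => e0 pv.
      field; rewrite ?(lt0r_neq0 pv) ?(lt0r_neq0 e0)/= ?andbT.
      by rewrite gt_eqF// exprMn -[X in X + _]mulr1 -mulrDr mulr_gt0// exprn_gt0.
    by apply: integrableZE.
  apply: eq_Rintegral => v _; rewrite /g addr0.
  have := p1 v; have := e_gt0 n => e0 pv.
  field; rewrite ?(lt0r_neq0 pv) ?(lt0r_neq0 e0)/= ?andbT.
  by rewrite gt_eqF// exprMn -[X in X + _]mulr1 -mulrDr mulr_gt0// exprn_gt0.
under eq_fun do rewrite E.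
have [] := @dominated_convergence _ _ _ leb setT measurableT (fun n => EFin \o g n)
  (EFin \o (fun v => rho 0 * (1 + v ^+ 2)^-1)) (EFin \o (fun v => M * (1 + v ^+ 2)^-1)).
- by move=> n; apply/measurable_EFinP; exact: mg.
- apply/measurable_EFinP; apply: measurable_funM; first exact: measurable_cst.
  by apply: continuous_measurable_fun; exact: continuous_inv_1Dsqr.
- apply/aeW => v _ /=; apply: cvg_EFin; first exact: nearW.
  apply: cvgMr_tmp; apply: (continuous_cvg _ crho).
  by rewrite -(mul0r v); exact: cvgMr_tmp.
- exact: iM.
- by apply/aeW => v n _ /=; rewrite lee_fin.
move=> _ _.
have -> : (\int[leb]_x (EFin \o (fun v : R => rho 0 * (1 + v ^+ 2)^-1)%R) x = (pi * rho 0)%:E)%E.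
  under eq_integral do rewrite /= EFinM.
  rewrite integralZl//; last exact: integrable_inv_1Dsqr.
  by rewrite integral_inv_1Dsqr -EFinM mulrC.
by move/fine_cvg.
Qed.

(* Abel summation of the inverse Fourier transform at the origin. *)
Lemma integral_cosine_transform : (forall xi, 0 <= q xi) ->
  (\int[leb]_(xi in `[0%R, +oo[) (q xi)%:E = (pi * rho 0)%:E)%E.
Proof.
move=> q0.
pose g n xi := (expR (- (e_ n * xi)) * q xi)%:E.
have mq : measurable_fun setT q.
  apply: (@measurable_Rintegral _ _ _ _ _ leb (fun z : R * R => rho z.2 * cos (z.1 * z.2))).
  apply: measurable_funM; first exact: (measurableT_comp mrho measurable_snd).
  apply: measurableT_comp; first by apply: continuous_measurable_fun; exact: continuous_cos.
  by apply: measurable_funM; [exact: measurable_fst|exact: measurable_snd].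
have mE n : measurable_fun setT (fun xi => expR (- (e_ n * xi))).
  apply: continuous_measurable_fun.
  exact: (continuous_derivable (is_derive_expR_lin (e_ n))).
have gn n : (\int[leb]_(xi in `[0%R, +oo[) g n xi =
   (\int[leb]_s (rho s * (e_ n / (e_ n ^+ 2 + s ^+ 2))))%:E)%E by exact: expR_integral.
have H : (fun n => (\int[leb]_s (rho s * (e_ n / (e_ n ^+ 2 + s ^+ 2))))%:E) @ \oo -->
    (\int[leb]_(x in `[0%R, +oo[) limn (g ^~ x))%E.
  rewrite (_ : (fun n => _) = (fun n => \int[leb]_(xi in `[0%R, +oo[) g n xi)%E); last exact/funext.
  (* As [q] is nonnegative, the damped integrands increase with [n]; monotone convergence thus
     computes the integral of [q] without prior knowledge that it is finite. *)
  apply: cvg_monotone_convergence => //.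
  - move=> n; apply: measurable_funTS; apply/measurable_EFinP.
    by apply: measurable_funM; [exact: mE|exact: mq].
  - by move=> n x _; rewrite lee_fin mulr_ge0 ?expR_ge0.
  - move=> x; rewrite /= in_itv /= andbT => x0 m n mn.
    rewrite lee_fin ler_wpM2r ?q0// ler_expR lerN2 ler_wpM2r//.
    by rewrite lef_pV2 ?posrE// ler_nat.
have L : (\int[leb]_(x in `[0%R, +oo[) limn (g ^~ x) = \int[leb]_(x in `[0%R, +oo[) (q x)%:E)%E.
  apply: eq_integral => x _; apply/cvg_lim => //; apply: cvg_EFin; first exact: nearW.
  rewrite -[X in _ --> X]mul1r; apply: cvgMr_tmp.
  rewrite -expR0 -oppr0 -(mul0r x).
  apply: continuous_cvg; first exact: continuous_expR.
  by apply: cvgN; exact: cvgMr_tmp.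
rewrite L in H.
have H2 : (fun n => (\int[leb]_s (rho s * (e_ n / (e_ n ^+ 2 + s ^+ 2))))%:E) @ \oo -->
  (pi * rho 0)%:E by apply: cvg_EFin; [exact: nearW|exact: approx_cvg].
by rewrite -(cvg_lim _ H)// (cvg_lim _ H2).
Qed.

End AbelInversion.

(** * Plancherel's formula *)

Section FourierTransform.
Context (R : realType).
Local Notation leb := (@lebesgue_measure R).
Local Notation L2R := (L2on leb setT).
Local Notation nrm2R := (nrm2 leb setT).
Local Notation CintR := (Cintegral leb setT).
Local Notation CiR := (Cintegrable leb setT).
Implicit Types u h phi : R -> R[i].

(** The l1 norm on the plane. It dominates both components, so a single integrable bound serves [Re]
    and [Im], and it avoids square roots. *)
Definition nabs (z : R[i]) : R := `|Re z| + `|Im z|.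

Lemma nabs_ge0 z : 0 <= nabs z. Proof. by rewrite addr_ge0. Qed.

Lemma normRe_le_nabs z : `|Re z| <= nabs z. Proof. by rewrite lerDl. Qed.
Lemma normIm_le_nabs z : `|Im z| <= nabs z. Proof. by rewrite lerDr. Qed.

Lemma nabsM_le z w : nabs (z * w) <= 2 * (nabs z * nabs w).
Proof.
case: z w => [a b] [c d]; rewrite /nabs /=.
have := ler_normB (a * c) (b * d); have := ler_normD (a * d) (b * c).
rewrite !normrM.
have := normr_ge0 a; have := normr_ge0 b; have := normr_ge0 c; have := normr_ge0 d.
nra.
Qed.

Lemma nabs_expi (x : R) : nabs (expi x) <= 2.
Proof.
rewrite /nabs /= (_ : 2 = 1 + 1); last by ring.
by rewrite lerD// ler_norml ?cos_geN1 ?cos_le1 ?sin_geN1 ?sin_le1.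
Qed.

Lemma nabs_le_sqnormc z : nabs z <= 1 + sqnormc z.
Proof.
rewrite /nabs /sqnormc -(real_normK (num_real (Re z))) -(real_normK (num_real (Im z))).
have := sqr_ge0 (`|Re z| - 2^-1); have := sqr_ge0 (`|Im z| - 2^-1); nra.
Qed.

Lemma integrable_nabs d (T : measurableType d) (mu : {measure set T -> \bar R})
  (D : set T) (mD : measurable D) (f : T -> R[i]) : Cintegrable mu D f ->
  mu.-integrable D (EFin \o (fun x => nabs (f x))).
Proof. by move=> [fr fi]; apply: integrableDE => //; exact: integrable_norm. Qed.

Lemma nabs_Cintegrable d (T : measurableType d) (mu : {measure set T -> \bar R})
  (D : set T) (mD : measurable D) (f : T -> R[i]) (b : T -> R) :
  cmeasurable_fun D f -> mu.-integrable D (EFin \o b) ->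
  (forall x, D x -> nabs (f x) <= b x) -> Cintegrable mu D f.
Proof.
move=> [mr mi] ib le; split; apply: le_integrable ib => //;
  try exact/measurable_EFinP; move=> x Dx /=; rewrite lee_fin.
  by rewrite (le_trans (normRe_le_nabs _))// (le_trans (le _ Dx))// ler_norm.
by rewrite (le_trans (normIm_le_nabs _))// (le_trans (le _ Dx))// ler_norm.
Qed.

Lemma nabs_Cintegral_le d (T : measurableType d) (mu : {measure set T -> \bar R})
  (D : set T) (mD : measurable D) (f : T -> R[i]) : Cintegrable mu D f ->
  nabs (Cintegral mu D f) <= 2 * \int[mu]_(x in D) nabs (f x).
Proof.
move=> fi; have [fr fm] := fi; have fn := integrable_nabs mD fi.
rewrite mulrDl !mul1r; apply: lerD; apply: (le_trans (le_normr_Rintegral mD _)) => //;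
  apply: le_Rintegral => //; try exact: integrable_norm.
  by move=> x _; exact: normRe_le_nabs.
by move=> x _; exact: normIm_le_nabs.
Qed.

Lemma cmeasurable_affine f (a b : R) : cmeasurable_fun setT f ->
  cmeasurable_fun setT (fun x : R => f (a * x + b) : R[i]).
Proof.
move=> [mr mi]; split.
  exact: (measurableT_comp mr (measurable_affine a b)).
exact: (measurableT_comp mi (measurable_affine a b)).
Qed.

Lemma Cintegral_affine (a b : R) f : a != 0 -> cmeasurable_fun setT f ->
  CintR (fun x => f (a * x + b)) = (`|a|^-1)%:C * CintR f.
Proof.
move=> a0 [mr mi]; apply: complex_ext; rewrite !(cReM, cImM) /= mul0r ?subr0 ?addr0.
  exact: (Rintegral_affine b a0 mr).
exact: (Rintegral_affine b a0 mi).
Qed.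

Lemma L2_affine (a b : R) f : a != 0 -> L2R f ->
  L2R (fun x => f (a * x + b)) /\ nrm2R (fun x => f (a * x + b)) = `|a|^-1 * nrm2R f.
Proof.
move=> a0 Lf; have [mf fi] := Lf.
have ms := measurable_sqnormc mf.
have E : (\int[leb]_x (sqnormc (f (a * x + b)))%:E = (`|a|^-1 * nrm2R f)%:E)%E.
  rewrite (@ge0_integral_affine _ a b (fun x => (sqnormc (f x))%:E))//.
  - by rewrite -nrm2E.
  - exact/measurable_EFinP.
  - by move=> x; rewrite lee_fin sqnormc_ge0.
have L : L2R (fun x => f (a * x + b)).
  by split; [exact: cmeasurable_affine|rewrite E ltry].
by split => //; apply: EFin_inj; rewrite nrm2E.
Qed.

Lemma integrable_symmetric_indic (M : R) :
  leb.-integrable setT (EFin \o (\1_(`[- M, M]%classic : set R) : R -> R)).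
Proof. exact: integrable_indic_itv. Qed.

Definition bounded_support phi := exists M : R, forall x, M < `|x| -> phi x = 0.

Lemma L2_bounded_support_integrable phi : L2R phi -> bounded_support phi -> CiR phi.
Proof.
move=> Lphi [M phi0].
have L1 : L2R (fun x => (\1_(`[- M, M]%classic : set R) x : R)%:C).
  apply: (@L2on_dom _ _ _ leb setT measurableT _ (\1_(`[- M, M]%classic : set R))).
  - by apply: cmeasurable_real; exact: measurable_indic.
  - exact: integrable_symmetric_indic.
  - by move=> x _; rewrite sqnormc_real indicE; case: (_ \in _); rewrite ?expr1n ?expr0n.
have := CintegrableM measurableT Lphi L1.
congr (CiR _); apply/funext => x; rewrite indicE.
have [xM|xM] := leP `|x| M.
  by rewrite mem_set ?mulr1//= in_itv /= -ler_norml.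
by rewrite phi0// mul0r.
Qed.

Definition test_fun u := [/\ continuous (fun x => Re (u x)),
  continuous (fun x => Im (u x)), (exists M, forall x, sqnormc (u x) <= M) &
  bounded_support u].

Lemma test_fun_cmeasurable u : test_fun u -> cmeasurable_fun setT u.
Proof. by move=> [cr ci _ _]; split; exact: continuous_measurable_fun. Qed.

Lemma test_fun_L2 u : test_fun u -> L2R u.
Proof.
move=> tu; have [cr ci [M uM] [N u0]] := tu.
apply: (@L2on_dom _ _ _ leb setT measurableT _ (fun x => M * \1_(`[- N, N]%classic : set R) x)).
- exact: test_fun_cmeasurable.
- by apply: integrableZE => //; exact: integrable_symmetric_indic.
- move=> x _; rewrite indicE; have [xN|xN] := leP `|x| N.
    by rewrite mem_set ?mulr1//= in_itv /= -ler_norml.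
  by rewrite u0// sqnormc0 mulr_ge0// (le_trans _ (uM x))// sqnormc_ge0.
Qed.

Lemma test_fun_integrable u : test_fun u -> CiR u.
Proof.
move=> tu; apply: L2_bounded_support_integrable; first exact: test_fun_L2.
by case: tu.
Qed.

Definition conv h phi t := CintR (fun x => h (t - x) * phi x).

Lemma integrable_affine (a b : R) (f : R -> R) : a != 0 ->
  leb.-integrable setT (EFin \o f) ->
  leb.-integrable setT (EFin \o (fun x => f (a * x + b))).
Proof.
move=> a0 /integrableP[mf fi]; apply/integrableP; split.
  exact: (measurableT_comp mf (measurable_affine a b)).
have mn : measurable_fun setT (fun x => `|(f x)%:E|)%E.
  exact: (measurableT_comp (@abse_measurable _ _) mf).
have E := ge0_integral_affine b a0 mn (fun x => abse_ge0 _).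
by rewrite /= E; apply: lte_mul_pinfty => //; rewrite lee_fin invr_ge0.
Qed.

Lemma Cintegrable_affine (a b : R) f : a != 0 -> CiR f ->
  CiR (fun x => f (a * x + b)).
Proof.
move=> a0 [fr fi]; split.
  exact: (integrable_affine b a0 fr).
exact: (integrable_affine b a0 fi).
Qed.

Definition fourier u xi := CintR (fun x => u x * expi (- (xi * x))).

Lemma L2_reflect h t : L2R h -> L2R (fun x => h (t - x)) /\
  nrm2R (fun x => h (t - x)) = nrm2R h.
Proof.
move=> Lh; have n1 : (-1 : R) != 0 by rewrite oppr_eq0 oner_eq0.
have := L2_affine t n1 Lh; rewrite normrN normr1 invr1 mul1r.
by under eq_fun do rewrite mulN1r addrC.
Qed.

Lemma conv_integrable h phi t : L2R h -> L2R phi -> CiR (fun x => h (t - x) * phi x).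
Proof. by move=> Lh Lphi; apply: CintegrableM => //; case: (L2_reflect t Lh). Qed.

Lemma sqnormc_conv_le h phi t : L2R h -> L2R phi ->
  sqnormc (conv h phi t) <= nrm2R h * nrm2R phi.
Proof.
move=> Lh Lphi; have [Lr <-] := L2_reflect t Lh.
have := CauchySchwarz measurableT Lr (L2onJ measurableT Lphi).
have -> : nrm2R (fun x => conjc (phi x)) = nrm2R phi.
  by rewrite /nrm2; under eq_Rintegral do rewrite sqnormcJ.
by rewrite /dotp; under eq_fun do rewrite conjcK.
Qed.

(** Continuity passes from [h] to the convolution by dominated convergence: [h] is bounded, and
    [phi], square-integrable with bounded support, is integrable. The radii of the supports add
    up. *)
Lemma test_fun_conv h phi : test_fun h -> L2R phi -> bounded_support phi ->
  test_fun (conv h phi).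
Proof.
move=> th Lphi sphi; have Lh := test_fun_L2 th.
have iphi := L2_bounded_support_integrable Lphi sphi.
have [hr hi [K hK] [M h0]] := th; have [N phi0] := sphi.
have ib : leb.-integrable setT (EFin \o (fun x => 2 * ((1 + K) * nabs (phi x)))).
  by do 2 apply: integrableZE => //; exact: integrable_nabs.
have bd t x : nabs (h (t - x) * phi x) <= 2 * ((1 + K) * nabs (phi x)).
  rewrite (le_trans (nabsM_le _ _))// ler_wpM2l// ler_wpM2r ?nabs_ge0//.
  by rewrite (le_trans (nabs_le_sqnormc _))// lerD2l.
have crefl (g : R -> R) x : continuous g -> continuous (fun t => g (t - x)).
  move=> cg t; apply: (@continuous_comp _ _ _ (fun t => t - x) g); last exact: cg.
  by apply: cvgB; [exact: cvg_id|exact: cvg_cst].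
split.
- move=> t0; have t0I : t0 \in `]t0 - 1, t0 + 1[%classic.
    by rewrite inE /= in_itv /=; apply/andP; split; lra.
  refine (@continuity_under_integral _ _ _ leb
    (fun t x => Re (h (t - x) * phi x)) setT measurableT (t0 - 1) (t0 + 1) _ _ _ ib _ t0 t0I).
  + by move=> t _; case: (conv_integrable t Lh Lphi).
  + apply/aeW => x _ t _; under eq_fun do rewrite cReM.
    by apply: cvgB; apply: cvgMr_tmp; [exact: (crefl _ x hr)|exact: (crefl _ x hi)].
  + by move=> t _; apply/aeW => x _; exact: le_trans (normRe_le_nabs _) (bd t x).
- move=> t0; have t0I : t0 \in `]t0 - 1, t0 + 1[%classic.
    by rewrite inE /= in_itv /=; apply/andP; split; lra.
  refine (@continuity_under_integral _ _ _ leb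
    (fun t x => Im (h (t - x) * phi x)) setT measurableT (t0 - 1) (t0 + 1) _ _ _ ib _ t0 t0I).
  + by move=> t _; case: (conv_integrable t Lh Lphi).
  + apply/aeW => x _ t _; under eq_fun do rewrite cImM.
    by apply: cvgD; apply: cvgMr_tmp; [exact: (crefl _ x hr)|exact: (crefl _ x hi)].
  + by move=> t _; apply/aeW => x _; exact: le_trans (normIm_le_nabs _) (bd t x).
- by exists (nrm2R h * nrm2R phi) => t; exact: sqnormc_conv_le.
- exists (M + N) => t Mt; rewrite /conv.
  rewrite (@eq_Cintegral _ _ _ _ _ _ (fun=> 0)).
    rewrite /Cintegral /Rintegral /=; under eq_integral do rewrite /=.
    by rewrite integral0.
  move=> x _; have [xN|xN] := leP `|x| N; last by rewrite phi0// mulr0.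
  rewrite h0 ?mul0r//; have := ler_normD (t - x) x; rewrite subrK; lra.
Qed.

Lemma Cintegral_Fubini (F : R * R -> R[i]) :
  Cintegrable (leb \x leb)%E setT F ->
  CintR (fun x => CintR (fun y => F (x, y))) = CintR (fun y => CintR (fun x => F (x, y))).
Proof.
move=> [ir ii]; apply: complex_ext => /=.
  exact: (Rintegral_Fubini ir).
exact: (Rintegral_Fubini ii).
Qed.

Lemma Cintegrable_expi u (xi : R) : CiR u -> CiR (fun x => u x * expi (- (xi * x))).
Proof.
move=> iu; have := integrable_nabs measurableT iu => /(integrableZE measurableT 2).
move=> /(integrableZE measurableT 2) ib; apply: (nabs_Cintegrable measurableT _ ib).
  apply: cmeasurable_funM; first exact: Cintegrable_meas iu.
  apply: cmeasurable_expi; apply: measurable_funN; exact: mulrl_measurable.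
move=> x _; rewrite (le_trans (nabsM_le _ _))// ler_wpM2l// mulrC.
by rewrite ler_wpM2r ?nabs_ge0// nabs_expi.
Qed.

Lemma cmeasurable_fourier u : cmeasurable_fun setT u -> cmeasurable_fun setT (fourier u).
Proof.
move=> mu; have [mr mi] : cmeasurable_fun setT
    (fun z : R * R => u z.2 * expi (- (z.1 * z.2))).
  apply: cmeasurable_funM.
    by case: mu => ur ui; split; [exact: (measurableT_comp ur measurable_snd)|
      exact: (measurableT_comp ui measurable_snd)].
  apply: cmeasurable_expi; apply: measurable_funN.
  by apply: measurable_funM; [exact: measurable_fst|exact: measurable_snd].
split; first exact: (measurable_Rintegral leb mr).
exact: (measurable_Rintegral leb mi).
Qed.

Lemma cmeasurable_sub_comp h : cmeasurable_fun setT h ->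
  cmeasurable_fun setT (fun z : R * R => h (z.2 - z.1)).
Proof.
have m : measurable_fun setT (fun z : R * R => z.2 - z.1).
  by apply: measurable_funB; [exact: measurable_snd|exact: measurable_fst].
by move=> [hr hi]; split; [exact: (measurableT_comp hr m)|exact: (measurableT_comp hi m)].
Qed.

Lemma fourier_conv h phi xi : test_fun h -> L2R phi -> bounded_support phi ->
  fourier (conv h phi) xi = fourier h xi * fourier phi xi.
Proof.
move=> th Lphi sphi; have Lh := test_fun_L2 th.
have iphi := L2_bounded_support_integrable Lphi sphi.
have ih := test_fun_integrable th.
have [hr hi [K hK] [M h0]] := th; have [N phi0] := sphi.
pose F (z : R * R) := h (z.2 - z.1) * phi z.1 * expi (- (xi * z.2)).
have mF : @cmeasurable_fun _ (measurableTypeR R * measurableTypeR R)%type R setT F.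
  apply: cmeasurable_funM; last first.
    apply: cmeasurable_expi; apply: measurable_funN.
    exact: (measurableT_comp (mulrl_measurable xi) measurable_snd).
  apply: cmeasurable_funM; first by apply: cmeasurable_sub_comp; case: Lh.
  have [pr pi] := Cintegrable_meas iphi.
  by split; [exact: (measurableT_comp pr measurable_fst)|
    exact: (measurableT_comp pi measurable_fst)].
have iF : Cintegrable (leb \x leb)%E setT F.
  (* The factor 8 is 2 from each of two uses of [nabsM_le] and 2 from [nabs_expi]. In the variable
     [t] the integrand lives on [[- (M + N), M + N]]. *)
  have i1 : leb.-integrable setT (EFin \o (fun x => 8 * ((1 + K) * nabs (phi x)))).
    by do 2 apply: integrableZE => //; exact: integrable_nabs.
  have ib := integrable_tensor i1 (integrable_symmetric_indic (M + N)).
  apply: (nabs_Cintegrable measurableT mF ib) => -[x t] _ /=; rewrite /F /=.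
  have K0 : 0 <= 1 + K by rewrite addr_ge0// (le_trans _ (hK 0))// sqnormc_ge0.
  have [xN|xN] := leP `|x| N; last first.
    by rewrite phi0// mulr0 mul0r /nabs /= normr0 addr0 !mulr_ge0.
  have [xM|xM] := leP `|t - x| M; last first.
    rewrite h0// mul0r mul0r {1}/nabs /= normr0 addr0 !mulr_ge0// ?nabs_ge0//.
  rewrite indicE mem_set; last first.
    rewrite /= in_itv /= -ler_norml.
    by have := ler_normD (t - x) x; rewrite subrK; lra.
  rewrite mulr1 (le_trans (nabsM_le _ _))//.
  have b1 : nabs (h (t - x) * phi x) <= 2 * ((1 + K) * nabs (phi x)).
    rewrite (le_trans (nabsM_le _ _))// ler_wpM2l// ler_wpM2r ?nabs_ge0//.
    by rewrite (le_trans (nabs_le_sqnormc _))// lerD2l.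
  have b2 := nabs_expi (- (xi * t)).
  have b3 := nabs_ge0 (h (t - x) * phi x).
  have b4 := nabs_ge0 (expi (- (xi * t))).
  nra.
rewrite /fourier.
transitivity (CintR (fun t => CintR (fun x => F (x, t)))).
  apply: eq_Cintegral => t _; rewrite /conv /F /= mulrC -CintegralZ//; last exact: conv_integrable.
  by apply: eq_Cintegral => x _; rewrite mulrC.
rewrite -Cintegral_Fubini// -CintegralZ//; last exact: Cintegrable_expi.
apply: eq_Cintegral => x _; rewrite /F /=.
transitivity (CintR (fun t => (phi x * expi (- (xi * x))) *
    ((fun y : R => h y * expi (- (xi * y))) (1 * t + - x)))).
  apply: eq_Cintegral => t _ /=; have -> : - (xi * t) = - (xi * x) + - (xi * (t - x)) by ring.
  rewrite expiD mul1r; ring.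
rewrite CintegralZ//.
  rewrite (@Cintegral_affine 1 (- x) (fun y => h y * expi (- (xi * y)))) ?oner_eq0//.
    by rewrite normr1 invr1 mul1r mulrC.
  exact: Cintegrable_meas (Cintegrable_expi _ ih).
apply: (@Cintegrable_affine 1 (- x) (fun y => h y * expi (- (xi * y)))).
  exact: oner_neq0.
exact: Cintegrable_expi.
Qed.

Lemma fourier_reflect_conj u xi : cmeasurable_fun setT u -> CiR u ->
  fourier (fun x => conjc (u (- x))) xi = conjc (fourier u xi).
Proof.
move=> mu iu; rewrite /fourier -CintegralJ//; last exact: Cintegrable_expi.
have mg : cmeasurable_fun setT (fun x => conjc (u x * expi (- (xi * x)))).
  by apply: cmeasurable_conjc; exact: Cintegrable_meas (Cintegrable_expi _ iu).
have n1 : (-1 : R) != 0 by rewrite oppr_eq0 oner_eq0.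
have := Cintegral_affine 0 n1 mg; rewrite normrN normr1 invr1 mul1r => <-.
apply: eq_Cintegral => x _; rewrite mulN1r addr0 conjcM -expiN.
by rewrite mulrN !opprK.
Qed.

Lemma test_fun_reflect_conj u : test_fun u -> test_fun (fun x => conjc (u (- x))).
Proof.
move=> [ur ui [M uM] [N u0]]; split.
- under eq_fun do rewrite cReJ.
  move=> x; apply: (@continuous_comp _ _ _ -%R (fun x => Re (u x))); last exact: ur.
  exact: oppr_continuous.
- under eq_fun do rewrite cImJ.
  move=> x; apply: cvgN; apply: (@continuous_comp _ _ _ -%R (fun x => Im (u x))); last exact: ui.
  exact: oppr_continuous.
- by exists M => x; rewrite sqnormcJ.
- by exists N => x xN; rewrite u0 ?normrN// conjc0.
Qed.

(** The autocorrelation [r] of [u] has the Fourier transform [sqnormc (fourier u xi)], which is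
    nonnegative, and [r 0] is the squared norm of [u]. Abel summation recovers [r 0] from the
    integral of that transform. *)
Lemma Plancherel u : test_fun u ->
  (\int[leb]_xi (sqnormc (fourier u xi))%:E = (2 * pi * nrm2R u)%:E)%E.
Proof.
move=> tu; pose v x := conjc (u (- x)).
have tv : test_fun v by exact: test_fun_reflect_conj.
have iu := test_fun_integrable tu.
have mu := test_fun_cmeasurable tu.
pose r := conv u v.
have tr : test_fun r.
  by apply: test_fun_conv => //; [exact: test_fun_L2|case: tv].
have Fr xi : fourier r xi = (sqnormc (fourier u xi))%:C.
  rewrite /r fourier_conv//; [|exact: test_fun_L2|by case: tv].
  by rewrite fourier_reflect_conj// mulcJ.
have r0 : Re (r 0) = nrm2R u.
  rewrite /r /conv; have [_ <-] := L2_reflect 0 (test_fun_L2 tu).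
  transitivity (Re (dotp leb setT (fun x => u (0 - x)) (fun x => u (0 - x)))).
    by congr Re; apply: eq_Cintegral => x _; rewrite /v sub0r.
  by rewrite dotpff.
have [rr ri [M rM] _] := tr.
have ir := test_fun_integrable tr.
have irx xi := Cintegrable_expi xi ir.
pose rho x := Re (r x).
(* Averaging over [xi] and [- xi] cancels the sine terms, leaving the cosine transform of the real
   part of [r]. *)
have q xi : \int[leb]_s (rho s * cos (xi * s)) =
    (sqnormc (fourier u xi) + sqnormc (fourier u (- xi))) / 2.
  have -> : sqnormc (fourier u xi) + sqnormc (fourier u (- xi)) =
      Re (fourier r xi) + Re (fourier r (- xi)) by rewrite !Fr.
  have E y : Re (fourier r y) = \int[leb]_s Re (r s * expi (- (y * s))) by [].
  rewrite !E -RintegralD//; [|by case: (irx xi)|by case: (irx (- xi))].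
  rewrite mulrC -RintegralZl//; last first.
    by apply: integrableDE => //; [case: (irx xi)|case: (irx (- xi))].
  apply: eq_Rintegral => s _; rewrite !cReM mulNr opprK [Re (expi _)]/= [Im (expi _)]/=.
  rewrite [Re (expi _)]/= [Im (expi _)]/= cosN sinN /rho.
  by field.
have q0 xi : 0 <= \int[leb]_s (rho s * cos (xi * s)).
  by rewrite q; apply: divr_ge0 => //; apply: addr_ge0; exact: sqnormc_ge0.
have H : (\int[leb]_(xi in `[0%R, +oo[) (\int[leb]_s (rho s * cos (xi * s)))%:E =
    (pi * nrm2R u)%:E)%E.
  rewrite (@integral_cosine_transform _ rho (1 + M)).
  - by rewrite /rho r0.
  - move=> x; rewrite (le_trans (normRe_le_nabs _))// (le_trans (nabs_le_sqnormc _))//.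
    by rewrite lerD2l.
  - by case: ir.
  - exact: rr.
  - exact: q0.
have mF : measurable_fun setT (fun xi => sqnormc (fourier u xi)).
  apply: measurable_sqnormc; exact: cmeasurable_fourier.
have mq : measurable_fun setT (fun xi : R => \int[leb]_s (rho s * cos (xi * s))).
  rewrite (funext q); apply: measurable_funM => //.
  by apply: measurable_funD => //; exact: (measurableT_comp mF).
have mFE : measurable_fun setT (fun xi => (sqnormc (fourier u xi))%:E).
  exact/measurable_EFinP.
(* Folding the line onto a half-line produces twice the average in [q], hence [2 * pi] instead of
   [pi]. *)
rewrite ge0_integral_half_lines//; last by move=> x; rewrite lee_fin sqnormc_ge0.
rewrite -ge0_integralD//; last 4 first.
- by move=> x _; rewrite lee_fin sqnormc_ge0.
- exact: measurable_funTS.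
- by move=> x _; rewrite lee_fin sqnormc_ge0.
- by apply: measurable_funTS; exact: (measurableT_comp mFE).
rewrite -mulrA EFinM -H -ge0_integralZl_EFin//.
- apply: eq_integral => xi _; rewrite q -EFinM -EFinD; congr EFin.
  by field.
- by move=> xi _; rewrite lee_fin; exact: q0.
- by apply: measurable_funTS; apply/measurable_EFinP; exact: mq.
Qed.

End FourierTransform.

(** * Convolution with a square-integrable function *)

Section ConvolutionL2.
Context (R : realType).
Local Notation leb := (@lebesgue_measure R).
Local Notation L2R := (L2on leb setT).
Local Notation nrm2R := (nrm2 leb setT).
Local Notation CintR := (Cintegral leb setT).
Local Notation CiR := (Cintegrable leb setT).
Implicit Types u h phi : R -> R[i].

Definition trunc (r : R) phi : R -> R[i] :=
  fun x => phi x * ((\1_(`[- r, r]%classic : set R) x : R)%:C).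

Lemma sqnormc_trunc r phi x :
  sqnormc (trunc r phi x) = sqnormc (phi x) * \1_(`[- r, r]%classic : set R) x.
Proof.
rewrite /trunc sqnormcM sqnormc_real indicE.
by case: (_ \in _); rewrite ?expr1n ?expr0n.
Qed.

Lemma cmeasurable_trunc r phi : cmeasurable_fun setT phi ->
  cmeasurable_fun setT (trunc r phi).
Proof.
move=> mphi; apply: cmeasurable_funM => //.
by apply: cmeasurable_real; exact: measurable_indic.
Qed.

Lemma trunc_L2 r phi : L2R phi -> L2R (trunc r phi).
Proof.
move=> Lphi; apply: (@L2on_dom _ _ _ leb setT measurableT _ (fun x => sqnormc (phi x))).
- by apply: cmeasurable_trunc; case: Lphi.
- exact: L2on_integrable.
- move=> x _; rewrite sqnormc_trunc; apply: ler_piMr; first exact: sqnormc_ge0.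
  by rewrite indicE; case: (_ \in _).
Qed.

Lemma trunc_bounded_support r phi : bounded_support (trunc r phi).
Proof.
exists r => x rx; rewrite /trunc indicE memNset ?mulr0//=.
by rewrite in_itv /= -ler_norml leNgt rx.
Qed.

Lemma trunc_id r phi x : `|x| <= r -> trunc r phi x = phi x.
Proof.
by move=> xr; rewrite /trunc indicE mem_set ?mulr1//= in_itv /= -ler_norml.
Qed.

(** The radii are [n * z] because cutting the SAFT integral off at [n] cuts the dilated window off
    at [n * zeta]. *)
Lemma nrm2_trunc_cvg (z : R) phi : 0 < z -> L2R phi ->
  (fun n => nrm2R (fun x => trunc (n%:R * z) phi x - phi x)) @ \oo --> (0 : R).
Proof.
move=> z0 Lphi; pose f n x := sqnormc (trunc (n%:R * z) phi x - phi x).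
have mf n : measurable_fun setT (f n).
  apply: measurable_sqnormc; have [mphi _] := Lphi.
  under eq_fun do rewrite -[X in _ - X]mul1r -mulNr.
  apply: cmeasurable_funD; first exact: cmeasurable_trunc.
  by apply: cmeasurable_funM => //; exact: cmeasurable_cst.
have fle n x : f n x <= sqnormc (phi x).
  rewrite /f; have [xn|xn] := leP `|x| (n%:R * z).
    by rewrite trunc_id// subrr sqnormc0 sqnormc_ge0.
  rewrite /trunc indicE memNset ?mulr0 ?sub0r ?sqnormcN//=.
  by rewrite in_itv /= -ler_norml leNgt xn.
have [] := @dominated_convergence _ _ _ leb setT measurableT (fun n => EFin \o f n)
  (EFin \o (fun=> 0)) (EFin \o (fun x => sqnormc (phi x))).
- by move=> n; apply/measurable_EFinP; exact: mf.
- exact/measurable_EFinP/measurable_cst.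
- apply/aeW => x _; apply: cvg_EFin; first exact: nearW.
  apply: cvg_near_cst; exists (Num.bound (`|x| / z)) => // n /= hn.
  rewrite /f trunc_id ?subrr ?sqnormc0//.
  rewrite -ler_pdivrMr// ltW// (lt_le_trans (archi_boundP _))//.
    by rewrite divr_ge0// ltW.
  by rewrite ler_nat.
- exact: L2on_integrable.
- by apply/aeW => x n _ /=; rewrite lee_fin ger0_norm ?sqnormc_ge0.
move=> _ _; rewrite (_ : (\int[leb]_x (EFin \o (fun=> 0%R)) x = 0)%E); last first.
  by rewrite integral0.
by move/fine_cvg.
Qed.

Lemma cmeasurable_conv h phi : cmeasurable_fun setT h -> cmeasurable_fun setT phi ->
  cmeasurable_fun setT (conv h phi).
Proof.
move=> mh [pr pi]; have [mr mi] : cmeasurable_fun setT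
    (fun z : R * R => h (z.1 - z.2) * phi z.2).
  apply: cmeasurable_funM; last first.
    by split; [exact: (measurableT_comp pr measurable_snd)|
      exact: (measurableT_comp pi measurable_snd)].
  have m : measurable_fun setT (fun z : R * R => z.1 - z.2).
    by apply: measurable_funB; [exact: measurable_fst|exact: measurable_snd].
  case: mh => hr hi.
  by split; [exact: (measurableT_comp hr m)|exact: (measurableT_comp hi m)].
split; first exact: (measurable_Rintegral leb mr).
exact: (measurable_Rintegral leb mi).
Qed.

Lemma convB h phi1 phi2 : L2R h -> L2R phi1 -> L2R phi2 ->
  conv h (fun x => phi1 x - phi2 x) = (fun t => conv h phi1 t - conv h phi2 t).
Proof.
move=> Lh L1 L2; apply/funext => t; rewrite /conv.
have i1 := conv_integrable t Lh L1; have i2 := conv_integrable t Lh L2.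
rewrite -[X in _ = _ - X]mul1r -mulNr -CintegralZ// -CintegralD//; last exact: CintegrableZ.
by apply: eq_Cintegral => x _; ring.
Qed.

Lemma integral_symmetric_indic (M : R) : 0 <= M ->
  (\int[leb]_x (\1_(`[- M, M]%classic : set R) x)%:E = (2 * M)%:E)%E.
Proof.
move=> M0; rewrite integral_indic//= setIT lebesgue_measure_itv /= lte_fin.
case: ifPn => [_|]; first by rewrite -EFinB; congr EFin; ring.
by rewrite -leNgt => M1; congr EFin; lra.
Qed.

(* On the support of [h (t - x)] one may replace [phi x] by its restriction to
   [`|t - x| <= M], which makes Cauchy-Schwarz sufficient. *)
Lemma conv_L2 h phi (M : R) : L2R h -> 0 <= M -> (forall x, M < `|x| -> h x = 0) ->
  L2R phi -> L2R (conv h phi) /\ nrm2R (conv h phi) <= 2 * M * nrm2R h * nrm2R phi.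
Proof.
move=> Lh M0 h0 Lphi; have [mh _] := Lh; have [mphi _] := Lphi.
pose ind : R -> R := \1_(`[- M, M]%classic : set R).
have mind : measurable_fun setT ind by exact: measurable_indic.
pose psi t x := phi x * (ind (t - x))%:C.
have msub t : measurable_fun setT (fun x : R => t - x).
  by apply: measurable_funB => //; exact: measurable_cst.
have s_psi t x : sqnormc (psi t x) = ind (t - x) * sqnormc (phi x).
  rewrite /psi sqnormcM sqnormc_real /ind indicE mulrC.
  by case: (_ \in _); rewrite ?expr1n ?expr0n.
have Lpsi t : L2R (psi t).
  apply: (@L2on_dom _ _ _ leb setT measurableT _ (fun x => sqnormc (phi x))).
  - apply: cmeasurable_funM => //; apply: cmeasurable_real.
    exact: (measurableT_comp mind (msub t)).
  - exact: L2on_integrable.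
  - move=> x _; rewrite s_psi; apply: ler_piMl; first exact: sqnormc_ge0.
    by rewrite /ind indicE; case: (_ \in _).
have E t : conv h phi t = conv h (psi t) t.
  apply: eq_Cintegral => x _; rewrite /psi /ind indicE.
  have [tx|tx] := leP `|t - x| M; last by rewrite h0// !mul0r.
  by rewrite mem_set ?mulr1//= in_itv /= -ler_norml.
have mF : measurable_fun setT (fun z : measurableTypeR R * measurableTypeR R =>
    (ind (z.1 - z.2) * sqnormc (phi z.2))%:E).
  apply/measurable_EFinP; apply: measurable_funM.
    have m : measurable_fun setT (fun z : R * R => z.1 - z.2).
      by apply: measurable_funB; [exact: measurable_fst|exact: measurable_snd].
    exact: (measurableT_comp mind m).
  exact: (measurableT_comp (measurable_sqnormc mphi) measurable_snd).
have F0 (z : measurableTypeR R * measurableTypeR R) :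
    (0 <= (ind (z.1 - z.2) * sqnormc (phi z.2))%:E)%E.
  by rewrite lee_fin mulr_ge0 ?sqnormc_ge0// /ind indicE.
have bound : (\int[leb]_t (sqnormc (conv h phi t))%:E <=
    (2 * M * nrm2R h * nrm2R phi)%:E)%E.
  apply: (@le_trans _ _ (\int[leb]_t ((nrm2R h)%:E *
      (\int[leb]_x (ind (t - x) * sqnormc (phi x))%:E)))%E).
    apply: ge0_le_integral => //.
    - by move=> t _; rewrite lee_fin sqnormc_ge0.
    - by apply/measurable_EFinP/measurable_sqnormc; exact: cmeasurable_conv.
    - apply: measurable_funeM.
      exact: (measurable_fun_fubini_tonelli_F _ mF F0).
    - move=> t _; rewrite E.
      have -> : (\int[leb]_x (ind (t - x) * sqnormc (phi x))%:E = (nrm2R (psi t))%:E)%E.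
        by rewrite nrm2E//; apply: eq_integral => x _; rewrite s_psi.
      by rewrite -EFinM lee_fin; exact: sqnormc_conv_le.
  rewrite ge0_integralZl_EFin ?nrm2_ge0//; last 2 first.
  - by move=> t _; apply: integral_ge0 => x _; exact: (F0 (t, x)).
  - exact: (measurable_fun_fubini_tonelli_F _ mF F0).
  (* After the exchange each [y] is counted over the [x] with [|x - y| <= M], an interval of length
     [2 * M]. *)
  have := @fubini_tonelli _ _ _ _ _ leb leb _ mF F0; rewrite /= => ->.
  have -> : (\int[leb]_y \int[leb]_x (ind (x - y) * sqnormc (phi y))%:E =
     (2 * M * nrm2R phi)%:E)%E.
    transitivity (\int[leb]_y ((2 * M)%:E * (sqnormc (phi y))%:E))%E.
      apply: eq_integral => y _; under eq_integral do rewrite mulrC EFinM.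
      rewrite ge0_integralZl_EFin ?sqnormc_ge0//; last 2 first.
      - by move=> x _; rewrite lee_fin /ind indicE.
      - apply/measurable_EFinP; apply: (measurableT_comp mind).
        by apply: measurable_funB => //; exact: measurable_cst.
      rewrite muleC; congr (_ * _)%E; rewrite -(integral_symmetric_indic M0).
      have := @ge0_integral_affine _ 1 (- y) (fun x => (ind x)%:E) (oner_neq0 _).
      rewrite normr1 invr1 mul1e => <-.
      - by apply: eq_integral => x _; rewrite mul1r.
      - exact/measurable_EFinP.
      - by move=> x; rewrite lee_fin /ind indicE.
    rewrite ge0_integralZl_EFin ?mulr_ge0//.
    - by rewrite -nrm2E// EFinM.
    - by move=> x _; rewrite lee_fin sqnormc_ge0.
    - exact/measurable_EFinP/measurable_sqnormc.
  by rewrite -EFinM lee_fin le_eqVlt; apply/orP; left; apply/eqP; ring.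
by apply: L2on_le => //; exact: cmeasurable_conv.
Qed.

Lemma conv_trunc_cvg h phi (z : R) : test_fun h -> L2R phi -> 0 < z ->
  (fun n => nrm2R (conv h (trunc (n%:R * z) phi))) @ \oo --> nrm2R (conv h phi).
Proof.
move=> th Lphi z0; have Lh := test_fun_L2 th; have [_ _ _ [M h0]] := th.
have h0' x : `|M| < `|x| -> h x = 0 by move=> xM; apply: h0; rewrite (le_lt_trans (ler_norm _)).
have cL f : L2R f -> L2R (conv h f) /\ nrm2R (conv h f) <= 2 * `|M| * nrm2R h * nrm2R f.
  by move=> Lf; apply: conv_L2.
apply: nrm2_cvg => //.
- by case: (cL _ Lphi).
- by move=> n; case: (cL _ (trunc_L2 (n%:R * z) Lphi)).
have lim : (fun n => 2 * `|M| * nrm2R h *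
    nrm2R (fun x => trunc (n%:R * z) phi x - phi x)) @ \oo --> (0 : R).
  rewrite -(mulr0 (2 * `|M| * nrm2R h)); apply: cvgMl_tmp; exact: nrm2_trunc_cvg.
apply: (squeeze_cvgr _ (@cvg_cst _ (0 : R) _ _ _) lim).
apply: nearW => n; rewrite nrm2_ge0/= -convB//; last exact: trunc_L2.
by apply: (cL _ _).2; apply: L2onB => //; exact: trunc_L2.
Qed.

Lemma Plancherel_conv h phi : test_fun h -> L2R phi -> bounded_support phi ->
  (\int[leb]_xi (sqnormc (fourier h xi * fourier phi xi))%:E =
   (2 * pi * nrm2R (conv h phi))%:E)%E.
Proof.
move=> th Lphi sphi; rewrite -Plancherel; last exact: test_fun_conv.
by apply: eq_integral => xi _; rewrite fourier_conv.
Qed.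

Lemma fourier_bounded u : CiR u -> exists2 C : R, 0 <= C &
  forall xi, sqnormc (fourier u xi) <= C.
Proof.
move=> iu; pose N := \int[leb]_x nabs (u x).
have N0 : 0 <= N by apply: Rintegral_ge0 => x _; exact: nabs_ge0.
(* Here 8 collects a factor 2 from each of [nabs_Cintegral_le], [nabsM_le] and [nabs_expi]. *)
exists ((8 * N) ^+ 2) => [|xi]; first exact: sqr_ge0.
have h : nabs (fourier u xi) <= 8 * N.
  apply: (le_trans (nabs_Cintegral_le measurableT (Cintegrable_expi xi iu))).
  rewrite (_ : 8 * N = 2 * (4 * N)); last by ring.
  rewrite ler_wpM2l// -RintegralZl//; last exact: integrable_nabs.
  apply: le_Rintegral => //.
  - by apply: integrable_nabs => //; exact: Cintegrable_expi.
  - by apply: integrableZE => //; exact: integrable_nabs.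
  move=> x _; rewrite (le_trans (nabsM_le _ _))//.
  have := nabs_expi (- (xi * x)); have := nabs_ge0 (u x); nra.
apply: (@le_trans _ _ (nabs (fourier u xi) ^+ 2)); last first.
  by rewrite ler_sqr ?nnegrE ?nabs_ge0 ?mulr_ge0.
rewrite /sqnormc /nabs -(real_normK (num_real (Re _))) -(real_normK (num_real (Im _))).
have := normr_ge0 (Re (fourier u xi)); have := normr_ge0 (Im (fourier u xi)); nra.
Qed.

End ConvolutionL2.

(** * Fourier transforms as SAFTs *)

Section SaftPlancherel.
Context (R : realType).
Local Notation leb := (@lebesgue_measure R).
Local Notation L2R := (L2on leb setT).
Local Notation nrm2R := (nrm2 leb setT).
Local Notation CintR := (Cintegral leb setT).
Local Notation CiR := (Cintegrable leb setT).
Variable L : saft_param R.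
Local Notation A := (sA L).
Local Notation B := (sB L).
Local Notation D := (sD L).
Local Notation p := (sp L).
Local Notation q := (sq L).
Hypothesis hB : B != 0.

Lemma sqnormcV (z : R[i]) : sqnormc z^-1 = (sqnormc z)^-1.
Proof.
have [->|z0] := eqVneq z 0; first by rewrite invr0 sqnormc0 invr0.
have s0 : sqnormc z != 0 by apply: contra_neq z0; exact: sqnormc_eq0.
apply: (mulIf s0); rewrite mulVf// -sqnormcM mulVf//.
by rewrite sqnormc_real expr1n.
Qed.

(** For [B < 0] the root in [K_B] is imaginary. Only its square is used: [sqnormc] of the root is
    the nonnegative number whose square is [(2 * pi * B) ^+ 2]. *)
Lemma sqnormc_K_B : sqnormc (K_B L) = (2 * pi * `|B|)^-1.
Proof.
rewrite /K_B sqnormcV; congr (_^-1).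
have h : sqnormc (sqrtc (2 * pi * B)%:C) ^+ 2 = (2 * pi * B) ^+ 2.
  by rewrite expr2 -sqnormcM -expr2 sqr_sqrtc sqnormc_real.
have p0 : 0 <= 2 * (pi : R) by rewrite mulr_ge0// pi_ge0.
have b0 : 0 <= 2 * pi * `|B| by rewrite mulr_ge0.
apply/eqP; rewrite -(@eqrXn2 _ 2 _ _ isT (sqnormc_ge0 _) b0); apply/eqP.
by rewrite h !exprMn real_normK ?num_real.
Qed.

(* [wavelet_transform L psi g (t, zeta)] is, up to a factor of constant
   modulus, the value at [t] of the convolution of [g(x) e^(i A x^2 / 2B)] with
   [chirped_window psi zeta]. *)
Definition chirped_window (psi : R -> R[i]) (zeta y : R) : R[i] :=
  conjc (psi (- zeta^-1 * y + 0)) * expi (A * y ^+ 2 / (2 * B)).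

Lemma chirped_window_L2 psi zeta : L2R psi -> 0 < zeta -> L2R (chirped_window psi zeta).
Proof.
move=> Lpsi z0; have n0 : - zeta^-1 != 0 by rewrite oppr_eq0 invr_eq0 gt_eqF.
have [Lr _] := L2_affine 0 n0 Lpsi.
apply: (@L2on_dom _ _ _ leb setT measurableT _ (fun y => sqnormc (psi (- zeta^-1 * y + 0)))).
- apply: cmeasurable_funM; first by apply: cmeasurable_conjc; case: Lr.
  apply: cmeasurable_expi; apply: continuous_measurable_fun => y.
  by apply: cvgMr_tmp; apply: cvgMl_tmp; exact: exprn_continuous.
- exact: L2on_integrable.
- by move=> y _; rewrite sqnormcM sqnormc_expi mulr1 sqnormcJ.
Qed.

Let saft_phase (w : R) : R[i] :=
  conjc (K_B L) * expi ((- (2 * w * (D * p - B * q)) + D * w ^+ 2) / (2 * B)).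

(** The exponents of [Psi] and of the kernel add up to [(A (zeta x)^2 + 2 x (zeta p - w)) / 2B] plus
    a function of [w]. The choice [w = zeta (B xi + p)] turns the linear term into [- xi (zeta x)],
    so the substitution [y = zeta x] leaves the Fourier integral of the chirped window. *)
Lemma truncated_saft_Psi psi zeta n xi : L2R psi -> 0 < zeta ->
  truncated_saft L (Psi L psi zeta) n (zeta * (B * xi + p)) =
  saft_phase (zeta * (B * xi + p)) * (zeta^-1)%:C *
    fourier (trunc (n%:R * zeta) (chirped_window psi zeta)) xi.
Proof.
move=> Lpsi z0; set w := zeta * (B * xi + p); set phi := chirped_window psi zeta.
have Lphi : L2R phi by exact: chirped_window_L2.
pose G y := trunc (n%:R * zeta) phi y * expi (- (xi * y)).
have iphi : CiR (trunc (n%:R * zeta) phi).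
  apply: L2_bounded_support_integrable; first exact: trunc_L2.
  exact: trunc_bounded_support.
have iG : CiR G by exact: Cintegrable_expi.
have zn : zeta != 0 by rewrite gt_eqF.
transitivity (CintR (fun x => saft_phase w * G (zeta * x + 0))).
  rewrite /truncated_saft /Cintegral.
  have E (x : R) : (if x \in (`[- n%:R, n%:R]%classic : set R)
      then Psi L psi zeta x * saft_kernel L x w else 0) = saft_phase w * G (zeta * x + 0).
    rewrite addr0 /G.
    have [xn|xn] := leP `|x| n%:R.
      rewrite mem_set /=; last by rewrite in_itv /= -ler_norml.
      rewrite trunc_id; last first.
        by rewrite normrM (gtr0_norm z0) mulrC ler_wpM2r// ltW.
      rewrite /phi /chirped_window /Psi /saft_kernel /saft_phase addr0.
      have -> : - zeta^-1 * (zeta * x) = - x by rewrite mulNr mulrA mulVf// mul1r.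
      rewrite [RHS](_ : _ = conjc (K_B L) * conjc (psi (- x)) *
        (expi ((- (2 * w * (D * p - B * q)) + D * w ^+ 2) / (2 * B)) *
        (expi (A * (zeta * x) ^+ 2 / (2 * B)) * expi (- (xi * (zeta * x))))));
        last by ring.
      set e1 := expi (_ / _); set e2 := expi ((_ + D * w ^+ 2) / (2 * B)).
      rewrite [LHS](_ : _ = conjc (K_B L) * conjc (psi (- x)) * (e1 * e2)); last by ring.
      rewrite /e1 /e2 -!expiD; congr (_ * expi _).
      by rewrite /w; field.
    rewrite memNset /=; last by rewrite in_itv /= -ler_norml leNgt xn.
    rewrite /trunc indicE memNset ?mulr0 ?mul0r ?mulr0//=.
    by rewrite in_itv /= -ler_norml normrM (gtr0_norm z0) mulrC ler_pM2r// leNgt xn.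
  congr (_ +i* _); rewrite Rintegral_mkcond; apply: eq_Rintegral => x _;
    by rewrite -E patchE; case: ifP.
rewrite CintegralZ//; last exact: (Cintegrable_affine 0 zn iG).
rewrite (Cintegral_affine 0 zn (Cintegrable_meas iG)) gtr0_norm//.
by rewrite mulrA.
Qed.

Lemma sqnormc_truncated_saft_Psi psi zeta n xi : L2R psi -> 0 < zeta ->
  sqnormc (truncated_saft L (Psi L psi zeta) n (zeta * (B * xi + p))) =
  (2 * pi * `|B| * zeta ^+ 2)^-1 *
    sqnormc (fourier (trunc (n%:R * zeta) (chirped_window psi zeta)) xi).
Proof.
move=> Lpsi z0; rewrite truncated_saft_Psi// !sqnormcM sqnormc_expi sqnormcJ mulr1.
by rewrite sqnormc_K_B sqnormc_real exprVn -invfM.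
Qed.

Lemma cmeasurable_truncated_saft_Psi psi zeta n : L2R psi -> 0 < zeta ->
  cmeasurable_fun setT (truncated_saft L (Psi L psi zeta) n).
Proof.
move=> Lpsi z0; have zn : zeta != 0 by rewrite gt_eqF.
set phi := trunc (n%:R * zeta) (chirped_window psi zeta).
have E w : truncated_saft L (Psi L psi zeta) n w =
    saft_phase w * (zeta^-1)%:C * fourier phi ((B * zeta)^-1 * w + - (p / B)).
  have {1}-> : w = zeta * (B * ((B * zeta)^-1 * w + - (p / B)) + p) by field; rewrite hB.
  rewrite truncated_saft_Psi//; congr (saft_phase _ * _ * _).
  by field; rewrite hB.
rewrite (funext E).
have Lphi : L2R phi by apply: trunc_L2; exact: chirped_window_L2.
apply: cmeasurable_funM; last first.
  by apply: cmeasurable_affine; apply: cmeasurable_fourier; case: Lphi.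
apply: cmeasurable_funM; last exact: cmeasurable_cst.
apply: cmeasurable_funM; first exact: cmeasurable_cst.
apply: cmeasurable_expi; apply: continuous_measurable_fun => w.
apply: cvgMr_tmp; apply: cvgD.
  by apply: cvgN; apply: cvgMr_tmp; apply: cvgMl_tmp; exact: cvg_id.
by apply: cvgMl_tmp; exact: exprn_continuous.
Qed.

(* Plancherel's formula for [h * phi], where the Fourier transform of the
   square-integrable function [phi] is read off the given SAFT. *)
Lemma integral_fourier_saft psi zeta (F : R -> R[i]) h : L2R psi -> 0 < zeta ->
  is_saft L (Psi L psi zeta) F -> test_fun h ->
  (\int[leb]_xi (sqnormc (fourier h xi * F (zeta * (B * xi + p))))%:E =
   ((`|B| * zeta ^+ 2)^-1 * nrm2R (conv h (chirped_window psi zeta)))%:E)%E.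
Proof.
move=> Lpsi z0 [mF saftF] th; have zn : zeta != 0 by rewrite gt_eqF.
set phi := chirped_window psi zeta; have Lphi : L2R phi by exact: chirped_window_L2.
pose gam n := truncated_saft L (Psi L psi zeta) n.
have mgam n : cmeasurable_fun setT (gam n) by exact: cmeasurable_truncated_saft_Psi.
have zB0 : zeta * B != 0 by rewrite mulf_neq0.
have Ew xi : zeta * (B * xi + p) = (zeta * B) * xi + zeta * p by ring.
pose a xi := fourier h xi * F (zeta * (B * xi + p)).
pose a_ n xi := fourier h xi * gam n (zeta * (B * xi + p)).
have mfh : cmeasurable_fun setT (fourier h).
  by apply: cmeasurable_fourier; exact: test_fun_cmeasurable.
have ma : cmeasurable_fun setT a.
  apply: cmeasurable_funM => //; under eq_fun do rewrite Ew.
  exact: cmeasurable_affine.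
have ma_ n : cmeasurable_fun setT (a_ n).
  apply: cmeasurable_funM => //; under eq_fun do rewrite Ew.
  exact: cmeasurable_affine.
have Bp : 0 < `|B| by rewrite normr_gt0.
have c0 : 0 < 2 * pi * `|B| * zeta ^+ 2 by rewrite !mulr_gt0 ?pi_gt0.
(* For the cut-off window the SAFT is a genuine Fourier transform; the [2 * pi] of Plancherel's
   formula cancels the one in [sqnormc_K_B]. *)
have Ia n : (\int[leb]_xi (sqnormc (a_ n xi))%:E =
    ((`|B| * zeta ^+ 2)^-1 * nrm2R (conv h (trunc (n%:R * zeta) phi)))%:E)%E.
  have := Plancherel_conv th (trunc_L2 (n%:R * zeta) Lphi) (@trunc_bounded_support _ _ _).
  move=> P; transitivity (((2 * pi * `|B| * zeta ^+ 2)^-1)%:E *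
     \int[leb]_xi (sqnormc (fourier h xi * fourier (trunc (n%:R * zeta) phi) xi))%:E)%E.
    rewrite -ge0_integralZl_EFin//.
    - apply: eq_integral => xi _; rewrite -EFinM; congr EFin.
      by rewrite !sqnormcM sqnormc_truncated_saft_Psi//; ring.
    - by move=> xi _; rewrite lee_fin sqnormc_ge0.
    - apply/measurable_EFinP/measurable_sqnormc; apply: cmeasurable_funM => //.
      by apply: cmeasurable_fourier; apply: cmeasurable_trunc; case: Lphi.
    - by rewrite invr_ge0 ltW.
  rewrite P -EFinM; congr EFin.
  move: (pi : R) (lt0r_neq0 (pi_gt0 R)) => P' P'0; field.
  by rewrite zn P'0 gt_eqF.
have La_ n : L2R (a_ n) by split; [exact: ma_|rewrite Ia ltry].
have Na n : nrm2R (a_ n) = (`|B| * zeta ^+ 2)^-1 * nrm2R (conv h (trunc (n%:R * zeta) phi)).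
  by apply: EFin_inj; rewrite nrm2E.
have [C C0 hC] := fourier_bounded (test_fun_integrable th).
have mdiff n : cmeasurable_fun setT (fun w => F w - gam n w).
  under eq_fun do rewrite -[X in _ - X]mul1r -mulNr.
  by apply: cmeasurable_funD => //; apply: cmeasurable_funM => //; exact: cmeasurable_cst.
have madiff n : cmeasurable_fun setT (fun x => a_ n x - a x).
  under eq_fun do rewrite -[X in _ - X]mul1r -mulNr.
  by apply: cmeasurable_funD => //; apply: cmeasurable_funM => //; exact: cmeasurable_cst.
pose S n := (\int[leb]_w (sqnormc (F w - gam n w))%:E)%E.
(* The bound [C] on the squared modulus of [fourier h] carries the convergence in the mean of the
   truncated SAFTs over to [a_ n]. *)
have diff n : (\int[leb]_xi (sqnormc (a_ n xi - a xi))%:E <=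
    (C * `|zeta * B|^-1)%:E * S n)%E.
  rewrite EFinM -muleA.
  have := @ge0_integral_affine _ (zeta * B) (zeta * p)
    (fun w => (sqnormc (F w - gam n w))%:E) zB0 => <-; last 2 first.
  - exact/measurable_EFinP/measurable_sqnormc.
  - by move=> w; rewrite lee_fin sqnormc_ge0.
  rewrite -ge0_integralZl_EFin//; last 2 first.
  - by move=> w _; rewrite lee_fin sqnormc_ge0.
  - apply/measurable_EFinP; apply: measurable_sqnormc.
    exact: (cmeasurable_affine (zeta * B) (zeta * p) (mdiff n)).
  apply: ge0_le_integral => //.
  - by move=> w _; rewrite lee_fin sqnormc_ge0.
  - by apply/measurable_EFinP; apply: measurable_sqnormc; exact: madiff.
  - apply: measurable_funeM; apply/measurable_EFinP; apply: measurable_sqnormc.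
    exact: (cmeasurable_affine (zeta * B) (zeta * p) (mdiff n)).
  - move=> xi _; rewrite -EFinM lee_fin /a /a_ -mulrBr sqnormcM -Ew.
    rewrite -(sqnormcN (_ - _)) opprB.
    by rewrite ler_wpM2r ?sqnormc_ge0.
(* Convergence to 0 among extended reals gives finiteness only for large [n]; one such index already
   shows that [a] is square-integrable. *)
have Sfin : \forall n \near \oo, (S n < +oo)%E.
  have := cvg_is_fine saftF; apply: filterS => n hn.
  by rewrite ltey_eq hn.
have La : L2R a.
  have [N _ hN] := Sfin; have SN := hN N (leqnn _).
  have Ld : L2R (fun x => a_ N x - a x).
    split; first exact: madiff.
    apply: (le_lt_trans (diff N)).
    by apply: lte_mul_pinfty => //; rewrite lee_fin mulr_ge0.
  have -> : a = (fun x => a_ N x - (a_ N x - a x)) by apply/funext => x; ring.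
  exact: L2onB.
have dcvg : (fun n => nrm2R (fun x => a_ n x - a x)) @ \oo --> (0 : R).
  have lim : (fun n => C * `|zeta * B|^-1 * fine (S n)) @ \oo --> (0 : R).
    rewrite -(mulr0 (C * `|zeta * B|^-1)); apply: cvgMl_tmp.
    exact: (fine_cvg saftF).
  apply: (squeeze_cvgr _ (@cvg_cst _ (0 : R) _ _ _) lim).
  apply: filterS Sfin => n Sn; rewrite nrm2_ge0/=.
  rewrite -lee_fin nrm2E//; last exact: L2onB.
  have S0 : (0 <= S n)%E by apply: integral_ge0 => w _; rewrite lee_fin sqnormc_ge0.
  by rewrite EFinM fineK ?ge0_fin_numE.
(* The norms of [a_ n] have two limits to be equated: [c1] on the frequency side, and [c2] for the
   convolutions with the cut-off windows. *)
have c1 := nrm2_cvg measurableT La La_ dcvg.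
have c2 : (fun n => nrm2R (a_ n)) @ \oo --> (`|B| * zeta ^+ 2)^-1 * nrm2R (conv h phi).
  rewrite (funext Na); apply: cvgMl_tmp; exact: conv_trunc_cvg.
rewrite -nrm2E//; congr EFin.
by rewrite -(cvg_lim _ c1)// (cvg_lim _ c2).
Qed.

End SaftPlancherel.

(** * The transform of a test function *)

Section HalfPlane.
Context (R : realType).
Local Notation leb := (@lebesgue_measure R).
Local Notation L2R := (L2on leb setT).
Local Notation nrm2R := (nrm2 leb setT).
Local Notation CintR := (Cintegral leb setT).
Local Notation CiR := (Cintegrable leb setT).
Local Notation H := (@half_plane R).
Local Notation mu2 := (@plane_measure R).

Lemma measurable_invr : measurable_fun setT (fun x : R => x^-1).
Proof.
have o0 : open [set x : R | x != 0].
  by rewrite openE => x /= x0; apply: (open_neq x0).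
have -> : [set: R] = [set x : R | x != 0] `|` [set 0].
  by apply/seteqP; split => x //= _; have [->|] := eqVneq x 0; [right|left].
apply/measurable_funU => //; first exact: open_measurable.
split; last exact: measurable_fun_set1.
apply: open_continuous_measurable_fun => // x /set_mem /= x0.
exact: inv_continuous.
Qed.

Lemma measurable_half_plane : measurable (H : set (measurableTypeR R * measurableTypeR R)).
Proof. by apply: measurableX => //; exact: measurable_itv. Qed.

Lemma half_planeE (t zeta : R) : H (t, zeta) = (0 < zeta) :> Prop.
Proof.
by rewrite /half_plane; apply/propext; split => /=; [case; rewrite in_itv/= andbT|
  move=> z0; split => //; rewrite in_itv/= andbT].
Qed.

(** Both orders of integration serve: with [zeta] fixed Plancherel's formula applies, with the
    frequency fixed the integral over [zeta] is the admissibility integral. *)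
Lemma half_plane_Tonelli (f : R * R -> \bar R) :
  measurable_fun (H : set (measurableTypeR R * measurableTypeR R)) f ->
  (forall z, H z -> (0 <= f z)%E) ->
  [/\ measurable_fun setT (fun t : measurableTypeR R =>
        \int[leb]_(zeta in `]0%R, +oo[) f (t, zeta))%E,
    (\int[mu2]_(z in H) f z =
     \int[leb]_(zeta in `]0%R, +oo[) \int[leb]_t f (t, zeta))%E &
    (\int[mu2]_(z in H) f z =
     \int[leb]_t \int[leb]_(zeta in `]0%R, +oo[) f (t, zeta))%E].
Proof.
move=> mf f0; have mfH : measurable_fun [set: measurableTypeR R * measurableTypeR R] (f \_ H).
  exact: (measurable_restrictT f measurable_half_plane).1 mf.
have fH0 (z : measurableTypeR R * measurableTypeR R) : (0 <= (f \_ H) z)%E.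
  by rewrite patchE; case: ifPn => // /set_mem; exact: f0.
have E t zeta : (f \_ H) (t, zeta) =
    ((fun y => f (t, y)) \_ `]0, +oo[%classic) zeta.
  rewrite !patchE; congr (if _ then _ else _).
  apply/idP/idP => /set_mem; rewrite ?half_planeE /= ?in_itv /= ?andbT => z0;
    by apply/mem_set; rewrite ?half_planeE /= ?in_itv /= ?andbT.
have EF t : fubini_F leb (f \_ H) t = (\int[leb]_(zeta in `]0%R, +oo[) f (t, zeta))%E.
  rewrite /fubini_F [RHS]integral_mkcond.
  by apply: eq_integral => zeta _; rewrite E.
rewrite integral_mkcond; split.
- rewrite -(funext EF); exact: (@measurable_fun_fubini_tonelli_F _ _ _ _ _ leb _ mfH fH0).
- apply: etrans (@fubini_tonelli2 _ _ _ _ _ leb leb _ mfH fH0) _.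
  rewrite [RHS]integral_mkcond.
  apply: eq_integral => zeta _; rewrite /fubini_G patchE.
  case: ifPn => z0.
    by apply: eq_integral => t _; rewrite E patchE z0.
  by rewrite integral0_eq// => t _; rewrite E patchE (negbTE z0).
- apply: etrans (@fubini_tonelli1 _ _ _ _ _ leb leb _ mfH fH0) _.
  by apply: eq_integral => t _; exact: EF.
Qed.

Variable L : saft_param R.
Local Notation A := (sA L).
Local Notation B := (sB L).
Local Notation p := (sp L).
Hypothesis hB : B != 0.
Implicit Types psi g : R -> R[i].

(** Joint measurability makes the transform measurable as an integral with parameters. As [Num.sqrt]
    and the inverse are total, it holds on the whole plane and not only for [zeta > 0]. *)
Lemma cmeasurable_wavelet_pairing psi g : L2R psi -> cmeasurable_fun setT g ->
  cmeasurable_fun [set: (measurableTypeR R * measurableTypeR R) * measurableTypeR R]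
    (fun z => g z.2 * conjc (wavelet L psi z.1.1 z.1.2 z.2)).
Proof.
move=> [mpsi _] mg.
have m1 : measurable_fun [set: (R * R) * R] (fun z => z.1.1).
  exact: (measurableT_comp measurable_fst measurable_fst).
have m2 : measurable_fun [set: (R * R) * R] (fun z => z.1.2).
  exact: (measurableT_comp measurable_snd measurable_fst).
have m3 : measurable_fun [set: (R * R) * R] (fun z => z.2) by exact: measurable_snd.
apply: cmeasurable_funM.
  by case: mg => gr gi; split; [exact: (measurableT_comp gr m3)|exact: (measurableT_comp gi m3)].
apply: cmeasurable_conjc; rewrite /wavelet.
apply: cmeasurable_funM; last first.
  apply: cmeasurable_expi; apply: measurable_funM; last exact: measurable_cst.
  apply: measurable_funM; last exact: measurable_funB.
  by apply: measurable_funM => //; exact: measurable_cst.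
apply: cmeasurable_funM.
  apply: cmeasurable_funM; first exact: cmeasurable_cst.
  have -> : (fun z : R * R * R => ((Num.sqrt z.1.2)%:C)^-1) =
      (fun z : R * R * R => ((Num.sqrt z.1.2)^-1)%:C).
    by apply/funext => z; rewrite fmorphV.
  apply: cmeasurable_real; apply: (measurableT_comp measurable_invr).
  apply: (measurableT_comp _ m2); apply: continuous_measurable_fun.
  exact: sqrt_continuous.
have m4 : measurable_fun [set: (R * R) * R] (fun z => (z.2 - z.1.1) / z.1.2).
  apply: measurable_funM; first exact: measurable_funB.
  exact: (measurableT_comp measurable_invr m2).
by case: mpsi => pr pi; split; [exact: (measurableT_comp pr m4)|exact: (measurableT_comp pi m4)].
Qed.

Lemma cmeasurable_wavelet_transform psi g : L2R psi -> cmeasurable_fun setT g ->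
  cmeasurable_fun [set: measurableTypeR R * measurableTypeR R] (wavelet_transform L psi g).
Proof.
move=> Lpsi mg; have [mr mi] := cmeasurable_wavelet_pairing Lpsi mg.
split; first exact: (measurable_Rintegral leb mr).
exact: (measurable_Rintegral leb mi).
Qed.

Lemma wavelet_L2 psi t zeta : L2R psi -> 0 < zeta -> L2R (wavelet L psi t zeta).
Proof.
move=> Lpsi z0; have z1 : zeta^-1 != 0 by rewrite invr_eq0 gt_eqF.
have [Lr _] := L2_affine (- (zeta^-1 * t)) z1 Lpsi.
have [mr _] := Lr.
apply: (@L2on_dom _ _ _ leb setT measurableT _ (fun x =>
  sqnormc (K_B L / (Num.sqrt zeta)%:C) * sqnormc (psi (zeta^-1 * x + - (zeta^-1 * t))))).
- rewrite /wavelet; apply: cmeasurable_funM; last first.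
    apply: cmeasurable_expi; apply: continuous_measurable_fun => x.
    apply: cvgMr_tmp; apply: cvgM; first by apply: cvgMl_tmp; exact: cvg_id.
    by apply: cvgB; [exact: cvg_cst|exact: cvg_id].
  apply: cmeasurable_funM; first exact: cmeasurable_cst.
  have -> : (fun x => psi ((x - t) / zeta)) = (fun x => psi (zeta^-1 * x + - (zeta^-1 * t))).
    by apply/funext => x; congr psi; ring.
  exact: mr.
- by apply: integrableZE => //; exact: L2on_integrable.
- move=> x _; rewrite /wavelet !sqnormcM sqnormc_expi mulr1 le_eqVlt.
  apply/orP; left; apply/eqP; congr (_ * sqnormc (psi _)); ring.
Qed.

Lemma wavelet_transform_conv psi g t zeta : L2R psi -> L2R g -> 0 < zeta ->
  wavelet_transform L psi g (t, zeta) =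
  conjc (K_B L) * ((Num.sqrt zeta)^-1)%:C * expi (- (A * t ^+ 2 / (2 * B))) *
  conv (fun x => g x * expi (A * x ^+ 2 / (2 * B))) (chirped_window L psi zeta) t.
Proof.
move=> Lpsi Lg z0; set h := fun x => g x * expi (A * x ^+ 2 / (2 * B)).
set phi := chirped_window L psi zeta.
have Lphi : L2R phi by exact: chirped_window_L2.
have mh : cmeasurable_fun setT h.
  apply: cmeasurable_funM; first by case: Lg.
  apply: cmeasurable_expi; apply: continuous_measurable_fun => y.
  by apply: cvgMr_tmp; apply: cvgMl_tmp; exact: exprn_continuous.
have Lh : L2R h.
  apply: (@L2on_dom _ _ _ leb setT measurableT _ (fun x => sqnormc (g x))) => //.
  - exact: L2on_integrable.
  - by move=> x _; rewrite sqnormcM sqnormc_expi mulr1.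
have [Lr _] := L2_reflect t Lphi.
have n1 : (-1 : R) != 0 by rewrite oppr_eq0 oner_eq0.
have ig : CiR (fun x => h x * phi (t - x)) by exact: CintegrableM.
have -> : conv h phi t = CintR (fun x => h x * phi (t - x)).
  have := Cintegral_affine t n1 (Cintegrable_meas ig).
  rewrite normrN normr1 invr1 mul1r => <-.
  apply: eq_Cintegral => x _; have -> : -1 * x + t = t - x by ring.
  by rewrite subKr.
rewrite -CintegralZ//; apply: eq_Cintegral => x _.
rewrite /wavelet [(t, zeta).1]/= [(t, zeta).2]/= !conjcM -expiN /h /phi /chirped_window.
have -> : - zeta^-1 * (t - x) + 0 = (x - t) / zeta by ring.
have -> : conjc ((Num.sqrt zeta)%:C^-1) = ((Num.sqrt zeta)^-1)%:C.
  by rewrite conjc_inv conjc_real fmorphV.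
(* From [- 2 x (t - x) = - t^2 + x^2 + (t - x)^2] the phase separates into functions of [t], of [x]
   and of [t - x], which is what makes the transform a convolution. *)
have -> : - (A * x * (t - x) / B) = - (A * t ^+ 2 / (2 * B)) +
    (A * x ^+ 2 / (2 * B) + A * (t - x) ^+ 2 / (2 * B)) by field.
rewrite !expiD; ring.
Qed.

Lemma sqnormc_wavelet_transform psi g t zeta : L2R psi -> L2R g -> 0 < zeta ->
  sqnormc (wavelet_transform L psi g (t, zeta)) =
  (2 * pi * `|B| * zeta)^-1 *
  sqnormc (conv (fun x => g x * expi (A * x ^+ 2 / (2 * B))) (chirped_window L psi zeta) t).
Proof.
move=> Lpsi Lg z0; rewrite wavelet_transform_conv// !sqnormcM sqnormc_expi sqnormcJ mulr1.
by rewrite sqnormc_K_B// sqnormc_real exprVn sqr_sqrtr ?ltW// -invfM.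
Qed.

(** The integrand is nonnegative, so for [c < 0] the equality would fail at every [w], and the line
    is not a null set. *)
Lemma admissibility_constant_ge0 (c : R) (G : R * R -> R[i]) :
  {ae leb, forall w, admissibility_integral G w = c%:E} -> 0 <= c.
Proof.
move=> aeG; have [N [mN N0 sub]] := aeG.
apply: contrapT => /negP; rewrite -ltNge => cn.
have : (leb setT <= leb N)%E.
  apply: le_measure; rewrite ?inE//.
  move=> w _; apply: sub => /= h1; move: cn.
  rewrite -lte_fin -h1 ltNge; apply/negP; rewrite negbK.
  apply: integral_ge0 => y; rewrite /= in_itv /= andbT => y0.
  by rewrite lee_fin divr_ge0 ?sqnormc_ge0// ltW.
by rewrite N0 -set_itvNyy lebesgue_measure_itv.
Qed.

Lemma wavelet_transform_isometry_test psi g (c : R) (G : R * R -> R[i]) :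
  L2R psi -> L2R g -> test_fun (fun x => g x * expi (A * x ^+ 2 / (2 * B))) ->
  is_saft_Psi L psi G -> {ae leb, forall w, admissibility_integral G w = c%:E} ->
  (\int[mu2]_(z in H) (sqnormc (wavelet_transform L psi g z) / z.2 ^+ 2)%:E =
   (c * nrm2R g)%:E)%E.
Proof.
move=> Lpsi Lg; set h := fun x => g x * expi (A * x ^+ 2 / (2 * B)) => th [mG sG] aeG.
have p0 : 0 < (pi : R) := pi_gt0 R.
have Bp : 0 < `|B| by rewrite normr_gt0.
have mW := cmeasurable_wavelet_transform Lpsi (proj1 Lg).
have msq : measurable_fun setT (fun z : R * R => z.2 ^- 2).
  apply: (measurableT_comp measurable_invr).
  by apply: measurable_funX; exact: measurable_snd.
have mf1 : measurable_fun (H : set (measurableTypeR R * measurableTypeR R))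
    (fun z => (sqnormc (wavelet_transform L psi g z) / z.2 ^+ 2)%:E).
  apply: measurable_funTS; apply/measurable_EFinP; apply: measurable_funM => //.
  exact: measurable_sqnormc.
(* The frequency-side density: for each [zeta] its integral over [xi] is that of the weighted
   squared transform over [t], and for almost every [xi] its integral over [zeta] is [c / (2 pi)]
   times [sqnormc (fourier h xi)]. *)
pose Phi (z : R * R) := ((2 * pi * z.2)^-1 *
   sqnormc (fourier h z.1 * G (z.2 * (B * z.1 + p), z.2)))%:E.
have mfh : cmeasurable_fun setT (fourier h).
  by apply: cmeasurable_fourier; exact: test_fun_cmeasurable.
have mPhi : measurable_fun (H : set (measurableTypeR R * measurableTypeR R)) Phi.
  apply/measurable_EFinP; apply: measurable_funM.
    apply: measurable_funTS; apply: (measurableT_comp measurable_invr).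
    by apply: measurable_funM; [exact: measurable_cst|exact: measurable_snd].
  apply: measurable_sqnormc; apply: cmeasurable_funM.
    case: mfh => fr fi; split; apply: measurable_funTS.
      exact: (measurableT_comp fr measurable_fst).
    exact: (measurableT_comp fi measurable_fst).
  have mm : measurable_fun (H : set (measurableTypeR R * measurableTypeR R))
      (fun z : R * R => (z.2 * (B * z.1 + p), z.2)).
    apply: measurable_funTS; apply/measurable_fun_pairP; split => /=.
      apply: measurable_funM; first exact: measurable_snd.
      apply: measurable_funD; last exact: measurable_cst.
      by apply: measurable_funM; [exact: measurable_cst|exact: measurable_fst].
    exact: measurable_snd.
  have sub : (fun z : R * R => (z.2 * (B * z.1 + p), z.2)) @` H `<=` H.
    by move=> _ [[t y] Hz <-]; move: Hz; rewrite /= !half_planeE.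
  case: mG => Gr Gi; split.
    exact: (measurable_comp measurable_half_plane sub Gr mm).
  exact: (measurable_comp measurable_half_plane sub Gi mm).
have zpos z : H z -> 0 < z.2 by case: z => t y; rewrite half_planeE.
have Phi0 z : H z -> (0 <= Phi z)%E.
  move=> /zpos z0; rewrite lee_fin mulr_ge0 ?sqnormc_ge0// invr_ge0.
  by rewrite !mulr_ge0// ltW.
have W0 (z : R * R) : H z -> (0 <= (sqnormc (wavelet_transform L psi g z) / z.2 ^+ 2)%:E)%E.
  by move=> _; rewrite lee_fin divr_ge0 ?sqnormc_ge0 ?sqr_ge0.
have [_ -> _] := half_plane_Tonelli mf1 W0.
transitivity (\int[mu2]_(z in H) Phi z)%E.
  have [_ -> _] := half_plane_Tonelli mPhi Phi0.
  apply: eq_integral => zeta /set_mem; rewrite /= in_itv /= andbT => z0.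
  have Lphi : L2R (chirped_window L psi zeta) by exact: chirped_window_L2.
  have [_ _ _ [M h0]] := th.
  have h0' x : `|M| < `|x| -> h x = 0.
    by move=> xM; apply: h0; rewrite (le_lt_trans (ler_norm _)).
  have [Lc _] := conv_L2 (test_fun_L2 th) (normr_ge0 M) h0' Lphi.
  transitivity (((2 * pi * `|B| * zeta ^+ 3)^-1 * nrm2R (conv h (chirped_window L psi zeta)))%:E)%E.
    rewrite EFinM nrm2E// -ge0_integralZl_EFin//.
    - apply: eq_integral => t _; rewrite -EFinM /= sqnormc_wavelet_transform//.
      by congr EFin; rewrite mulrAC -invfM; congr (_^-1 * _); ring.
    - by move=> t _; rewrite lee_fin sqnormc_ge0.
    - by apply/measurable_EFinP/measurable_sqnormc; case: Lc.
    - by rewrite invr_ge0 !mulr_ge0// ?exprn_ge0// ltW.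
  have := integral_fourier_saft hB Lpsi z0 (sG _ z0) th => E.
  transitivity (((2 * pi * zeta)^-1)%:E * (\int[leb]_xi
    (sqnormc (fourier h xi * G (zeta * (B * xi + p), zeta)))%:E))%E.
    rewrite E -EFinM; congr EFin; move: (pi : R) p0 => P P0.
    by field; rewrite !gt_eqF.
  rewrite -ge0_integralZl_EFin//.
  - by move=> xi _; rewrite lee_fin sqnormc_ge0.
  - apply/measurable_EFinP; apply: measurable_sqnormc; apply: cmeasurable_funM => //.
    have -> : (fun xi => G (zeta * (B * xi + p), zeta)) =
      (fun xi => (fun w => G (w, zeta)) ((zeta * B) * xi + zeta * p)).
      by apply/funext => xi; congr (G (_, _)); ring.
    apply: (@cmeasurable_affine _ (fun w => G (w, zeta))).
    by case: (sG _ z0).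
  - by rewrite invr_ge0 !mulr_ge0// ltW.
have [mI _ ->] := half_plane_Tonelli mPhi Phi0.
have nh : nrm2R h = nrm2R g.
  by apply: eq_Rintegral => x _; rewrite sqnormcM sqnormc_expi mulr1.
have B1 : B != 0 by [].
(* The admissibility integral is evaluated at [w = B xi + p]; since [B] is nonzero, the exceptional
   [w] come from a null set of [xi]. *)
have aeG' := ae_affine p B1 aeG.
have msF : measurable_fun setT (fun xi => sqnormc (fourier h xi)) by exact: measurable_sqnormc.
transitivity (\int[leb]_xi ((c / (2 * pi))%:E * (sqnormc (fourier h xi))%:E))%E; last first.
  have c0 : 0 <= c by exact: admissibility_constant_ge0 aeG.
  rewrite ge0_integralZl_EFin//.
  - rewrite Plancherel// -EFinM nh; congr EFin.
    by move: (pi : R) p0 => P P0; field; rewrite gt_eqF.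
  - by move=> xi _; rewrite lee_fin sqnormc_ge0.
  - exact/measurable_EFinP.
  - by rewrite divr_ge0// mulr_ge0// ltW.
apply: ae_eq_integral => //.
- by apply: measurable_funeM; exact/measurable_EFinP.
have [N [mN N0 sub]] := aeG'; exists N; split => // xi nE; apply: sub => Exi; apply: nE => _.
rewrite muleC EFinM muleCA -Exi /admissibility_integral.
rewrite muleC -EFinM -ge0_integralZl_EFin//.
- apply: eq_integral => zeta _; rewrite /Phi /= -EFinM; congr EFin.
  by rewrite sqnormcM invfM; ring.
- move=> zeta; rewrite /= in_itv /= andbT => z0.
  by rewrite lee_fin divr_ge0 ?sqnormc_ge0// ltW.
- have mm : measurable_fun (`]0%R, +oo[%classic : set (measurableTypeR R))
      (fun y : R => (y * (B * xi + p), y)).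
    apply: measurable_funTS; apply/measurable_fun_pairP; split => /=.
      by apply: measurable_funM => //; exact: measurable_cst.
    exact: measurable_id.
  have sub' : (fun y : R => (y * (B * xi + p), y)) @` `]0%R, +oo[%classic `<=` H.
    by move=> _ [y Hy <-]; move: Hy; rewrite /= half_planeE in_itv /= andbT.
  apply/measurable_EFinP; apply: (@measurable_funM _ (measurableTypeR R) R _
    (fun y => sqnormc (G (y * (B * xi + p), y))) (fun y => y^-1)).
    apply: measurable_sqnormc; case: mG => Gr Gi; split.
      exact: (measurable_comp measurable_half_plane sub' Gr mm).
    exact: (measurable_comp measurable_half_plane sub' Gi mm).
  by apply: measurable_funTS; exact: measurable_invr.
- by rewrite mulr_ge0 ?sqnormc_ge0// invr_ge0 mulr_ge0// ltW.
Qed.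

End HalfPlane.

(** * Density of test functions *)

Section Density.
Context (R : realType).
Local Notation leb := (@lebesgue_measure R).
Local Notation L2R := (L2on leb setT).
Local Notation nrm2R := (nrm2 leb setT).
Local Notation CiR := (Cintegrable leb setT).

Definition clamp (M y : R) : R := Num.max (- M) (Num.min M y).

Lemma clamp_bounded M y : 0 <= M -> `|clamp M y| <= M.
Proof.
move=> M0; rewrite /clamp ler_norml; apply/andP; split.
  by rewrite le_max lexx.
by rewrite ge_max ge_min lexx /= andbT; lra.
Qed.

Lemma clamp_id M y : `|y| <= M -> clamp M y = y.
Proof.
by rewrite ler_norml => /andP[y1 y2]; rewrite /clamp min_r// max_r.
Qed.

Lemma clamp_contract M y x : `|x| <= M -> `|clamp M y - x| <= `|y - x|.
Proof.
rewrite ler_norml => /andP[x1 x2]; rewrite /clamp.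
have [yM|My] := leP M y.
  rewrite max_r; last by lra.
  by rewrite !ger0_norm; lra.
have [yM'|My'] := leP (- M) y; first by [].
by rewrite !ler0_norm; lra.
Qed.

Lemma continuous_clamp M : continuous (clamp M).
Proof.
move=> y; apply: (@continuous_max _ _ (fun=> - M) (fun y => Num.min M y)).
  exact: cvg_cst.
by apply: (@continuous_min _ _ (fun=> M) id); [exact: cvg_cst|exact: cvg_id].
Qed.

Definition tent (N x : R) : R := Num.max 0 (Num.min 1 (N + 1 - `|x|)).

Lemma continuous_tent N : continuous (tent N).
Proof.
move=> y; apply: (@continuous_max _ _ (fun=> 0) (fun y => Num.min 1 (N + 1 - `|y|))).
  exact: cvg_cst.
apply: (@continuous_min _ _ (fun=> 1) (fun y => N + 1 - `|y|)); first exact: cvg_cst.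
by apply: cvgB; [exact: cvg_cst|exact: norm_continuous].
Qed.

Lemma tent_ge0 N x : 0 <= tent N x. Proof. by rewrite le_max lexx. Qed.
Lemma tent_le1 N x : tent N x <= 1.
Proof. by rewrite ge_max ler01 ge_min lexx. Qed.
Lemma tent1 N x : `|x| <= N -> tent N x = 1.
Proof. by move=> xN; rewrite /tent min_l ?max_r//; lra. Qed.
Lemma tent0 N x : N + 1 < `|x| -> tent N x = 0.
Proof. by move=> xN; rewrite /tent min_r ?max_l//; lra. Qed.

(** Approximation in L1 becomes approximation in L2 because both functions are bounded by [M],
    whence [(v - f)^2 <= 2 M |v - f|]. Clamping and the tent cutoff enforce bound and support
    without moving further away from [f]. *)
Lemma continuous_approx_bounded (f : R -> R) (M N e : R) : 0 < M -> 0 <= N -> 0 < e ->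
  measurable_fun setT f -> (forall x, `|f x| <= M) -> (forall x, N < `|x| -> f x = 0) ->
  exists v : R -> R, [/\ continuous v, (forall x, `|v x| <= M),
    (forall x, N + 1 < `|x| -> v x = 0) &
    (\int[leb]_x ((v x - f x) ^+ 2)%:E <= e%:E)%E].
Proof.
move=> M0 N0 e0 mf fM f0; pose E := (`[- (N + 1), N + 1]%classic : set R).
have mE : measurable (E : set (measurableTypeR R)) by exact: measurable_itv.
have Efin : (leb E < +oo)%E.
  by rewrite /E lebesgue_measure_itv /=; case: ifP => _; rewrite ?ltry// -EFinB ltry.
have fi : leb.-integrable E (EFin \o f).
  apply: measurable_bounded_integrable => //; first exact: measurable_funTS.
  by exists M; split; rewrite ?num_real // => y My x _; exact: le_trans (fM x) (ltW My).
have [g [cg ig]] := approximation_continuous_integrable mE Efin fi.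
move=> /fine_cvgP[gfin /cvgrPdist_lt /(_ (e / (2 * M)))].
rewrite divr_gt0 ?mulr_gt0// => /(_ isT) gl.
have [k _ /(_ k (leqnn _)) [gk1 gk2]] := filterI gfin gl.
have {gk2}gk : (\int[leb]_(x in E) `|(f x - g k x)%:E| < (e / (2 * M))%:E)%E.
  move: gk2; rewrite /= sub0r normrN => gk2; rewrite -(fineK gk1) lte_fin.
  exact: le_lt_trans (ler_norm _) gk2.
pose v x := tent N x * clamp M (g k x).
have cv : continuous v.
  move=> x; apply: cvgM; first exact: continuous_tent.
  by apply: (@continuous_comp _ _ _ (g k) (clamp M)); [exact: cg|exact: continuous_clamp].
have vM x : `|v x| <= M.
  rewrite normrM ger0_norm ?tent_ge0// -[leRHS]mul1r.
  by rewrite ler_pM ?tent_ge0 ?tent_le1// clamp_bounded// ltW.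
have v0 x : N + 1 < `|x| -> v x = 0 by move=> xN; rewrite /v tent0// mul0r.
exists v; split => //.
have vf x : E x -> `|v x - f x| <= `|f x - g k x|.
  move=> _; have [xN|xN] := leP `|x| N.
    by rewrite /v tent1// mul1r [leRHS]distrC clamp_contract.
  rewrite f0// subr0 sub0r normrN /v normrM ger0_norm ?tent_ge0//.
  rewrite (le_trans (ler_piMl _ (tent_le1 _ _)))//.
  by have := @clamp_contract M (g k x) 0; rewrite !subr0 normr0 => /(_ (ltW M0)).
have mv : measurable_fun setT v by exact: continuous_measurable_fun.
have msq : measurable_fun setT (fun x => ((v x - f x) ^+ 2)%:E).
  by apply/measurable_EFinP; apply: measurable_funX; exact: measurable_funB.
have mgf : measurable_fun E (fun x => `|(f x - g k x)%:E|%E).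
  apply: measurable_funTS; apply: measurableT_comp => //; apply/measurable_EFinP.
  by apply: measurable_funB => //; exact: continuous_measurable_fun.
apply: (@le_trans _ _ ((2 * M)%:E * \int[leb]_(x in E) `|(f x - g k x)%:E|)%E); last first.
  have M2 : 0 < 2 * M by rewrite mulr_gt0.
  apply: (@le_trans _ _ ((2 * M)%:E * (e / (2 * M))%:E)%E).
    by apply: lee_wpmul2l; [rewrite lee_fin ltW|exact: ltW].
  by rewrite -EFinM lee_fin mulrC divfK// gt_eqF.
rewrite -ge0_integralZl_EFin ?mulr_ge0 ?(ltW M0)//.
have -> : (\int[leb]_x ((v x - f x) ^+ 2)%:E = \int[leb]_(x in E) ((v x - f x) ^+ 2)%:E)%E.
  rewrite [RHS]integral_mkcond; apply: eq_integral => x _; rewrite patchE.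
  case: ifPn => // xE.
  have xN : N + 1 < `|x|.
    by rewrite ltNge; apply: contra xE => xN; rewrite inE /E /= in_itv /= -ler_norml.
  by rewrite v0// f0 ?subr0 ?expr0n//; lra.
apply: ge0_le_integral => //.
- by move=> x _; rewrite lee_fin sqr_ge0.
- exact: measurable_funTS.
- exact: measurable_funeM.
- move=> x Ex; rewrite -EFinM lee_fin -real_normK ?num_real// expr2.
  rewrite ler_pM//; last exact: vf.
  by rewrite (le_trans (ler_normB _ _))// mulrDl !mul1r lerD.
Qed.

Lemma continuous_approx_real (f : R -> R) (e : R) : 0 < e ->
  measurable_fun setT f -> (\int[leb]_x ((f x) ^+ 2)%:E < +oo)%E ->
  exists v : R -> R, [/\ continuous v, (exists M, forall x, `|v x| <= M),
    (exists N, forall x, N < `|x| -> v x = 0) &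
    (\int[leb]_x ((v x - f x) ^+ 2)%:E <= e%:E)%E].
Proof.
move=> e0 mf ff.
(* Cutting off values and support at once reduces to the bounded case; each cut moves [f x] towards
   0, so [f x ^+ 2] dominates the squared error. *)
pose g (n : nat) x := clamp n%:R (f x) * (\1_(`[- n%:R, n%:R]%classic : set R) x : R).
have mg n : measurable_fun setT (g n).
  apply: measurable_funM; last exact: measurable_indic.
  apply: measurableT_comp => //; apply: continuous_measurable_fun.
  exact: continuous_clamp.
have gle n x : `|g n x - f x| <= `|f x|.
  rewrite /g indicE; case: (_ \in _) => /=; last by rewrite mulr0 sub0r normrN.
  rewrite mulr1; have [fn|fn] := leP `|f x| n%:R; first by rewrite clamp_id// subrr normr0.
  have n0 : (0 : R) <= n%:R by [].
  move: fn; rewrite /clamp; have [f0|f0] := leP 0 (f x).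
    rewrite (ger0_norm f0) => fn; rewrite min_l ?(ltW fn)// max_r; last by lra.
    by rewrite ler0_norm; lra.
  rewrite (ltr0_norm f0) => fn; rewrite min_r; last by lra.
  by rewrite max_l ?ger0_norm; lra.
have if2 : leb.-integrable setT (EFin \o (fun x => f x ^+ 2)).
  apply/integrableP; split; first by apply/measurable_EFinP; exact: measurable_funX.
  by under eq_integral do rewrite /= ger0_norm ?sqr_ge0//.
have [] := @dominated_convergence _ _ _ leb setT measurableT
  (fun n => EFin \o (fun x => (g n x - f x) ^+ 2)) (EFin \o (fun=> 0))
  (EFin \o (fun x => f x ^+ 2)).
- move=> n; apply/measurable_EFinP; apply: measurable_funX.
  by apply: measurable_funB => //; exact: mg.
- exact/measurable_EFinP/measurable_cst.
- apply/aeW => x _; apply: cvg_EFin; first exact: nearW.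
  apply: cvg_near_cst; exists (Num.bound (`|x| + `|f x|)) => // n /= hn.
  have xn : `|x| + `|f x| <= n%:R.
    apply: ltW; apply: (lt_le_trans (archi_boundP _)); first by rewrite addr_ge0.
    by rewrite ler_nat.
  have := normr_ge0 x; have := normr_ge0 (f x) => f0 x0.
  rewrite /g clamp_id; last by lra.
  rewrite indicE mem_set ?mulr1 ?subrr ?expr0n//=.
  by rewrite in_itv /= -ler_norml; lra.
- exact: if2.
- apply/aeW => x n _ /=; rewrite lee_fin ger0_norm ?sqr_ge0//.
  by rewrite -(real_normK (num_real (f x))) -real_normK ?num_real// ler_sqr ?nnegrE.
move=> _ _; rewrite (_ : (\int[leb]_x (EFin \o (fun=> 0%R)) x = 0)%E); last by rewrite integral0.
(* Two errors of [e / 4] combine to [e] through [(a + b)^2 <= 2 a^2 + 2 b^2]. *)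
have e4 : 0 < e / 4 by rewrite divr_gt0.
move=> /fine_cvgP[gfin /cvgrPdist_lt /(_ (e / 4) e4)] gl.
have [n _ hn] := filterI gfin gl.
have [gk1 gk2] := hn n.+1 (leqnSn n).
have {gk2}gk : (\int[leb]_x ((g n.+1 x - f x) ^+ 2)%:E < (e / 4)%:E)%E.
  move: gk2; rewrite /= sub0r normrN => gk2; rewrite -[ltLHS](fineK gk1) lte_fin.
  exact: le_lt_trans (ler_norm _) gk2.
have n1 : (0 : R) < n.+1%:R by [].
have gM x : `|g n.+1 x| <= n.+1%:R.
  rewrite normrM indicE; case: (_ \in _) => /=.
    by rewrite normr1 mulr1 clamp_bounded// ltW.
  by rewrite normr0 mulr0 ltW.
have g0 x : n.+1%:R < `|x| -> g n.+1 x = 0.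
  by move=> xn; rewrite /g indicE memNset ?mulr0//= in_itv /= -ler_norml leNgt xn.
have [v [cv vM v0 vg]] := continuous_approx_bounded n1 (ltW n1) e4 (mg n.+1) gM g0.
exists v; split => //; [by exists n.+1%:R|by exists (n.+1%:R + 1)|].
have mv : measurable_fun setT v by exact: continuous_measurable_fun.
apply: (@le_trans _ _ (\int[leb]_x (2%:E * ((v x - g n.+1 x) ^+ 2)%:E +
    2%:E * ((g n.+1 x - f x) ^+ 2)%:E))%E).
  apply: ge0_le_integral => //.
  - by move=> x _; rewrite lee_fin sqr_ge0.
  - by apply/measurable_EFinP; apply: measurable_funX; exact: measurable_funB.
  - by apply: emeasurable_funD; apply: measurable_funeM; apply/measurable_EFinP;
      apply: measurable_funX; apply: measurable_funB => //; exact: mg.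
  - move=> x _; rewrite -!EFinM -EFinD lee_fin.
    have := sqr_ge0 ((v x - g n.+1 x) - (g n.+1 x - f x)); nra.
rewrite ge0_integralD//; last 4 first.
- by move=> x _; rewrite -EFinM lee_fin mulr_ge0// sqr_ge0.
- by apply: measurable_funeM; apply/measurable_EFinP; apply: measurable_funX;
    apply: measurable_funB => //; exact: mg.
- by move=> x _; rewrite -EFinM lee_fin mulr_ge0// sqr_ge0.
- by apply: measurable_funeM; apply/measurable_EFinP; apply: measurable_funX;
    apply: measurable_funB => //; exact: mg.
rewrite !ge0_integralZl_EFin//; last 4 first.
- by move=> x _; rewrite lee_fin sqr_ge0.
- by apply/measurable_EFinP; apply: measurable_funX; apply: measurable_funB => //; exact: mg.
- by move=> x _; rewrite lee_fin sqr_ge0.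
- by apply/measurable_EFinP; apply: measurable_funX; apply: measurable_funB => //; exact: mg.
apply: (@le_trans _ _ (2%:E * (e / 4)%:E + 2%:E * (e / 4)%:E)%E).
  by apply: leeD; apply: lee_wpmul2l => //; exact: ltW.
by rewrite -!EFinM -EFinD lee_fin; lra.
Qed.

Lemma test_fun_dense (g : R -> R[i]) (e : R) : L2R g -> 0 < e ->
  exists2 u, test_fun u & nrm2R (fun x => u x - g x) <= e.
Proof.
move=> Lg e0; have [[mr mi] gfin] := Lg.
have e2 : 0 < e / 2 by rewrite divr_gt0.
have msq := measurable_sqnormc (proj1 Lg).
have fr : (\int[leb]_x ((Re (g x)) ^+ 2)%:E < +oo)%E.
  apply: le_lt_trans gfin; apply: ge0_le_integral => //.
  - by move=> x _; rewrite lee_fin sqr_ge0.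
  - by apply/measurable_EFinP; exact: measurable_funX.
  - exact/measurable_EFinP.
  - by move=> x _; rewrite lee_fin /sqnormc lerDl sqr_ge0.
have fi : (\int[leb]_x ((Im (g x)) ^+ 2)%:E < +oo)%E.
  apply: le_lt_trans gfin; apply: ge0_le_integral => //.
  - by move=> x _; rewrite lee_fin sqr_ge0.
  - by apply/measurable_EFinP; exact: measurable_funX.
  - exact/measurable_EFinP.
  - by move=> x _; rewrite lee_fin /sqnormc lerDr sqr_ge0.
have [v [cv [M vM] [N v0] vg]] := continuous_approx_real e2 mr fr.
have [w [cw [M' wM] [N' w0] wg]] := continuous_approx_real e2 mi fi.
have tu : test_fun (fun x => v x +i* w x).
  split => //=.
    exists (M ^+ 2 + M' ^+ 2) => x; rewrite /sqnormc /=.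
    have M0 : 0 <= M by apply: le_trans (vM x).
    have M'0 : 0 <= M' by apply: le_trans (wM x).
    rewrite lerD// -(real_normK (num_real _)) ler_sqr ?nnegrE//.
  exists (`|N| + `|N'|) => x xN.
  have := ler_norm N; have := ler_norm N'; have := normr_ge0 N; have := normr_ge0 N' => *.
  by rewrite v0 ?w0//; lra.
exists (fun x => v x +i* w x) => //.
have Ld : L2R (fun x => (v x +i* w x) - g x) by apply: L2onB => //; exact: test_fun_L2.
have mv : measurable_fun setT v by exact: continuous_measurable_fun.
have mw : measurable_fun setT w by exact: continuous_measurable_fun.
rewrite -lee_fin nrm2E//.
apply: (@le_trans _ _ ((e / 2)%:E + (e / 2)%:E)%E); last first.
  by rewrite -EFinD lee_fin; lra.
apply: le_trans (leeD vg wg); rewrite -ge0_integralD//; last 4 first.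
- by move=> x _; rewrite lee_fin sqr_ge0.
- by apply/measurable_EFinP; apply: measurable_funX; exact: measurable_funB.
- by move=> x _; rewrite lee_fin sqr_ge0.
- by apply/measurable_EFinP; apply: measurable_funX; exact: measurable_funB.
rewrite le_eqVlt; apply/orP; left; apply/eqP; apply: eq_integral => x _.
by rewrite -EFinD /sqnormc !(cReD, cImD, cReN, cImN).
Qed.

Lemma test_funB (u v : R -> R[i]) : test_fun u -> test_fun v ->
  test_fun (fun x => u x - v x).
Proof.
move=> [ur ui [M uM] [N u0]] [vr vi [M' vM] [N' v0]]; split.
- by under eq_fun do rewrite cReD cReN; move=> x; apply: cvgB; [exact: ur|exact: vr].
- by under eq_fun do rewrite cImD cImN; move=> x; apply: cvgB; [exact: ui|exact: vi].
- exists (2 * M + 2 * M') => x; apply: (le_trans (sqnormcD_le _ _)).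
  by rewrite sqnormcN lerD// ler_wpM2l.
- exists (`|N| + `|N'|) => x xN.
  have := ler_norm N; have := ler_norm N'; have := normr_ge0 N; have := normr_ge0 N' => *.
  by rewrite u0 ?v0 ?subrr//; lra.
Qed.

End Density.

(** * The isometry *)

Section Isometry.
Context (R : realType).
Local Notation leb := (@lebesgue_measure R).
Local Notation L2R := (L2on leb setT).
Local Notation nrm2R := (nrm2 leb setT).
Local Notation mu2 := (@plane_measure R).
Local Notation H := (@half_plane R : set (measurableTypeR R * measurableTypeR R)).
Local Notation L2H := (L2on mu2 H).
Local Notation nrm2H := (nrm2 mu2 H).

Lemma cvg_sqnormc (u : nat -> R[i]) (z : R[i]) :
  (fun n => sqnormc (u n - z)) @ \oo --> (0 : R) ->
  (fun n => sqnormc (u n)) @ \oo --> sqnormc z.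
Proof.
move=> h; have hs : (fun n => Num.sqrt (sqnormc (u n - z))) @ \oo --> (0 : R).
  by rewrite -sqrtr0; apply: continuous_cvg => //; exact: sqrt_continuous.
have key (v : nat -> R) (l : R) : (forall n, (v n - l) ^+ 2 <= sqnormc (u n - z)) ->
    (fun n => v n ^+ 2) @ \oo --> l ^+ 2.
  move=> vl; have vc : v @ \oo --> l.
    apply/subr_cvg0/norm_cvg0P.
    apply: (squeeze_cvgr _ (@cvg_cst _ (0 : R) _ _ _) hs).
    by apply: nearW => n; rewrite normr_ge0 /= -sqrtr_sqr ler_wsqrtr.
  by under eq_fun do rewrite expr2; rewrite expr2; exact: cvgM.
rewrite /sqnormc; apply: cvgD; apply: key => n.
  by rewrite /sqnormc !(cReD, cReN) lerDl sqr_ge0.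
by rewrite /sqnormc !(cImD, cImN) lerDr sqr_ge0.
Qed.

Lemma limn_einf_le_ub (u : nat -> \bar R) (b : \bar R) :
  (forall n, u n <= b)%E -> (limn_einf u <= b)%E.
Proof.
move=> ub; rewrite limn_einf_lim; apply: lime_le; first exact: is_cvg_einfs.
apply: nearW => n; apply: le_trans (ub n).
by apply: ereal_inf_lbound; exists n => /=.
Qed.

Variable L : saft_param R.
Local Notation A := (sA L).
Local Notation B := (sB L).
Hypothesis hB : B != 0.
Variable psi : R -> R[i].
Hypothesis Lpsi : L2R psi.

Let W := wavelet_transform L psi.

(* Dividing by [zeta] turns the weight [zeta ^- 2] of the half-plane into plain
   Lebesgue measure. *)
Definition weighted (f : R * R -> R[i]) (z : R * R) : R[i] := f z * (z.2^-1)%:C.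

Lemma sqnormc_weighted f z : sqnormc (weighted f z) = sqnormc (f z) / z.2 ^+ 2.
Proof. by rewrite sqnormcM sqnormc_real exprVn. Qed.

Lemma half_plane_gt0 (z : R * R) : half_plane z -> 0 < z.2.
Proof. by case: z => t y; rewrite half_planeE. Qed.

Lemma wavelet_transformE g z : W g z = dotp leb setT g (wavelet L psi z.1 z.2).
Proof. by []. Qed.

Lemma wavelet_transform_linear f g (s : R[i]) z : half_plane z -> L2R f -> L2R g ->
  W (fun x => f x + s * g x) z = W f z + s * W g z.
Proof.
move=> /half_plane_gt0 z0 Lf Lg; have Lw := wavelet_L2 L z.1 Lpsi z0.
by rewrite !wavelet_transformE dotpDl ?dotpZl//; exact: L2onZ.
Qed.

Lemma wavelet_transformB f g z : half_plane z -> L2R f -> L2R g ->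
  W (fun x => f x - g x) z = W f z - W g z.
Proof.
move=> Hz Lf Lg; rewrite -[X in _ - X]mul1r -mulNr -wavelet_transform_linear//.
by congr (W _ z); apply/funext => x; ring.
Qed.

Lemma cmeasurable_weighted_wavelet g : cmeasurable_fun setT g ->
  cmeasurable_fun H (weighted (W g)).
Proof.
move=> mg; have [mr mi] := cmeasurable_wavelet_transform L Lpsi mg.
apply: cmeasurable_funM; first by split; exact: measurable_funTS.
apply: cmeasurable_real; apply: measurable_funTS.
exact: (measurableT_comp (@measurable_invr R) measurable_snd).
Qed.

Variables (c : R) (G : R * R -> R[i]).
Hypothesis sG : is_saft_Psi L psi G.
Hypothesis aeG : {ae leb, forall w, admissibility_integral G w = c%:E}.

Let ch x : R[i] := expi (A * x ^+ 2 / (2 * B)).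

Let mch : cmeasurable_fun setT ch.
Proof.
apply: cmeasurable_expi; apply: continuous_measurable_fun => y.
by apply: cvgMr_tmp; apply: cvgMl_tmp; exact: exprn_continuous.
Qed.

Let L2_unimodular (g k : R -> R[i]) : L2R g -> cmeasurable_fun setT k ->
  (forall x, sqnormc (k x) = 1) -> L2R (fun x => g x * k x).
Proof.
move=> Lg mk k1; apply: (@L2on_dom _ _ _ leb setT measurableT _ (fun x => sqnormc (g x))).
- by apply: cmeasurable_funM => //; case: Lg.
- exact: L2on_integrable.
- by move=> x _; rewrite sqnormcM k1 mulr1.
Qed.

Let isometry_test g : L2R g -> test_fun (fun x => g x * ch x) ->
  L2H (weighted (W g)) /\ nrm2H (weighted (W g)) = c * nrm2R g.
Proof.
move=> Lg tg; have := wavelet_transform_isometry_test hB Lpsi Lg tg sG aeG.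
move=> E; have E' : (\int[mu2]_(z in H) (sqnormc (weighted (W g) z))%:E =
    (c * nrm2R g)%:E)%E.
  by rewrite -E; apply: eq_integral => z _; rewrite sqnormc_weighted.
have LW : L2H (weighted (W g)).
  split; first by apply: cmeasurable_weighted_wavelet; case: Lg.
  by rewrite E' ltry.
by split => //; apply: EFin_inj; rewrite nrm2E// ; exact: measurable_half_plane.
Qed.

(** Differences of the approximants are again covered by [isometry_test], so their transforms form a
    Cauchy sequence. At each point of the half-plane these transforms converge to that of [g], by
    Cauchy-Schwarz against the wavelet; Fatou's lemma thus bounds their distance to the transform of
    [g] itself. *)
Lemma wavelet_transform_isometry g : L2R g ->
  L2H (weighted (W g)) /\ nrm2H (weighted (W g)) = c * nrm2R g.
Proof.
move=> Lg; have c0 := admissibility_constant_ge0 aeG.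
have mH := @measurable_half_plane R.
have Lh : L2R (fun x => g x * ch x).
  by apply: L2_unimodular => // x; exact: sqnormc_expi.
have ex n : exists u, test_fun u /\ nrm2R (fun x => u x - g x * ch x) <= n.+1%:R^-1.
  have [|u tu ug] := @test_fun_dense _ _ (n.+1%:R^-1) Lh; first by rewrite invr_gt0.
  by exists u.
pose u n := projT1 (cid (ex n)).
have tu n : test_fun (u n) by case: (projT2 (cid (ex n))).
have un n : nrm2R (fun x => u n x - g x * ch x) <= n.+1%:R^-1 by case: (projT2 (cid (ex n))).
(* The approximation takes place after multiplication by the chirp; its conjugate undoes this
   without changing norms. *)
pose g_ n x := u n x * conjc (ch x).
have chch x : conjc (ch x) * ch x = 1.
  by rewrite mulrC mulcJ sqnormc_expi.
have gch n x : g_ n x * ch x = u n x by rewrite /g_ -mulrA chch mulr1.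
have Lg_ n : L2R (g_ n).
  apply: L2_unimodular; first exact: test_fun_L2.
    exact: cmeasurable_conjc.
  by move=> x; rewrite sqnormcJ sqnormc_expi.
have gn n : nrm2R (fun x => g_ n x - g x) <= n.+1%:R^-1.
  apply: le_trans (un n); rewrite le_eqVlt; apply/orP; left; apply/eqP.
  apply: eq_Rintegral => x _; rewrite -gch -mulrBl sqnormcM sqnormc_expi mulr1//.
have cvg0 : (fun n => nrm2R (fun x => g_ n x - g x)) @ \oo --> (0 : R).
  apply: (squeeze_cvgr _ (@cvg_cst _ (0 : R) _ _ _) (@cvg_harmonic R)).
  by apply: nearW => n; rewrite nrm2_ge0 /=; exact: gn.
have tgn n : test_fun (fun x => g_ n x * ch x) by rewrite (funext (gch n)).
have iso n : L2H (weighted (W (g_ n))) /\ nrm2H (weighted (W (g_ n))) = c * nrm2R (g_ n).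
  exact: isometry_test.
have dist m n : nrm2H (fun z => weighted (W (g_ m)) z - weighted (W (g_ n)) z) =
    c * nrm2R (fun x => g_ m x - g_ n x).
  have Ld : L2R (fun x => g_ m x - g_ n x) by exact: L2onB.
  have td : test_fun (fun x => (g_ m x - g_ n x) * ch x).
    have -> : (fun x => (g_ m x - g_ n x) * ch x) = (fun x => u m x - u n x).
      by apply/funext => x; rewrite mulrBl !gch.
    exact: test_funB.
  have [_ <-] := isometry_test Ld td.
  apply: eq_Rintegral => z /set_mem Hz.
  by rewrite /weighted wavelet_transformB// mulrBl.
have mWg : cmeasurable_fun H (weighted (W g)).
  by apply: cmeasurable_weighted_wavelet; case: Lg.
(* The constant 4 arises from [sqnormcD_le]: twice the error of [g_ n] plus twice that of a later
   approximant, each at most [n.+1%:R^-1]. *)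
have bound n : L2H (fun z => weighted (W (g_ n)) z - weighted (W g) z) /\
    nrm2H (fun z => weighted (W (g_ n)) z - weighted (W g) z) <= c * (4 * n.+1%:R^-1).
  have md : cmeasurable_fun H (fun z => weighted (W (g_ n)) z - weighted (W g) z).
    under eq_fun do rewrite -[X in _ - X]mul1r -mulNr.
    apply: cmeasurable_funD; first by case: (iso n) => -[].
    by apply: cmeasurable_funM => //; exact: cmeasurable_cst.
  apply: L2on_le => //.
  (* Fatou is applied in [m] with [n] fixed, the later approximant playing the role of the limit. *)
  pose f m z := (sqnormc (weighted (W (g_ n)) z - weighted (W (g_ (n + m)%N)) z))%:E.
  have mf m : measurable_fun H (f m).
    apply/measurable_EFinP; apply: measurable_sqnormc.
    by case: (L2onB mH (iso n).1 (iso (n + m)%N).1).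
  have f0 m z : H z -> (0 <= f m z)%E by rewrite lee_fin sqnormc_ge0.
  have fm m : (\int[mu2]_(z in H) f m z <= (c * (4 * n.+1%:R^-1))%:E)%E.
    have LB := L2onB mH (iso n).1 (iso (n + m)%N).1.
    rewrite -(nrm2E mH LB) lee_fin dist ler_wpM2l//.
    have -> : (fun x => g_ n x - g_ (n + m)%N x) =
       (fun x => (g_ n x - g x) + - (g_ (n + m)%N x - g x)) by apply/funext => x; ring.
    have L1 : L2R (fun x => g_ n x - g x) by exact: L2onB.
    have L2 : L2R (fun x => g_ (n + m)%N x - g x) by exact: L2onB.
    apply: (@le_trans _ _ (2 * nrm2R (fun x => g_ n x - g x) +
      2 * nrm2R (fun x => g_ (n + m)%N x - g x))).
      rewrite /nrm2 -!RintegralZl//; [|exact: L2on_integrable|exact: L2on_integrable].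
      rewrite -RintegralD//; [|by apply: integrableZE => //; exact: L2on_integrable|
        by apply: integrableZE => //; exact: L2on_integrable].
      apply: le_Rintegral => //.
      - by apply: L2on_integrable => //; exact: L2onB.
      - by apply: integrableDE => //; apply: integrableZE => //; exact: L2on_integrable.
      - by move=> x _; apply: (le_trans (sqnormcD_le _ _)); rewrite sqnormcN.
    have h1 := gn n; have h2 := gn (n + m)%N.
    have h3 : ((n + m)%N.+1%:R^-1 : R) <= n.+1%:R^-1.
      by rewrite lef_pV2 ?posrE// ler_nat ltnS leq_addr.
    have {h2 h3}h2 := le_trans h2 h3.
    rewrite (_ : 4 * _ = 2 * n.+1%:R^-1 + 2 * n.+1%:R^-1); last by ring.
    by apply: lerD; rewrite ler_wpM2l.
  have := fatou mu2 mH mf f0.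
  have -> : (\int[mu2]_(x in H) limn_einf (f^~ x) = \int[mu2]_(z in H)
      (sqnormc (weighted (W (g_ n)) z - weighted (W g) z))%:E)%E.
    apply: eq_integral => z /set_mem Hz.
    suff h : (fun m => f m z) @ \oo --> (sqnormc (weighted (W (g_ n)) z - weighted (W g) z))%:E.
      by rewrite (cvg_limn_einf_sup h).1.
    apply: cvg_EFin; first exact: nearW.
    apply: cvg_sqnormc.
    have Lw := wavelet_L2 L z.1 Lpsi (half_plane_gt0 Hz).
    have E m : sqnormc (weighted (W (g_ n)) z - weighted (W (g_ (n + m)%N)) z -
       (weighted (W (g_ n)) z - weighted (W g) z)) =
       sqnormc (W (fun x => g_ (n + m)%N x - g x) z) * z.2^-1 ^+ 2.
      rewrite -(sqnormcN (_ - _)) -sqnormc_real -sqnormcM; congr sqnormc.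
      by rewrite wavelet_transformB// /weighted; ring.
    rewrite (funext E).
    have lim : (fun m => nrm2R (fun x => g_ (n + m)%N x - g x) *
        nrm2R (wavelet L psi z.1 z.2) * z.2^-1 ^+ 2) @ \oo --> (0 : R).
      rewrite -(mul0r (z.2^-1 ^+ 2)); apply: cvgMr_tmp.
      rewrite -(mul0r (nrm2R (wavelet L psi z.1 z.2))); apply: cvgMr_tmp.
      by have := cvg0; rewrite -(cvg_shiftn n); under eq_fun do rewrite addnC.
    apply: (squeeze_cvgr _ (@cvg_cst _ (0 : R) _ _ _) lim).
    apply: nearW => m; rewrite mulr_ge0 ?sqnormc_ge0 ?sqr_ge0//=.
    rewrite ler_wpM2r ?sqr_ge0//; apply: CauchySchwarz => //; exact: L2onB.
  move=> /le_trans; apply; apply: limn_einf_le_ub => m; exact: fm.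
have LWg : L2H (weighted (W g)).
  have -> : weighted (W g) = (fun z => weighted (W (g_ 0%N)) z -
      (weighted (W (g_ 0%N)) z - weighted (W g) z)) by apply/funext => z; ring.
  by apply: L2onB => //; [case: (iso 0%N)|case: (bound 0%N)].
split => //.
have c1 : (fun n => nrm2H (weighted (W (g_ n)))) @ \oo --> nrm2H (weighted (W g)).
  apply: (nrm2_cvg mH LWg (fun n => (iso n).1)).
  have lim : (fun n => c * (4 * n.+1%:R^-1)) @ \oo --> (0 : R).
    rewrite -(mulr0 c); apply: cvgMl_tmp; rewrite -(mulr0 4); apply: cvgMl_tmp.
    exact: cvg_harmonic.
  apply: (squeeze_cvgr _ (@cvg_cst _ (0 : R) _ _ _) lim).
  by apply: nearW => n; rewrite nrm2_ge0 /=; case: (bound n).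
have c2 : (fun n => nrm2H (weighted (W (g_ n)))) @ \oo --> c * nrm2R g.
  rewrite (_ : (fun n => _) = (fun n => c * nrm2R (g_ n))); last first.
    by apply/funext => n; case: (iso n).
  by apply: cvgMl_tmp; exact: nrm2_cvg.
by rewrite -(cvg_lim _ c1)// (cvg_lim _ c2).
Qed.

End Isometry.

(** * Polarization, the adjoint of the transform, and the reproducing formula *)

Section Reproducing.
Context (R : realType).
Local Notation leb := (@lebesgue_measure R).
Local Notation L2R := (L2on leb setT).
Local Notation nrm2R := (nrm2 leb setT).
Local Notation mu2 := (@plane_measure R).
Local Notation H := (@half_plane R : set (measurableTypeR R * measurableTypeR R)).
Local Notation L2H := (L2on mu2 H).
Local Notation nrm2H := (nrm2 mu2 H).
Local Notation mH := (@measurable_half_plane R).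

Lemma ae_eq_Cintegral d (T : measurableType d) (mu : {measure set T -> \bar R})
    (D : set T) (f g : T -> R[i]) : measurable D ->
  cmeasurable_fun D f -> cmeasurable_fun D g -> f = g %[ae mu in D] ->
  Cintegral mu D f = Cintegral mu D g.
Proof.
move=> mD [fr fi] [gr gi] fg; congr (_ +i* _); congr fine;
  apply: ae_eq_integral => //; try exact/measurable_EFinP;
  by apply: filterS fg => x E Dx; rewrite E.
Qed.

(** Here [a] and [b] stand for the squared norms of [g] and [k], [t] for [sqnormc s], and [x] and
    [y] for the cross terms on the half-plane and on the line. *)
Lemma scaled_polarization (c a b x y t : R) :
  c * a + t * (c * b) + 2 * x = c * (a + t * b + 2 * y) -> x = c * y.
Proof. by move=> E; lra. Qed.

Variable L : saft_param R.
Hypothesis hB : sB L != 0.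
Variable psi : R -> R[i].
Hypothesis Lpsi : L2R psi.
Variables (c : R) (G : R * R -> R[i]).
Hypothesis sG : is_saft_Psi L psi G.
Hypothesis aeG : {ae leb, forall w, admissibility_integral G w = c%:E}.

Let W := wavelet_transform L psi.
Let isom g (Lg : L2R g) := wavelet_transform_isometry hB Lpsi sG aeG Lg.

Lemma wavelet_transform_polarized g k : L2R g -> L2R k ->
  dotp mu2 H (weighted (W g)) (weighted (W k)) = c%:C * dotp leb setT g k.
Proof.
move=> Lg Lk; have [LWg ng] := isom Lg; have [LWk nk] := isom Lk.
have key (s : R[i]) : Re (conjc s * dotp mu2 H (weighted (W g)) (weighted (W k))) =
    c * Re (conjc s * dotp leb setT g k).
  have Lsk : L2R (fun x => s * k x) by exact: L2onZ.
  have [_] := isom (L2onD measurableT Lg Lsk).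
  have -> : nrm2H (weighted (W (fun x => g x + s * k x))) =
      nrm2H (fun z => weighted (W g) z + s * weighted (W k) z).
    apply: eq_Rintegral => z /set_mem Hz.
    by rewrite /weighted /W wavelet_transform_linear// mulrDl mulrA.
  rewrite (nrm2D mH LWg (L2onZ mH s LWk)) nrm2D// (nrm2Z mH) // nrm2Z// ng nk.
  rewrite (dotpZr mH s LWg LWk) (dotpZr measurableT s Lg Lk); exact: scaled_polarization.
(* The multiplier [s = 1] compares the real parts, [s = i] the imaginary parts. *)
apply: complex_ext; rewrite ?cReZ ?cImZ.
  by have := key 1; rewrite conjc1 !mul1r.
by have := key (0 +i* 1); rewrite !cRe_conjiM.
Qed.

(** Riesz applies because Cauchy-Schwarz and the isometry bound the squared functional by
    [nrm2H F * c] times the squared norm of [k]. *)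
Lemma wavelet_transform_adjoint (F : R * R -> R[i]) : L2H F ->
  exists2 g, L2R g & forall k, L2R k ->
    dotp leb setT g k = dotp mu2 H F (weighted (W k)).
Proof.
move=> LF; pose ell k := Re (dotp mu2 H F (weighted (W k))).
have lin f g (s : R[i]) : L2R f -> L2R g ->
    dotp mu2 H F (weighted (W (fun x => f x + s * g x))) =
    dotp mu2 H F (weighted (W f)) + conjc s * dotp mu2 H F (weighted (W g)).
  move=> Lf Lg; have [LWf _] := isom Lf; have [LWg _] := isom Lg.
  rewrite -(dotpZr mH)// -(dotpDr mH LF LWf (L2onZ mH s LWg)).
  apply: eq_Cintegral => z Hz; congr (_ * conjc _).
  by rewrite /weighted /W wavelet_transform_linear// mulrDl mulrA.
have [|k Lk|g Lg gP] := @Riesz_representation _ _ _ leb setT measurableT ell (nrm2H F * c).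
- by move=> f g s Lf Lg; rewrite /ell lin// cReD conjc_real cReZ.
- have [LWk nk] := isom Lk; rewrite -mulrA -nk.
  exact: (CauchySchwarz_Re mH LF LWk).
exists g => // k Lk; apply: complex_ext; first exact: gP.
(* [Riesz_representation] matches real parts only; testing with [i k] supplies the imaginary part.
   The leading 0 gives the sum the shape required by [lin]. *)
have Lik : L2R (fun x => 0 + (0 +i* 1) * k x) by apply: L2onD => //; [exact: L2on0|exact: L2onZ].
have := gP _ Lik; rewrite /ell lin//; last exact: L2on0.
rewrite dotpDr ?dotpZr//; [|exact: L2on0|exact: L2onZ].
have [L0 n0] := isom (L2on0 leb setT).
have := gP _ (L2on0 leb setT); rewrite /ell => E.
by rewrite !cReD E => /addrI; rewrite !cRe_conjiM.
Qed.

(** By conjugate symmetry the kernel is the conjugate, at [z], of the transform of the wavelet at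
    [z']; the weight [z.2 ^- 2] is shared equally between the two [weighted] factors. *)
Lemma half_plane_integral_kernel (f : R * R -> R[i]) (z' : R * R) : half_plane z' ->
  half_plane_integral (fun z => f z *
    inner (wavelet L psi z.1 z.2) (wavelet L psi z'.1 z'.2)) =
  dotp mu2 H (weighted f) (weighted (W (wavelet L psi z'.1 z'.2))).
Proof.
move=> Hz'; have Lz' := wavelet_L2 L z'.1 Lpsi (half_plane_gt0 Hz').
apply: eq_Cintegral => z Hz; have Lz := wavelet_L2 L z.1 Lpsi (half_plane_gt0 Hz).
rewrite /weighted /W wavelet_transformE conjcM conjc_real -(dotpC measurableT Lz Lz').
rewrite -/(dotp leb setT _ _) -exprVn expr2 rmorphM.
  by rewrite mulrACA.
Qed.

End Reproducing.

Theorem theorem3p5 (R : realType) (L : saft_param R)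
    (hdet : sA L * sD L - sB L * sC L = 1) (hB : sB L != 0)
    (psi : R -> R[i]) (hpsi : L2 psi) (hadm : admissible L psi)
    (c : R) (hc : is_admissibility_constant L psi c)
    (f : R * R -> R[i]) (hf : L2_half_plane f) :
  (exists2 g : R -> R[i], L2 g &
     f = wavelet_transform L psi g %[ae @plane_measure R in @half_plane R])
  <->
  f = (fun z' => (c^-1)%:C * half_plane_integral (fun z =>
         f z * inner (wavelet L psi z.1 z.2) (wavelet L psi z'.1 z'.2)))
    %[ae @plane_measure R in @half_plane R].
Proof.
have [G sG aeG] := hc.
have isom g (Lg : L2 g) := wavelet_transform_isometry hB hpsi sG aeG Lg.
have mH := @measurable_half_plane R.
have [[fr fi] ff] := hf.
have LF : L2on (@plane_measure R) (@half_plane R : set (measurableTypeR R * measurableTypeR R))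
    (weighted f).
  split.
    apply: cmeasurable_funM => //; apply: cmeasurable_real; apply: measurable_funTS.
    exact: (measurableT_comp (@measurable_invr R) measurable_snd).
  by under eq_integral do rewrite sqnormc_weighted.
split.
  move=> [g Lg fg].
  (* This holds at every [z'], since the almost everywhere equality of [f] with the transform of [g]
     enters only under the integral. *)
  have key z' : half_plane z' -> half_plane_integral (fun z => f z *
      inner (wavelet L psi z.1 z.2) (wavelet L psi z'.1 z'.2)) =
      c%:C * wavelet_transform L psi g z'.
    move=> Hz'; rewrite half_plane_integral_kernel//.
    have Lz' := wavelet_L2 L z'.1 hpsi (half_plane_gt0 Hz').
    rewrite wavelet_transformE -(wavelet_transform_polarized hB hpsi sG aeG Lg Lz').
    have [LWz' _] := isom _ Lz'; have [LWg _] := isom _ Lg.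
    apply: ae_eq_Cintegral => //.
    - by have := dotp_Cintegrable mH LF LWz' => /Cintegrable_meas.
    - by have := dotp_Cintegrable mH LWg LWz' => /Cintegrable_meas.
    - by apply: (@filterS _ _ (ae_filter_ringOfSetsType (@plane_measure R)) _ _ _ fg) => z E Hz; rewrite /weighted E.
  (* For [c = 0] the right-hand side is 0 because [0^-1 = 0], and the isometry makes the transform
     of [g], hence [f], vanish almost everywhere. *)
  have [c0|c0] := eqVneq c 0.
    have [LWg nWg] := isom _ Lg.
    have W0 := nrm2_eq0 mH LWg; rewrite nWg c0 mul0r in W0.
    have {}W0 : \forall z \ae @plane_measure R, half_plane z ->
      weighted (wavelet_transform L psi g) z = 0 := W0 erefl.
    apply: (@filterS2 _ _ (ae_filter_ringOfSetsType (@plane_measure R)) _ _ _ _ fg W0).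
    move=> z fz Wz Hz.
    rewrite c0 invr0 mul0r fz//; have := Wz Hz => /eqP.
    rewrite mulf_eq0 => /orP[/eqP//|/eqP/complexI/eqP].
    by rewrite invr_eq0 gt_eqF// half_plane_gt0.
  apply: (@filterS _ _ (ae_filter_ringOfSetsType (@plane_measure R)) _ _ _ fg) => z fz Hz; rewrite key// mulrA -rmorphM mulVf// mul1r.
  exact: fz.
(* The preimage is [c^-1] times the adjoint image [g] of [weighted f]: pairing [g] with the wavelet
   at [z] yields the reproducing integral at [z]. This covers [c = 0] too. *)
move=> fE; have [g Lg gP] := wavelet_transform_adjoint hB hpsi sG aeG LF.
exists (fun x => (c^-1)%:C * g x); first exact: (L2onZ measurableT (c^-1)%:C Lg).
apply: (@filterS _ _ (ae_filter_ringOfSetsType (@plane_measure R)) _ _ _ fE) => z fz Hz; rewrite fz// half_plane_integral_kernel//.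
have Lz := wavelet_L2 L z.1 hpsi (half_plane_gt0 Hz).
by rewrite wavelet_transformE dotpZl// gP.
Qed.
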